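(* Let $(\mathcal{G},K)$ be a finite connected weighted graph, where $K:\mathcal{G}\times\mathcal{G}\to[0,\infty)$ is symmetric. Suppose the mobility function $\theta:\mathbb{R}^d\times\mathcal{G}\times\mathcal{G}\times[0,\infty)\times[0,\infty)\to[0,\infty)$, written $\theta_{x,g,g'}(s,t)$, satisfies either (A0), or all of (A1)–(A5), as listed in the context. Then the function $W_2$ on $\mathcal{P}_2(\mathbb{R}^d\times\mathcal{G})\times\mathcal{P}_2(\mathbb{R}^d\times\mathcal{G})$ defined by $$W_2(\mu_0,\mu_1)^2:=\inf\int_0^1\Big(\int_{\mathbb{R}^d}\sum_{g}|\nabla_x\phi_t(x,g)|^2d\mu_t(x,g)+\int_{\mathbb{R}^d}\sum_{g,g'}(\nabla_g\psi_t(x,g,g'))^2K(g,g')\,d\hat\mu_t(x,g,g')\Big)dt,$$ where the infimum is over all solutions $t\in[0,1]\mapsto(\mu_t,\nabla_x\phi_t,\nabla_g\psi_t)$ of the semi-discrete continuity equation (defined in the context), with $\phi_t,\psi_t:\mathbb{R}^d\times\mathcal{G}\to\mathbb{R}$, that start at $\mu_0$ at $t=0$ and end at $\mu_1$ at $t=1$, is a metric on $\mathcal{P}_2(\mathbb{R}^d\times\mathcal{G})$.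
   Context: $\mathcal{G}$ is a finite set; connected means that any $g,g'$ are joined by a path $g_0=g,\dots,g_m=g'$ with $K(g_l,g_{l+1})>0$. $\mathcal{P}_2(\mathbb{R}^d\times\mathcal{G})$ is the set of Borel probability measures with finite second moments; $dg$ is counting measure on $\mathcal{G}$. For $\psi:\mathbb{R}^d\times\mathcal{G}\to\mathbb{R}$, $\nabla_g\psi(x,g,g')=\psi(x,g')-\psi(x,g)$. Mobility assumptions: (A0) $\theta$ is non-zero, does not depend on $s,t$, is symmetric ($\theta_{x,g,g'}=\theta_{x,g',g}$ for all $x,g,g'$), and $\theta_{x,g,g'}$ is uniformly bounded away from zero on compact subsets of $\mathbb{R}^d\times\mathcal{G}\times\mathcal{G}$. (A1) $\theta_{x,g,g'}(s,t)=\theta_{x,g,g'}(t,s)$ for all $s,t$. (A2) $\theta_{x,g,g'}(\cdot,\cdot)$ is differentiable. (A3) $\theta_{x,g,g'}(r,t)\le\theta_{x,g,g'}(s,t)$ for all $r\le s$ and all $t$. (A4) $\theta_{x,g,g'}(\lambda s,\lambda t)=\lambda\theta_{x,g,g'}(s,t)$ for all $\lambda\ge0$ and all $s,t$. (A5) $C_{x,g,g'}:=\int_0^1\theta_{x,g,g'}(1-t,t)^{-1/2}dt$ is uniformly bounded above on compact subsets of $\mathbb{R}^d\times\mathcal{G}\times\mathcal{G}$, and $\theta_{x,g,g'}(1,1)$ is uniformly bounded away from zero on compact subsets of $\mathbb{R}^d\times\mathcal{G}\times\mathcal{G}$. For $\mu\in\mathcal{P}_2(\mathbb{R}^d\times\mathcal{G})$,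 $\hat\mu$ is the measure on $\mathbb{R}^d\times\mathcal{G}\times\mathcal{G}$ given by $d\hat\mu=\theta_{x,g,g'}\,dx\,dg\,dg'$ in case (A0), and by $d\hat\mu=\theta_{x,g,g'}(\mu_{g|x}(g),\mu_{g|x}(g'))\,d\mu_x(x)\,dg\,dg'$ in case (A1)–(A5), where $\mu_x$ is the marginal of $\mu$ on $\mathbb{R}^d$ and $\mu_{g|x}$ is the conditional distribution of $g$ given $x$. Semi-discrete continuity equation: for $\mu_t\in\mathcal{P}_2(\mathbb{R}^d\times\mathcal{G})$, $v_t:\mathbb{R}^d\times\mathcal{G}\to\mathbb{R}^d$, $h_t:\mathbb{R}^d\times\mathcal{G}\times\mathcal{G}\to\mathbb{R}$, the curve $t\mapsto(\mu_t,v_t,h_t)$ is a solution if for all $\zeta\in C_c^\infty(\mathbb{R}^d\times\mathcal{G})$ (i.e. $\zeta(\cdot,g)\in C_c^\infty(\mathbb{R}^d)$ for each $g$) $$\frac{d}{dt}\int_{\mathbb{R}^d}\sum_g\zeta\,d\mu_t=\int_{\mathbb{R}^d}\sum_g\nabla_x\zeta\cdot v_t\,d\mu_t+\int_{\mathbb{R}^d}\sum_{g,g'}\nabla_g\zeta(x,g,g')\,h_t(x,g,g')\,K(g,g')\,d\hat\mu_t(x,g,g').$$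
   Formalization: The formal theorem also assumes that, for every μ in P_2, the measure μ̂ is finite on compact sets; without a local upper bound on θ the claim fails, e.g. for θ_{x,g,g'}(s,t) = (s+t)/(2|x|) for x ≠ 0 (and (s+t)/2 at x = 0), where W_2 vanishes between distinct Dirac masses. *)

(* Defs.v *)
From HB Require Import structures.
From mathcomp Require Import all_boot all_order all_algebra.
From mathcomp Require Import all_classical all_reals all_analysis.
From mathcomp Require Import measurable_realfun.

Set Implicit Arguments.
Unset Strict Implicit.
Unset Printing Implicit Defensive.

Import Order.TTheory GRing.Theory Num.Theory.
Import numFieldNormedType.Exports.

Local Open Scope classical_set_scope.
Local Open Scope ring_scope.

(* Borel sigma-algebra on matrices, hence on ['rV[R]_d]. *)
HB.instance Definition _ (R : realType) (m n : nat) :=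
  @isMeasurable.Build (sigma_display (@open 'M[R]_(m, n)))
    'M[R]_(m, n) <<s @open 'M[R]_(m, n) >>
    (@sigma_algebra0 _ setT _) (@sigma_algebraC 'M[R]_(m, n) _)
    (@sigma_algebra_bigcup _ setT _).

(* Nonempty finite types: measurable types of the library are pointed. *)
#[short(type="pfinType")]
HB.structure Definition PointedFinite := {T of Finite T & Pointed T}.

(* [discr G] is [G] with the discrete sigma-algebra. *)
Definition discr (G : pfinType) : Type := G.
HB.instance Definition _ (G : pfinType) := Finite.on (discr G).
HB.instance Definition _ (G : pfinType) := Pointed.on (discr G).
HB.instance Definition _ (G : pfinType) := @isMeasurable.Build
  default_measure_display (discr G) discrete_measurable discrete_measurable0
  discrete_measurableC discrete_measurableU.

Section lebesgue_rV.
Context {R : realType}.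

Lemma measurable_fun_rV d (T : measurableType d) n (f : T -> 'rV[R]_n) :
  (forall j, measurable_fun setT (fun t => f t 0 j)) -> measurable_fun setT f.
Proof.
move=> mf; apply: (@measurability _ _ _ _ _ _ (@open 'rV[R]_n)) => //.
move=> _ [U oU <-]; rewrite setTI.
pose r (k : nat) : R := k.+1%:R^-1.
have r0 k : 0 < r k by rewrite invr_gt0 ltr0n.
pose box (p : 'rV[rat]_n * nat) : set 'rV[R]_n :=
  [set y | forall j, `|ratr (p.1 0 j) - y 0 j| < r p.2].
have -> : f @^-1` U = \bigcup_(p in [set p | box p `<=` U]) f @^-1` (box p).
  apply/seteqP; split=> [t /= Uft|t [p /= pU] /pU //].
  have /nbhs_ballP[e /= e0 eU] : nbhs (f t) U by apply: open_nbhs_nbhs.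
  have [k ke] : exists k, 2 * r k < e.
    have [k _ hk] := @near_infty_natSinv_lt R (PosNum (divr_gt0 e0 (@ltr0n R 2))).
    exists k; have := hk k (leqnn k) => /=.
    by rewrite ltr_pdivlMr // mulrC.
  have /choice[q qP] : forall j : 'I_n, exists q : rat,
      f t 0 j - r k < ratr q < f t 0 j + r k.
    move=> j; have [|q] := @rat_in_itvoo R (f t 0 j - r k) (f t 0 j + r k).
      by rewrite ltrBlDr -addrA ltrDl addr_gt0.
    by rewrite in_itv /= => qP; exists q.
  exists (\row_j q j, k) => /=.
    move=> y /= hy; apply: eU; split => // i j; rewrite (ord1 i).
    have := hy j; rewrite /ball /= !mxE => h.
    have := qP j => /andP[h1 h2].
    have h3 : `|f t 0 j - ratr (q j)| < r k by rewrite ltr_distlC; apply/andP.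
    rewrite (le_lt_trans (ler_distD (ratr (q j)) _ _)) //.
    by rewrite (lt_trans _ ke) // mulrDl mul1r ltrD.
  move=> j; rewrite /= mxE distrC ltr_distlC.
  exact: qP.
rewrite bigcup_mkcond; apply: countable_bigcupT_measurable => // p.
case: ifP => // _.
have -> : f @^-1` box p =
    \bigcap_(j in [set: 'I_n]) [set t | `|ratr (p.1 0 j) - f t 0 j| < r p.2].
  by apply/seteqP; split=> t h j => [_|]; exact: h.
apply: fin_bigcap_measurable => [|j _]; first exact: finite_finset.
have mg : measurable_fun setT (fun t => `|ratr (p.1 0 j) - f t 0 j|).
  by apply: measurableT_comp => //; apply: measurable_funB.
have := mg measurableT _ (measurable_itv `]-oo, r p.2[).
by rewrite setTI preimage_itvNyo.
Qed.

Lemma continuous_measurable_fun_rV n (f : 'rV[R]_n -> R) :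
  continuous f -> measurable_fun setT f.
Proof.
move=> /continuousP cf.
apply: (measurability _ (RGenOInfty.measurableE R)).
move=> _ [_ [a ->] <-]; rewrite setTI.
by apply: sub_sigma_algebra; apply: cf; exact: interval_open.
Qed.

Definition rV_cons n (p : measurableTypeR R * 'rV[R]_n) : 'rV[R]_n.+1 := row_mx p.1%:M p.2.
Definition rV_uncons n (x : 'rV[R]_n.+1) : measurableTypeR R * 'rV[R]_n :=
  (x 0 0, \row_j x 0 (lift 0 j)).

Lemma rV_consK n : cancel (@rV_cons n) (@rV_uncons n).
Proof.
move=> [a y]; rewrite /rV_uncons /rV_cons /=; congr pair.
  by rewrite mxE; case: splitP => // j _; rewrite (ord1 j) mxE.
apply/rowP => j; rewrite !mxE; case: splitP => [k|k /= [/val_inj ->]//].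
by rewrite (ord1 k).
Qed.

Lemma measurable_rV_cons n : measurable_fun setT (@rV_cons n).
Proof.
apply: measurable_fun_rV => j.
case: (unliftP 0 j) => [k ->|->].
  rewrite (_ : (fun _ => _) = (fun p : measurableTypeR R * 'rV[R]_n => p.2 0 k)).
    apply: (@measurableT_comp _ _ _ _ _ _ (fun y : 'rV[R]_n => y 0 k)) => //.
    by apply: continuous_measurable_fun_rV; exact: coord_continuous.
  by apply/funext => p; have := congr1 (fun q : R * 'rV[R]_n => q.2 0 k) (rV_consK p);
    rewrite /= mxE.
rewrite (_ : (fun _ => _) = fst) //.
by apply/funext => p; have := congr1 fst (rV_consK p).
Qed.

HB.instance Definition _ n :=
  isMeasurableFun.Build _ _ _ _ (@rV_cons n) (@measurable_rV_cons n).

Lemma measurable_rV_uncons n : measurable_fun setT (@rV_uncons n).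
Proof.
apply: measurable_fun_pair.
  by apply: continuous_measurable_fun_rV; exact: coord_continuous.
apply: measurable_fun_rV => j.
rewrite (_ : (fun _ => _) = (fun x : 'rV[R]_n.+1 => x 0 (lift 0 j))).
  by apply: continuous_measurable_fun_rV; exact: coord_continuous.
by apply/funext => x; rewrite mxE.
Qed.

(* Image of [lebesgue_measure \x L] under [(a, y) |-> (a, y_1, .., y_n)]. *)
Section cons.
Context {n : nat} (L : {sigma_finite_measure set 'rV[R]_n -> \bar R}).

Let leb1 : {sigma_finite_measure set (measurableTypeR R) -> \bar R} :=
  @lebesgue_measure R.

Definition lebesgue_cons : set 'rV[R]_n.+1 -> \bar R :=
  pushforward (leb1 \x L)%E (@rV_cons n).

Let lebesgue_cons0 : lebesgue_cons set0 = 0%E.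
Proof. exact: measure0. Qed.

Let lebesgue_cons_ge0 A : (0 <= lebesgue_cons A)%E.
Proof. exact: measure_ge0. Qed.

Let lebesgue_cons_sigma_additive : semi_sigma_additive lebesgue_cons.
Proof. exact: measure_semi_sigma_additive. Qed.

HB.instance Definition _ := isMeasure.Build _ _ _ lebesgue_cons
  lebesgue_cons0 lebesgue_cons_ge0 lebesgue_cons_sigma_additive.

Let lebesgue_cons_sigma_finite : sigma_finite setT lebesgue_cons.
Proof.
have /sigma_finiteP[F [TF ndF Foo]] := sigma_finiteT leb1.
have /sigma_finiteP[G [TG ndG Goo]] := sigma_finiteT L.
exists (fun k => @rV_uncons n @^-1` (F k `*` G k)).
  rewrite -preimage_bigcup; apply/esym/seteqP; split => // x _.
  have [i _ Fi] : (\bigcup_i F i) (rV_uncons x).1 by rewrite -TF.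
  have [j _ Gj] : (\bigcup_i G i) (rV_uncons x).2 by rewrite -TG.
  exists (maxn i j) => //; split.
    by move: Fi; exact/subsetPset/ndF/leq_maxl.
  by move: Gj; exact/subsetPset/ndG/leq_maxr.
move=> k; have [mF oF] := Foo k; have [mG oG] := Goo k; split.
  rewrite -[X in measurable X]setTI.
  by apply: measurable_rV_uncons => //; exact: measurableX.
rewrite /lebesgue_cons /pushforward -comp_preimage.
rewrite (_ : _ \o _ = id); last by apply/funext => p; exact: rV_consK.
by rewrite preimage_id product_measure1E // lte_mul_pinfty // ge0_fin_numE.
Qed.

HB.instance Definition _ := Measure_isSigmaFinite.Build _ _ _ lebesgue_cons
  lebesgue_cons_sigma_finite.

End cons.

(* Lebesgue measure on [R^n], as an iterated product. *)
Fixpoint lebesgue_rV n : {sigma_finite_measure set 'rV[R]_n -> \bar R} :=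
  if n is n'.+1 return {sigma_finite_measure set 'rV[R]_n -> \bar R}
  then lebesgue_cons (lebesgue_rV n') else \d_(0 : 'rV[R]_0).

End lebesgue_rV.
Section mobility.
Context {R : realType} {d : nat} {G : pfinType}.

Local Notation Rd := 'rV[R]_d.
Local Notation X := ('rV[R]_d * discr G)%type.

(* [theta x g g' s t] is only meaningful for [0 <= s] and [0 <= t]. *)
Definition mobility := Rd -> G -> G -> R -> R -> R.

Implicit Types (theta : mobility) (mu nu : probability X R).

Definition mobility_ge0 theta :=
  forall x g g' s t, 0 <= s -> 0 <= t -> 0 <= theta x g g' s t.

Definition mobility_measurable theta := forall g g',
  measurable_fun [set p : Rd * (R * R) | 0 <= p.2.1 /\ 0 <= p.2.2]
    (fun p => theta p.1 g g' p.2.1 p.2.2).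

(* [G] being finite and discrete, a subset of [R^d * G * G] is relatively
   compact iff it lies in [C * G * G] for some compact [C]. *)
Definition A0 theta :=
  [/\ exists x g g' s t, [/\ 0 <= s, 0 <= t & theta x g g' s t != 0],
      forall x g g' s t s' t', 0 <= s -> 0 <= t -> 0 <= s' -> 0 <= t' ->
        theta x g g' s t = theta x g g' s' t',
      forall x g g' s t, 0 <= s -> 0 <= t ->
        theta x g g' s t = theta x g' g s t &
      forall C : set Rd, compact C -> exists2 c : R, 0 < c &
        forall x g g' s t, C x -> 0 <= s -> 0 <= t -> c <= theta x g g' s t].

Definition A1 theta := forall x g g' s t, 0 <= s -> 0 <= t ->
  theta x g g' s t = theta x g g' t s.

(* Differentiability is required on the open quadrant: together with A4, it
   would force [theta x g g' s t = (s + t) * theta x g g' 1 0] if it were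
   required at the origin. *)
Definition A2 theta := forall x g g' (s t : R), 0 < s -> 0 < t ->
  differentiable (fun p : R * R => theta x g g' p.1 p.2) ((s, t) : R * R).

Definition A3 theta := forall x g g' r s t, 0 <= r -> r <= s -> 0 <= t ->
  theta x g g' r t <= theta x g g' s t.

Definition A4 theta := forall x g g' l s t, 0 <= l -> 0 <= s -> 0 <= t ->
  theta x g g' (l * s) (l * t) = l * theta x g g' s t.

(* The inverse is taken in the extended reals, where [0^-1 = +oo]. *)
Definition mobility_C theta (x : Rd) (g g' : G) : \bar R :=
  (\int[lebesgue_measure]_(t in `[0%R, 1%R])
     ((Num.sqrt (theta x g g' (1 - t)%R t))%:E)^-1)%E.

Definition A5 theta := forall C : set Rd, compact C ->
  (exists M : R, forall x g g', C x -> (mobility_C theta x g g' <= M%:E)%E) /\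
  (exists2 c : R, 0 < c & forall x g g', C x -> c <= theta x g g' 1 1).

Definition A15 theta := [/\ A1 theta, A2 theta, A3 theta, A4 theta & A5 theta].

Definition sqnorm (v : Rd) : R := \sum_(i < d) v 0 i ^+ 2.

Definition dot (u v : Rd) : R := \sum_(i < d) u 0 i * v 0 i.

Definition P2 mu := (\int[mu]_z (sqnorm z.1)%:E < +oo)%E.

(* Measures are total functions on sets, with arbitrary values on sets which
   are not measurable. *)
Definition eq_law mu nu := forall A, measurable A -> mu A = nu A.

Definition marginal mu : set Rd -> \bar R := pushforward mu fst.

Definition is_conditional mu (k : Rd -> G -> R) :=
  [/\ forall g, measurable_fun setT (k ^~ g),
      forall x g, 0 <= k x g,
      forall x, \sum_(g : G) k x g = 1 &
      forall (A : set Rd) (g : G), measurable A ->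
        mu (A `*` [set (g : discr G)]) =
          (\int[marginal mu]_(x in A) (k x g)%:E)%E].

Definition conditional mu : Rd -> G -> R :=
  xget (fun=> cst 0) [set k | is_conditional mu k].

(* The measure [hat mu] has density [hat_density] with respect to
   [hat_base * counting * counting]. A0 and A1-A5 exclude each other: A4 gives
   [theta x g g' 0 0 = 0]. *)
Definition hat_base theta mu : set Rd -> \bar R :=
  if `[< A0 theta >] then (lebesgue_rV d : set Rd -> \bar R)
  else marginal mu.

Definition hat_density theta mu (x : Rd) (g g' : G) : R :=
  theta x g g' (conditional mu x g) (conditional mu x g').

Definition hat_integral theta mu (D : set Rd) (F : Rd -> G -> G -> R)
    : \bar R :=
  (\int[hat_base theta mu]_(x in D)
     (\sum_(g : G) \sum_(g' : G) F x g g' * hat_density theta mu x g g')%:E)%E.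

(* [hat mu] is a locally finite (Radon) measure for every [mu] in [P2]. This is
   the only local upper bound on [theta]. Without it, mass at points of [R^d]
   near which [theta] is unbounded can jump in [G] at arbitrarily small cost
   (e.g. [theta x g g' s t = (s + t) / |x|] for [x != 0]), and [W2] vanishes
   between distinct measures. *)
Definition hat_locally_finite theta := forall mu, P2 mu ->
  forall C : set Rd, compact C ->
    (hat_integral theta mu C (fun _ _ _ => 1%R) < +oo)%E.

Definition grad (f : Rd -> R) (x : Rd) : Rd :=
  \row_(i < d) 'D_(delta_mx 0 i) f x.

Definition grad_g (f : Rd -> G -> R) (x : Rd) (g g' : G) : R :=
  f x g' - f x g.

(* For [n] > 0: the partial derivatives exist everywhere and are of class
   [C^(n-1)]. *)
Fixpoint is_Cn n (f : Rd -> R) : Prop :=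
  if n is n'.+1 then
    continuous f /\ forall i : 'I_d,
      (forall x, derivable f x (delta_mx 0 i)) /\
      is_Cn n' ('D_(delta_mx 0 i) f)
  else continuous f.

Definition test_function (zeta : Rd -> G -> R) := forall g,
  (forall n, is_Cn n (zeta ^~ g)) /\
  compact (closure [set x | zeta x g != 0]).

Section continuity_equation.
Variables (theta : mobility) (K : G -> G -> R).
Variables (mu : R -> probability X R).
Variables (v : R -> Rd -> G -> Rd) (h : R -> Rd -> G -> G -> R).

Definition drift (zeta : Rd -> G -> R) (t : R) (z : X) : R :=
  dot (grad (zeta ^~ z.2) z.1) (v t z.1 z.2).

Definition reaction (zeta : Rd -> G -> R) (t : R) (x : Rd) (g g' : G) : R :=
  grad_g zeta x g g' * h t x g g' * K g g'.

Definition rate (zeta : Rd -> G -> R) (t : R) : \bar R :=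
  (\int[mu t]_z (drift zeta t z)%:E +
   hat_integral theta (mu t) setT (reaction zeta t))%E.

(* [d/dt int zeta dmu_t = rate zeta t], integrated in time: both sides are
   defined for almost every [t], and [t |-> int zeta dmu_t] is the absolutely
   continuous primitive of the right-hand side. *)
Definition continuity_equation :=
  [/\ forall t, 0 <= t <= 1 -> P2 (mu t),
      forall g i, measurable_fun (`[0, 1] `*` setT : set (R * Rd))
        (fun p => v p.1 p.2 g 0 i),
      forall g g', measurable_fun (`[0, 1] `*` setT : set (R * Rd))
        (fun p => h p.1 p.2 g g') &
      forall zeta, test_function zeta ->
      [/\ {ae @lebesgue_measure R, forall t : R, 0 <= t <= 1 ->
            (mu t).-integrable setT (EFin \o drift zeta t) /\
            (hat_integral theta (mu t) setT
               (fun x g g' => `|reaction zeta t x g g'|%R) < +oo)%E},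
          (@lebesgue_measure R).-integrable `[0, 1] (rate zeta) &
          forall t, 0 <= t <= 1 ->
            (\int[mu t]_z (zeta z.1 z.2)%:E =
             \int[mu 0%R]_z (zeta z.1 z.2)%:E +
             \int[lebesgue_measure]_(s in `[0%R, t]) rate zeta s)%E]].

End continuity_equation.

Section distance.
Variables (theta : mobility) (K : G -> G -> R).

Definition grad_curve (mu : R -> probability X R)
    (phi psi : R -> Rd -> G -> R) :=
  (forall t, 0 <= t <= 1 -> forall g x, differentiable (phi t ^~ g) x) /\
  continuity_equation theta K mu
    (fun t x g => grad (phi t ^~ g) x) (fun t => grad_g (psi t)).

Definition action (mu : R -> probability X R) (phi psi : R -> Rd -> G -> R)
    : \bar R :=
  (\int[lebesgue_measure]_(t in `[0%R, 1%R])
     (\int[mu t]_z (sqnorm (grad (phi t ^~ z.2) z.1))%:E +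
      hat_integral theta (mu t) setT
        (fun x g g' => (grad_g (psi t) x g g' ^+ 2 * K g g')%R)))%E.

Definition W2 mu0 mu1 : \bar R :=
  sqrte (ereal_inf [set a |
    exists (mu : R -> probability X R) (phi psi : R -> Rd -> G -> R),
    [/\ grad_curve mu phi psi, eq_law (mu 0%R) mu0, eq_law (mu 1%R) mu1 &
        a = action mu phi psi]]).

End distance.

Definition metric_on_P2 (dist : probability X R -> probability X R -> \bar R) :=
  [/\ forall mu nu, P2 mu -> P2 nu ->
        (0 <= dist mu nu)%E /\ dist mu nu \is a fin_num,
      forall mu nu, P2 mu -> P2 nu -> dist mu nu = 0%E <-> eq_law mu nu,
      forall mu nu, P2 mu -> P2 nu -> dist mu nu = dist nu mu &
      forall mu nu rho, P2 mu -> P2 nu -> P2 rho ->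
        (dist mu rho <= dist mu nu + dist nu rho)%E].

End mobility.
Arguments mobility : clear implicits.

Definition connected_graph (R : realType) (G : pfinType) (K : G -> G -> R) :=
  forall g g' : G, connect [rel a b | 0 < K a b] g g'.

(* Main.v *)
Require Import Defs.
From HB Require Import structures.
From mathcomp Require Import all_boot all_order all_algebra.
From mathcomp Require Import all_classical all_reals all_analysis.
From mathcomp Require Import measurable_realfun lra ring.

Set Implicit Arguments.
Unset Strict Implicit.
Unset Printing Implicit Defensive.

Import Order.TTheory GRing.Theory Num.Theory.
Import numFieldNormedType.Exports.

Local Open Scope classical_set_scope.
Local Open Scope ring_scope.

(** Finiteness.  Contracting the space coordinates one at a time moves [m] to the
    product of [delta_0] with its node weights, at finite cost.  Over a fixed
    space law ([delta_0] under A1-A5; the uniform law of the unit cube under A0,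
    where [hat mu] does not see [mu]) the node weights then move along
    [p + t^2 (q - p)], driven by the solution of a graph Laplace equation: its
    source is of order [t] and its conductances are at least [c t^2], so that the
    energy stays bounded although all conductances may vanish at [t = 0].

    Symmetry and the triangle inequality come from reversing and concatenating
    curves, the latter with durations proportional to the two distances.

    Separation.  Young's inequality bounds the variation of [int zeta dmu_t] along
    a curve of action [r^2] by [e C + r^2 / e] for every [e > 0]; as [r] tends to
    [0], smooth test functions separate laws.  The constant [C] does not depend
    on the curve because [hat mu] is bounded on compact sets uniformly in [mu]:
    under A1-A5 its density is at most [theta 1 1], which is locally bounded, for
    otherwise a law with atoms where it is large would contradict local finiteness.

    The integrand of an action need not be measurable in time, so actions are
    only compared as lower integrals. *)

(** * Lower integrals and affine changes of time *)

(** The exponent of the ramp comes from scaling: along t^k the source is of order t^(k-1) and the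
    conductances of order t^k, so the energy, source squared over conductance, is of order t^(k-2),
    which is bounded from k = 2 on. The conductances have this order because the target weights are
    uniform and A1, A3, A4 bound theta(a, b) below by min(a, b) theta(1, 1). Arbitrary laws are thus
    joined through one common law with uniform weights. The space law must suit [hat mu]: under A0
    its spatial part is Lebesgue measure, so reaction can only move laws with a density; under A1-A5
    conditional weights are determined up to null sets, and an atom fixes them at its point. Another
    obstacle: the continuity equation grants integrability outside a null set of times that depends
    on the test function, and an integral that does not converge absolutely has a conventional
    value, which need not scale. Countably many test functions give a single null set, where the
    potentials are put to zero; after that, reversal and gluing may rescale the rates at every
    time. *)

Section lower_integral.
Context d (T : measurableType d) (R : realType).
Variable mu : {measure set T -> \bar R}.
Local Open Scope ereal_scope.
Import HBNNSimple.

(* Without measurability the integral of a nonnegative function is the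
   supremum of the integrals of the measurable functions below it. *)
Lemma ge0_integral_lub (D : set T) (f : T -> \bar R) (b : \bar R) :
  measurable D -> (forall x, D x -> 0 <= f x) ->
  (forall g : T -> \bar R, measurable_fun setT g -> (forall x, 0 <= g x) ->
    (forall x, D x -> g x <= f x) -> (forall x, ~ D x -> g x = 0) ->
    \int[mu]_(x in D) g x <= b) ->
  \int[mu]_(x in D) f x <= b.
Proof.
move=> mD f0 fb; rewrite ge0_integralE//.
apply: ge_ereal_sup => _ /= [h hf <-].
have hD x : ~ D x -> (h x)%:E = 0.
  move=> nDx; have := hf x; rewrite patchE memNset// => h0.
  by apply/eqP; rewrite eq_le h0/= lee_fin fun_ge0.
have hfD x : D x -> (h x)%:E <= f x.
  by move=> Dx; have := hf x; rewrite patchE mem_set.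
have := fb (EFin \o h) _ _ hfD hD.
rewrite integral_nnsfun// => fbh; apply: le_trans (fbh _ _).
- suff -> : (h \_ D)%R = h by [].
  apply/funext => x; rewrite patchE; case: ifPn => // /negP nDx.
  have /hD[->//] : ~ D x by move=> Dx; apply: nDx; rewrite inE.
- exact/measurable_EFinP.
- by move=> x; rewrite lee_fin fun_ge0.
Qed.

(** Both integrals are suprema over simple functions below the integrand, and those below [f1] lie
    below [f2], so monotonicity survives without measurability. *)
Lemma ge0_le_integral_lower (D : set T) (f1 f2 : T -> \bar R) :
  (forall x, D x -> 0 <= f1 x) -> (forall x, D x -> f1 x <= f2 x) ->
  \int[mu]_(x in D) f1 x <= \int[mu]_(x in D) f2 x.
Proof.
move=> f10 f12.
have f20 x : D x -> 0 <= f2 x by move=> Dx; exact: le_trans (f10 _ Dx) (f12 _ Dx).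
rewrite !ge0_integralE//; apply: le_ereal_sup => _ /= [h hf <-].
exists h => // x.
apply: le_trans (hf x) _; rewrite !patchE; case: ifPn => // /set_mem; exact: f12.
Qed.

(** A measurable function below [f] on the union splits exactly, and each part lies below [f] on its
    piece. This direction bounds the action of a glued curve from above. *)
Lemma ge0_integral_lowerU (D1 D2 : set T) (f : T -> \bar R) :
  measurable D1 -> measurable D2 -> [disjoint D1 & D2] ->
  (forall x, (D1 `|` D2) x -> 0 <= f x) ->
  \int[mu]_(x in D1 `|` D2) f x <=
  \int[mu]_(x in D1) f x + \int[mu]_(x in D2) f x.
Proof.
move=> mD1 mD2 D12 f0; apply: ge0_integral_lub => //; first exact: measurableU.
move=> g mg g0 gf _; rewrite ge0_integral_setU//; last exact: measurable_funTS.
by apply: leeD; apply: ge0_le_integral_lower => // x Dx; apply: gf; [left|right].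
Qed.

Lemma ge0_integral_lowerZl (D : set T) (c : R) (f : T -> \bar R) :
  measurable D -> (0 < c)%R -> (forall x, D x -> 0 <= f x) ->
  \int[mu]_(x in D) (c%:E * f x) <= c%:E * \int[mu]_(x in D) f x.
Proof.
move=> mD c0 f0; apply: ge0_integral_lub => // [x Dx|g mg g0 gf _].
  by apply: mule_ge0; [rewrite lee_fin ltW|exact: f0].
rewrite -lee_pdivrMl// -ge0_integralZl//; last first.
- by rewrite lee_fin invr_ge0 ltW.
- exact: measurable_funTS.
apply: ge0_le_integral_lower => x Dx.
  by rewrite mule_ge0// lee_fin invr_ge0 ltW.
by rewrite lee_pdivrMl//; exact: gf.
Qed.

End lower_integral.

Section affine_change.
Context {R : realType}.
Local Open Scope ereal_scope.
Notation leb := (@lebesgue_measure R).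

Definition affine (a c s : R) : measurableTypeR R := (a + c * s)%R.

Lemma measurable_affine (a c : R) : measurable_fun setT (affine a c).
Proof.
by apply: measurable_funD => //; apply: measurable_funM.
Qed.

HB.instance Definition _ (a c : R) :=
  isMeasurableFun.Build _ _ _ _ (affine a c) (measurable_affine a c).

(** Lebesgue measure is determined by its values on the intervals []x, y]]. The two signs of [c] are
    separate cases because the preimage of such an interval is closed on the left when [c] is
    negative. *)
Lemma lebesgue_affine (a c : R) (A : set R) : (c != 0)%R -> measurable A ->
  leb A = `|c|%:E * pushforward leb (affine a c) A.
Proof.
move=> c0 mA.
have c0' : (0 <= `|c|)%R by [].
pose m0 :
    {measure set (measurableTypeR R) -> \bar R} :=
  mscale (NngNum c0') (pushforward leb (affine a c)).
pose m' := m0 (measurable_affine a c).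
have -> : `|c|%:E * pushforward leb (affine a c) A = m' A by [].
apply: lebesgue_measure_unique => // _ [[x y] _ <-] /=.
rewrite -[m' _]/(`|c|%:E * leb (affine a c @^-1` `]x, y])).
case: (ltrgtP c 0%R) c0 => // cc _.
  have -> : affine a c @^-1` `]x, y] = `[((y - a) / c)%R, ((x - a) / c)%R[%classic.
    apply/seteqP; split => s /=; rewrite !in_itv/= /affine.
      by move=> /andP[h1 h2]; rewrite ler_ndivrMr// ltr_ndivlMr//; apply/andP; split; lra.
    by move=> /andP[]; rewrite ler_ndivrMr// ltr_ndivlMr// => h1 h2; apply/andP; split; lra.
  rewrite !lebesgue_measure_itv/= !lte_fin ltr_ndivrMr// divfK ?lt_eqF//.
  rewrite ltrD2r; case: ifPn => xy; last by rewrite mule0.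
  rewrite -!EFinD -EFinM; congr EFin; rewrite ltr0_norm//; field; by rewrite lt_eqF.
have -> : affine a c @^-1` `]x, y] = `]((x - a) / c)%R, ((y - a) / c)%R]%classic.
  apply/seteqP; split => s /=; rewrite !in_itv/= /affine.
    by move=> /andP[h1 h2]; rewrite ler_pdivlMr// ltr_pdivrMr//; apply/andP; split; lra.
  by move=> /andP[]; rewrite ler_pdivlMr// ltr_pdivrMr// => h1 h2; apply/andP; split; lra.
rewrite !lebesgue_measure_itv/= !lte_fin ltr_pdivrMr// divfK ?gt_eqF//.
rewrite ltrD2r; case: ifPn => xy; last by rewrite mule0.
rewrite -!EFinD -EFinM; congr EFin; rewrite gtr0_norm//; field; by rewrite gt_eqF.
Qed.

Lemma ge0_integral_affine (a c : R) (D : set R) (f : R -> \bar R) :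
  (c != 0)%R -> measurable D -> measurable_fun D f ->
  (forall x, D x -> 0 <= f x) ->
  \int[leb]_(x in D) f x =
  `|c|%:E * \int[leb]_(s in affine a c @^-1` D) f (affine a c s).
Proof.
move=> c0 mD mf f0.
have c0' : (0 <= `|c|)%R by [].
pose m0 :
    {measure set (measurableTypeR R) -> \bar R} :=
  mscale (NngNum c0') (pushforward leb (affine a c)).
pose m' := m0 (measurable_affine a c).
transitivity (\int[m']_(x in D) f x).
  by apply: eq_measure_integral => A mA _; exact: lebesgue_affine.
rewrite ge0_integral_mscale//=; congr (_ * _).
rewrite ge0_integral_pushforward//; first exact: measurable_affine.
by move=> x /set_mem; exact: f0.
Qed.

Lemma integrable_affine (a c : R) (D : set R) (f : R -> \bar R) :
  (c != 0)%R -> measurable D -> leb.-integrable D f ->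
  leb.-integrable (affine a c @^-1` D) (f \o affine a c).
Proof.
move=> c0 mD /integrableP[mf fi]; apply/integrableP; split.
  apply: (measurable_comp mD) => //; first by move=> _ [s Ds <-].
  by apply: (measurable_funS measurableT) => //; exact: measurable_affine.
have := fi; rewrite (ge0_integral_affine a c0)//; last exact: measurableT_comp.
by rewrite -lte_pdivlMl ?normr_gt0// gt0_muley// lte_fin invr_gt0 normr_gt0.
Qed.

Lemma integral_affine (a c : R) (D : set R) (f : R -> \bar R) :
  (c != 0)%R -> measurable D -> leb.-integrable D f ->
  \int[leb]_(x in D) f x =
  `|c|%:E * \int[leb]_(s in affine a c @^-1` D) f (affine a c s).
Proof.
move=> c0 mD /integrableP[mf fi].
rewrite integralE (@ge0_integral_affine a c D f^\+)//;
  last exact: measurable_funepos.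
rewrite (@ge0_integral_affine a c D f^\-)//; last exact: measurable_funeneg.
transitivity (`|c|%:E *
    (\int[leb]_(s in affine a c @^-1` D) (f \o affine a c)^\+ s -
     \int[leb]_(s in affine a c @^-1` D) (f \o affine a c)^\- s)); last first.
  by rewrite -integralE.
rewrite [RHS]muleBr//; first by rewrite (funepos_comp f (affine a c)) (funeneg_comp f (affine a c)).
apply: fin_num_adde_defr; apply: (@integrable_pos_fin_num _ _ _ leb).
  by rewrite -[X in measurable X]setTI; exact: measurable_affine.
by apply: (integrable_affine a c0 mD); apply/integrableP.
Qed.

(** The exact change of variables holds for every measurable function below [f], and its composite
    with [affine a c] stays below that of [f]. *)
Lemma ge0_integral_lower_affine (a c : R) (D : set R) (f : R -> \bar R) :
  (c != 0)%R -> measurable D -> (forall x, D x -> 0 <= f x) ->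
  \int[leb]_(x in D) f x <=
  `|c|%:E * \int[leb]_(s in affine a c @^-1` D) f (affine a c s).
Proof.
move=> c0 mD f0; apply: ge0_integral_lub => // g mg g0 gf _.
rewrite (@ge0_integral_affine a c D g)//; last exact: measurable_funTS.
apply: lee_pmul => //; first by apply: integral_ge0 => *.
by apply: ge0_le_integral_lower => // s Ds; exact: gf.
Qed.

End affine_change.

(** * Test functions *)

Section smooth_line.
Context {R : realType}.
Implicit Types (f g : R -> R) (p : {poly R}).

(** The derivative is an existential witness instead of a derivation operator, so that stability
    under sums, products and affine substitutions is a direct induction. *)
Fixpoint Cn n f : Prop :=
  if n is n'.+1 then exists2 f', forall x : R, is_derive x (1 : R) f (f' x) & Cn n' f'
  else continuous f.

Lemma is_derive_continuous f f' :
  (forall x : R, is_derive x (1 : R) f (f' x : R)) -> continuous f.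
Proof.
move=> df x; apply/differentiable_continuous/derivable1_diffP.
by have [] := df x.
Qed.

Lemma CnS n f : Cn n.+1 f -> Cn n f.
Proof.
elim: n f => [|n IH] f /= [f' df f'n]; first exact: is_derive_continuous df.
by exists f' => //; exact: IH.
Qed.

Lemma Cn_continuous n f : Cn n f -> continuous f.
Proof. by elim: n f => [//|n IH] f /CnS; exact: IH. Qed.

Lemma CnD n f g : Cn n f -> Cn n g -> Cn n (f + g).
Proof.
elim: n f g => [|n IH] f g /=.
  by move=> cf cg x; apply: cvgD; [exact: cf|exact: cg].
move=> [f' df f'n] [g' dg g'n]; exists (f' + g'); last exact: IH.
by move=> x; exact: is_deriveD.
Qed.

Lemma CnM n f g : Cn n f -> Cn n g -> Cn n (f * g).
Proof.
elim: n f g => [|n IH] f g.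
  by move=> cf cg x; apply: cvgM; [exact: cf|exact: cg].
move=> Cf Cg; have [f' df f'n] := Cf; have [g' dg g'n] := Cg.
exists (f * g' + g * f'); last by apply: CnD; apply: IH => //; exact: CnS.
by move=> x; exact: is_deriveM.
Qed.

Lemma Cn_cst n (c : R) : Cn n (cst c).
Proof.
elim: n c => [|n IH] c /=; first by move=> x; exact: cvg_cst.
by exists (cst 0) => // x; exact: is_derive_cst.
Qed.

Lemma Cn_id n : Cn n (@id R).
Proof.
case: n => [|n] /=; first by move=> x.
by exists (cst 1); [move=> x; exact: is_derive_id|exact: Cn_cst].
Qed.

Lemma Cn_comp_affine n f (a b : R) : Cn n f -> Cn n (fun x => f (a * x + b)).
Proof.
elim: n f => [|n IH] f.
  move=> cf x; apply: (@continuous_comp _ _ _ (fun x => a * x + b)).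
    by apply: cvgD; [apply: cvgM; [exact: cvg_cst|exact: cvg_id]|exact: cvg_cst].
  exact: cf.
move=> [f' df f'n]; exists (fun x => f' (a * x + b) * a); last first.
  by apply: (@CnM _ (fun x => f' (a * x + b)) (cst a)); [exact: IH|exact: Cn_cst].
move=> x; apply: (@is_derive1_comp _ f (fun x => a * x + b)).
have d1 : is_derive x (1 : R) (fun y : R => a * y) a.
  have := @is_deriveZ R _ _ (@id R) a x 1 1 (is_derive_id _ _).
  by rewrite /GRing.scale /= mulr1.
by apply: is_derive_eq; rewrite addr0.
Qed.

(* The factor [p] makes the family stable under differentiation. *)
Definition flat p (x : R) : R :=
  if 0 < x then p.[x^-1] * expR (- x^-1) else 0.

(** Monomial by monomial: the exponential of [y] dominates its Taylor term of degree i + 1, so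
    [y ^+ i * expR (- y)] is at most the factorial of i + 1 divided by [y]. *)
Lemma horner_expR_le p : exists2 C : R, 0 <= C &
  forall y, 0 < y -> `|p.[y]| * expR (- y) <= C * y^-1.
Proof.
exists (\sum_(i < size p) `|p`_i| * (i.+1)`!%:R).
  by apply: sumr_ge0 => i _; rewrite mulr_ge0.
move=> y y0; rewrite horner_coef.
apply: (@le_trans _ _ (\sum_(i < size p) `|p`_i| * (y ^+ i * expR (- y)))).
  rewrite (le_trans (ler_wpM2r (expR_ge0 _) (ler_norm_sum _ _ _)))//.
  rewrite mulr_suml ler_sum// => i _.
  by rewrite normrM (@ger0_norm _ (y ^+ i)) ?exprn_ge0 ?(ltW y0)// mulrA.
rewrite mulr_suml ler_sum// => i _; rewrite -mulrA ler_wpM2l//.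
rewrite expRN ler_pdivrMr ?expR_gt0//.
have := expR_ge1Dxn i (ltW y0).
have i0 : 0 < (i.+1)`!%:R :> R by rewrite ltr0n fact_gt0.
move=> h; have {}h : y ^+ i.+1 / (i.+1)`!%:R <= expR y.
  by apply: le_trans h; rewrite lerDr.
rewrite -(ler_pM2l y0) -exprS (le_trans (y := (i.+1)`!%:R * expR y))//.
  by rewrite -ler_pdivrMl// mulrC.
by rewrite !mulrA (mulrC y) -!mulrA (mulrA y) mulfV ?mul1r// gt_eqF.
Qed.

(** For positive [x], differentiating p(1/x) exp(-1/x) gives the same expression with the polynomial
    X^2 (p - p'). The delicate point is 0, where the difference quotient must tend to 0. *)
Lemma is_derive_flat p (x : R) :
  is_derive x (1 : R) (flat p) (flat ('X^2 * (p - p^`())) x).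
Proof.
have [x0|x0|->] := ltrgt0P x.
- apply: (@near_eq_is_derive _ _ _
    (fun y : R => p.[y^-1] * expR (- y^-1)) (flat p) x (1 : R)).
    near=> y; rewrite /flat ifT//; near: y; exact: lt_nbhsr.
  have xN0 : x != 0 by rewrite gt_eqF.
  have dV : is_derive x (1 : R) (fun y : R => y^-1) (- x ^- 2).
    apply: is_derive_eq; first exact: is_deriveV.
    by rewrite /GRing.scale /= mulr1.
  have d1 := @is_derive1_comp _ (horner p) (fun y : R => y^-1) x _ _
    (is_derive_poly p x^-1) dV.
  have dN : is_derive x (1 : R) (fun y : R => - y^-1) (x ^- 2).
    by apply: is_derive_eq; rewrite opprK.
  have d2 := @is_derive1_comp _ expR (fun y : R => - y^-1) x _ _
    (is_derive_expR (- x^-1)) dN.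
  have d3 := is_deriveM d1 d2.
  apply: (@is_derive_eq _ _ _ _ _ _ _ _ d3).
  rewrite /flat x0 !hornerE /GRing.scale /=.
  by field.
- apply: (@near_eq_is_derive _ _ _ (cst (0 : R)) (flat p) x (1 : R)).
    near=> y; rewrite /flat ifF//; apply/negbTE; rewrite -leNgt ltW//.
    by near: y; exact: lt_nbhsl.
  rewrite /flat ifF; last by apply/negbTE; rewrite -leNgt ltW.
  exact: is_derive_cst.
have -> : flat ('X^2 * (p - p^`())) 0 = 0 by rewrite /flat ltxx.
(* The extra factor ['X], evaluated at the inverse of [h], absorbs the division by [h] in the
   difference quotient, which is then at most [C * h]. *)
have [C C0 pC] := horner_expR_le ('X * p).
have H : h^-1 *: (flat p (h *: 1 + 0) - flat p 0) @[h --> 0^'] --> (0 : R).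
  apply/cvgr0Pnorm_lt => e e0; near=> h.
  have -> : flat p 0 = 0 by rewrite /flat ltxx.
  rewrite subr0 /GRing.scale /= mulr1 addr0 /flat.
  case: ifPn => h0; last by rewrite mulr0 normr0.
  have := pC h^-1; rewrite invr_gt0 h0 invrK => /(_ erefl) hC.
  have -> : `|h^-1 * (p.[h^-1] * expR (- h^-1))| =
            `|('X * p).[h^-1]| * expR (- h^-1).
    by rewrite hornerM hornerX mulrA normrM (@ger0_norm _ (expR _)) ?expR_ge0.
  apply: le_lt_trans hC _.
  have C1 : 0 < C + 1 by lra.
  apply: (@lt_le_trans _ _ ((C + 1) * h)); first by rewrite ltr_pM2r//; lra.
  rewrite -ler_pdivlMl// mulrC; apply: le_trans (ler_norm _) _.
  by near: h; apply: dnbhs0_le; apply: divr_gt0 => //; lra.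
apply: DeriveDef; first by apply/cvg_ex; exists 0.
by apply/cvg_lim.
Unshelve. all: by end_near. Qed.

Lemma Cn_flat n p : Cn n (flat p).
Proof.
elim: n p => [|n IH] p.
  exact: is_derive_continuous (is_derive_flat p).
by exists (flat ('X^2 * (p - p^`()))); [exact: is_derive_flat|exact: IH].
Qed.

(** A smooth approximation of the indicator of the open interval from [a] to [b]: as [n] grows, each
    factor tends to 1 where its argument is positive and is 0 elsewhere. *)
Definition bump (a b : R) (n : nat) (x : R) : R :=
  flat 1 (n%:R * (x - a)) * flat 1 (n%:R * (b - x)).

Lemma Cn_bump a b n m : Cn m (bump a b n).
Proof.
have -> : bump a b n = (fun x => flat 1 (n%:R * x + - (n%:R * a))) *
    (fun x => flat 1 (- n%:R * x + n%:R * b)).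
  by apply/funext => x; rewrite /bump /=; congr (flat 1 _ * flat 1 _); ring.
by apply: CnM; apply: (Cn_comp_affine (f := flat 1)); exact: Cn_flat.
Qed.

Lemma flat1_ge0 x : 0 <= flat 1 x.
Proof. by rewrite /flat; case: ifPn => // _; rewrite hornerE mul1r expR_ge0. Qed.

Lemma flat1_le1 x : flat 1 x <= 1.
Proof.
rewrite /flat; case: ifPn => // x0; rewrite hornerE mul1r -expR0 ler_expR.
by rewrite oppr_le0 invr_ge0 ltW.
Qed.

Lemma bump_ge0 a b n x : 0 <= bump a b n x.
Proof. by rewrite mulr_ge0// flat1_ge0. Qed.

Lemma bump_le1 a b n x : bump a b n x <= 1.
Proof. by rewrite mulr_ile1// ?flat1_ge0// flat1_le1. Qed.

Lemma bump_neq0 a b n x : bump a b n x != 0 -> a <= x <= b.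
Proof.
rewrite mulf_eq0 negb_or /flat; case: ifPn => [h1|]; last by rewrite eqxx.
case: ifPn => [h2 _|]; last by rewrite eqxx andbF.
move: h1 h2; case: n => [|n]; first by rewrite mul0r ltxx.
by rewrite !pmulr_rgt0 ?ltr0n// !subr_gt0 => /ltW -> /ltW ->.
Qed.

Lemma cvg_flat1 x : flat 1 (n%:R * x) @[n --> \oo] --> ((0 < x)%R%:R : R).
Proof.
have [x0|x0] := ltP 0 x; last first.
  apply: cvg_near_cst; near=> n; rewrite /flat ifF//.
  by apply/negbTE; rewrite -leNgt mulr_ge0_le0.
apply: (@cvg_trans _ (expR (- x^-1 * n%:R^-1) @[n --> \oo])).
  apply: near_eq_cvg; near=> n.
  have n0 : 0 < n%:R :> R by rewrite ltr0n; near: n; exact: nbhs_infty_gt.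
  by rewrite /flat mulr_gt0// hornerE mul1r invfM mulNr mulrC.
suff : expR (- x^-1 / n%:R) @[n --> \oo] --> expR (0 : R) by rewrite expR0.
apply: (@continuous_cvg _ _ _ _ _ (fun n : nat => - x^-1 / n%:R) expR).
  exact: continuous_expR.
rewrite -[X in _ --> X](mulr0 (- x^-1)); apply: cvgM; first exact: cvg_cst.
apply/gtr0_cvgV0; last exact: cvgr_idn.
by near=> n; rewrite ltr0n; near: n; exact: nbhs_infty_gt.
Unshelve. all: by end_near. Qed.

Lemma cvg_bump a b x :
  bump a b n x @[n --> \oo] --> ((a < x < b)%R%:R : R).
Proof.
rewrite -mulnb natrM -(subr_gt0 a) -(subr_gt0 x).
by apply: cvgM; exact: cvg_flat1.
Qed.

End smooth_line.

Section test_functions.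
Context {R : realType} {d : nat}.
Local Notation Rd := 'rV[R]_d.
Implicit Types (F : 'I_d -> R -> R) (x : Rd).

Definition prodf F x : R := \prod_(j < d) F j (x 0 j).

Lemma is_derive_prodf F (F' : R -> R) i x :
  (forall y : R, is_derive y (1 : R) (F i) (F' y : R)) ->
  is_derive x (delta_mx 0 i : Rd) (prodf F)
    (prodf (fun j => if j == i then F' else F j) x).
Proof.
move=> dF; have [/= cF FE] := dF (x 0 i).
pose c := \prod_(j < d | j != i) F j (x 0 j).
have E : prodf (fun j => if j == i then F' else F j) x = F' (x 0 i) * c.
  rewrite /prodf (bigD1 i)//= eqxx; congr (_ * _).
  by apply: eq_bigr => j /negbTE ->.
have H : h^-1 *: (prodf F (h *: delta_mx 0 i + x) - prodf F x) @[h --> 0^']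
    --> F' (x 0 i) * c.
  rewrite (_ : (fun h => _) = fun h : R =>
      (h^-1 *: (F i (h *: (1 : R) + x 0 i) - F i (x 0 i))) * c); last first.
    apply/funext => h; rewrite /prodf (bigD1 i)//= [X in _ - X](bigD1 i)//=.
    rewrite -/c (_ : \prod_(j < d | j != i) F j _ = c); last first.
      by apply: eq_bigr => j ji; rewrite !mxE eqxx (negbTE ji)/= mulr0 add0r.
    by rewrite -mulrBl !mxE !eqxx /GRing.scale /= mulrA.
  by rewrite -FE; apply: cvgM; [exact: cF|exact: cvg_cst].
rewrite E; apply: DeriveDef; first by apply/cvg_ex; eexists; exact: H.
by apply/cvg_lim => //; exact: H.
Qed.

Lemma continuous_prodf F : (forall j, continuous (F j)) -> continuous (prodf F).
Proof.
move=> cF; apply: (@continuous_big R 'I_d *%R 1 xpredT (@mul_continuous R)).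
move=> j _ x; apply: (@continuous_comp _ _ _ (fun y : Rd => y 0 j)).
  exact: coord_continuous.
exact: cF.
Qed.

(** Each [Cn n] provides its own derivative; uniqueness of derivatives lets a single function serve
    for all orders. *)
Lemma smooth_derive (f : R -> R) : (forall n, Cn n f) ->
  exists2 f' : R -> R, forall y : R, is_derive y (1 : R) f (f' y : R) &
    forall n, Cn n f'.
Proof.
move=> sf; have [f' df _] := sf 1%N; exists f' => // n.
have [g dg gn] := sf n.+1; suff -> : f' = g by [].
by apply/funext => y; have [_ <-] := df y; have [_ <-] := dg y.
Qed.

(** A partial derivative of a product of functions of one coordinate each only replaces one factor
    by its derivative, so the class of such products is stable and induction on the order
    applies. *)
Lemma is_Cn_prodf n F : (forall j m, Cn m (F j)) -> is_Cn n (prodf F).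
Proof.
elim: n F => [|n IH] F sF /=.
  by apply: continuous_prodf => j; exact: Cn_continuous (sF j 0%N).
split; first by apply: continuous_prodf => j; exact: Cn_continuous (sF j 0%N).
move=> i; have [F' dF sF'] := smooth_derive (sF i).
have dp x := @is_derive_prodf F F' i x dF; split.
  by move=> x; have [] := dp x.
rewrite (_ : 'D_(delta_mx 0 i) _ =
    prodf (fun j => if j == i then F' else F j)).
  by apply: IH => j m; case: ifP.
by apply/funext => x; have [] := dp x.
Qed.

Lemma is_Cn_cst n (c : R) : is_Cn n (cst c : Rd -> R).
Proof.
have cc : continuous (cst c : Rd -> R) by move=> x; exact: cst_continuous.
elim: n c cc => [|n IH] c cc //=; split=> // i.
split=> [x|]; first exact: derivable_cst.
rewrite (_ : 'D_(delta_mx 0 i) _ = cst 0).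
  by apply: IH => x; exact: cst_continuous.
by apply/funext => x; rewrite derive_cst.
Qed.

Lemma compact_box (a b : R) : compact [set x : Rd | forall j, a <= x 0 j <= b].
Proof.
have := @rV_compact R d (fun=> `[a, b]%classic) (fun=> @segment_compact R a b).
by congr compact; apply/seteqP; split => x /= h j; have := h j; rewrite in_itv.
Qed.

Lemma measurable_compact (C : set Rd) : compact C -> measurable C.
Proof.
move=> cC; rewrite -(setCK C); apply: measurableC; apply: sub_sigma_algebra.
by apply: closed_openC; apply: compact_closed => //; exact: norm_hausdorff.
Qed.

Variable G : pfinType.

Lemma test_prodf F (S : G -> bool) (a b : R) :
  (forall j m, Cn m (F j)) -> (forall j y, F j y != 0 -> a <= y <= b) ->
  test_function (fun x (g : G) => if S g then prodf F x else 0).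
Proof.
move=> sF supp g; split.
  by move=> n; case: (S g); [exact: is_Cn_prodf|exact: (is_Cn_cst n 0)].
apply: (@subclosed_compact _ _ [set x : Rd | forall j, a <= x 0 j <= b]).
- exact: closed_closure.
- exact: compact_box.
have /closure_id -> : closed [set x : Rd | forall j, a <= x 0 j <= b].
  by apply: compact_closed; [exact: norm_hausdorff|exact: compact_box].
apply: closure_subset => x /= + j; case: (S g); rewrite ?eqxx//.
rewrite /prodf (bigD1 j)//= mulf_eq0 negb_or => /andP[+ _]; exact: supp.
Qed.

Lemma bounded_compact_support (f : Rd -> R) (C : set Rd) :
  compact C -> continuous f -> (forall x, ~ C x -> f x = 0) ->
  exists2 M : R, 0 <= M & forall x, `|f x| <= M.
Proof.
move=> cC cf f0.
have : compact (f @` C).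
  by apply: continuous_compact => //; exact: continuous_subspaceT.
move=> /compact_bounded[M [Mr MP]].
exists (`|M| + 1) => [|x]; first by rewrite addr_ge0.
have [Cx|nCx] := pselect (C x); last by rewrite f0// normr0 addr_ge0.
apply: (MP (`|M| + 1)); last by exists x.
by rewrite (le_lt_trans (ler_norm _))// ltrDl.
Qed.

Definition bounded_test (zeta : Rd -> G -> R) (M : R) (C : set Rd) :=
  [/\ 0 <= M, compact C,
    forall x g, `|zeta x g| <= M /\ (~ C x -> zeta x g = 0) &
    forall i x g, `|'D_(delta_mx 0 i) (zeta ^~ g) x| <= M /\
      (~ C x -> 'D_(delta_mx 0 i) (zeta ^~ g) x = 0)].

(** [C] is the finite union of the supports. Its complement is open and [zeta] vanishes on it, hence
    so do the derivatives; [M] adds up the finitely many separate bounds. *)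
Lemma test_bound (zeta : Rd -> G -> R) : test_function zeta ->
  exists M C, bounded_test zeta M C.
Proof.
move=> tz.
pose C := \bigcup_(g in [set: G]) closure [set x | zeta x g != 0].
have cC : compact C.
  rewrite /C bigcup_fset_set; last exact: finite_finset.
  apply: bigsetU_compact => g _; exact: (tz g).2.
have z0 g x : ~ C x -> zeta x g = 0.
  move=> nCx; apply: contra_notP nCx => /eqP zx; exists g => //.
  exact: subset_closure.
have dz0 i g x : ~ C x -> 'D_(delta_mx 0 i) (zeta ^~ g) x = 0.
  move=> nCx; rewrite -[RHS](@derive_cst _ _ _ 0 x (delta_mx 0 i)).
  apply: near_eq_derive.
  have : (~` C) x by [].
  have oC : open (~` C).
    by apply: closed_openC; apply: compact_closed => //; exact: norm_hausdorff.
  move=> Cx; near=> y; apply: z0.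
  near: y; exact: open_nbhs_nbhs.
have cz g : continuous (zeta ^~ g) := (tz g).1 0%N.
have cdz g i : continuous ('D_(delta_mx 0 i) (zeta ^~ g)).
  by have [_ /(_ i)[_]] := (tz g).1 1%N.
have /choice[M0 M0P] g : exists M, 0 <= M /\ forall x, `|zeta x g| <= M.
  by have [M] := bounded_compact_support cC (cz g) (z0 g); exists M.
have /choice[M1 M1P] (p : 'I_d * G) : exists M, 0 <= M /\
    forall x, `|'D_(delta_mx 0 p.1) (zeta ^~ p.2) x| <= M.
  by have [M] := bounded_compact_support cC (cdz p.2 p.1) (dz0 p.1 p.2); exists M.
exists (\sum_g M0 g + \sum_p M1 p), C; split=> //.
- by rewrite addr_ge0// sumr_ge0// => [g|p] _; [have [] := M0P g|have [] := M1P p].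
- move=> x g; split=> [|/z0//].
  apply: le_trans ((M0P g).2 x) _; rewrite (bigD1 g)//= -addrA lerDl addr_ge0//.
    by rewrite sumr_ge0// => h _; have [] := M0P h.
  by rewrite sumr_ge0// => p _; have [] := M1P p.
- move=> i x g; split=> [|/dz0//].
  apply: le_trans ((M1P (i, g)).2 x) _.
  rewrite addrC (bigD1 (i, g))//= -addrA lerDl addr_ge0//.
    by rewrite sumr_ge0// => h _; have [] := M1P h.
  by rewrite sumr_ge0// => p _; have [] := M0P p.
Unshelve. all: by end_near. Qed.

Lemma measurable_fun_discr d1 d2 (T : measurableType d1) (T' : measurableType d2)
    (f : T -> G -> T') :
  (forall g, measurable_fun setT (f ^~ g)) ->
  measurable_fun setT (fun z : T * discr G => f z.1 z.2).
Proof.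
move=> mf _ B mB; rewrite setTI.
rewrite (_ : _ @^-1` _ = \bigcup_(g in [set: discr G])
    ((f ^~ g) @^-1` B `*` [set g])); last first.
  apply/seteqP; split=> [[x g] /= Bx|[x g] [h _ [/= Bx ->//]]].
  by exists g.
apply: fin_bigcup_measurable => [|g _]; first exact: finite_finset.
by apply: measurableX => //; rewrite -[X in measurable X]setTI; exact: mf.
Qed.

End test_functions.

(** * Test functions determine probability laws *)

Section law_uniqueness.
Context {R : realType} {d : nat} {G : pfinType}.
Local Notation Rd := 'rV[R]_d.
Local Notation X := ('rV[R]_d * discr G)%type.
Implicit Types (mu nu : probability X R).

Definition obox (a b : 'I_d -> R) : set Rd :=
  [set x | forall j, a j < x 0 j < b j].

Definition cylinders : set (set X) :=
  [set A | exists a b (S : G -> bool), A = obox a b `*` [set g | S g]].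

Lemma measurable_obox a b : measurable (obox a b).
Proof.
have -> : obox a b = \bigcap_(j in [set: 'I_d])
    ((fun x : Rd => x 0 j) @^-1` `]a j, b j[).
  by apply/seteqP; split=> x h j => [_|]; have := h j; rewrite /= in_itv/=; apply.
apply: fin_bigcap_measurable => [|j _]; first exact: finite_finset.
rewrite -[X in measurable X]setTI; apply: continuous_measurable_fun_rV => //.
exact: coord_continuous.
Qed.

Lemma setI_closed_cylinders : setI_closed cylinders.
Proof.
move=> _ _ [a [b [S ->]]] [a' [b' [S' ->]]].
exists (fun j => Num.max (a j) (a' j)), (fun j => Num.min (b j) (b' j)),
  (fun g => S g && S' g).
apply/seteqP; split=> -[x g] /=.
  move=> [[h Sg] [h' Sg']]; split; last by rewrite Sg.
  by move=> j; rewrite gt_max lt_min; case/andP: (h j) => -> ->; exact: h'.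
move=> [h /andP[Sg Sg']]; split; split=> // j;
  by have := h j; rewrite gt_max lt_min => /andP[/andP[h1 h2] /andP[h3 h4]];
    apply/andP.
Qed.

Lemma cylinders_cover :
  \bigcup_n (obox (fun=> - n%:R) (fun=> n%:R) `*` [set g : discr G | true]) =
  [set: X].
Proof.
apply/seteqP; split=> // -[x g] _; exists (Num.truncn (\sum_j `|x 0 j|)).+1 => //.
split=> //= j; rewrite -ltr_norml (le_lt_trans _ (truncnS_gt _))//.
by rewrite (bigD1 j)//= lerDl sumr_ge0.
Qed.

(** For the inclusion that is not immediate, both projections are measurable for the sigma-algebra
    generated by the cylinders, hence so is the identity into the product. A half-line in one
    coordinate is a countable union of boxes that are bounded in the others. *)
Lemma cylinders_gen : @measurable _ X = <<s cylinders >>.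
Proof.
apply/seteqP; split; last first.
  apply: smallest_sub; first exact: sigma_algebra_measurable.
  by move=> _ [a [b [S ->]]]; apply: measurableX => //; exact: measurable_obox.
pose Y := g_sigma_algebraType cylinders.
have mY (A : set X) : cylinders A -> measurable (A : set Y).
  by move=> cA; exact: sub_sigma_algebra.
have m1 : measurable_fun setT (fun z : Y => (z : X).1).
  apply: measurable_fun_rV => j.
  apply: (measurability _ (RGenOInfty.measurableE R)).
  move=> _ [_ [c ->] <-]; rewrite setTI.
  have -> : (fun t : Y => (t : X).1 0 j) @^-1` `]c, +oo[ =
      \bigcup_n (obox (fun k => if k == j then c else - n%:R) (fun=> n%:R)
        `*` [set g : discr G | true]).
    apply/seteqP; split=> [[x g] /= cx|[x g] [n _] [/= h _]]; last first.
      by have := h j; rewrite eqxx in_itv/= andbT => /andP[].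
    exists (Num.truncn (\sum_j `|x 0 j|)).+1 => //; split=> //= k.
    have : `|x 0 k| < (Num.truncn (\sum_j `|x 0 j|)).+1%:R.
      rewrite (le_lt_trans _ (truncnS_gt _))//.
      by rewrite (bigD1 k)//= lerDl sumr_ge0.
    rewrite ltr_norml => /andP[h1 ->]; rewrite andbT.
    by case: eqP => // ->; move: cx; rewrite in_itv/= andbT.
  by apply: bigcupT_measurable => n; apply: mY; do 3 eexists.
have m2 : measurable_fun setT (fun z : Y => (z : X).2).
  move=> _ B _; rewrite setTI.
  have -> : (fun z : Y => (z : X).2) @^-1` B =
      \bigcup_n (obox (fun=> - n%:R) (fun=> n%:R)
        `*` [set g : discr G | `[< B g >]]).
    apply/seteqP; split=> [[x g] /= Bg|[x g] [n _] [/= _ /asboolP//]].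
    have : [set: X] (x, g) by [].
    rewrite -cylinders_cover => -[n _ [h _]]; exists n => //; split=> //=.
    exact/asboolP.
  by apply: bigcupT_measurable => n; apply: mY; do 3 eexists.
have m12 : measurable_fun setT (fun z : Y => ((z : X).1, (z : X).2)).
  exact: measurable_fun_pair.
move=> A mA; have := m12 measurableT A mA; rewrite setTI.
by congr (<<s _ >> _); apply/seteqP; split=> -[].
Qed.

Lemma measurable_test (zeta : Rd -> G -> R) : test_function zeta ->
  measurable_fun setT (fun z : X => zeta z.1 z.2).
Proof.
move=> tz; apply: (measurable_fun_discr (f := zeta)) => g.
by apply: continuous_measurable_fun_rV; exact: (tz g).1 0%N.
Qed.

(** Cylinders form a generating pi-system, and the indicator of a cylinder is the pointwise limit of
    products of bumps bounded by 1; dominated convergence then identifies the two measures of each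
    cylinder. *)
Lemma law_unique mu nu :
  (forall zeta : Rd -> G -> R, test_function zeta ->
    (\int[mu]_z (zeta z.1 z.2)%:E = \int[nu]_z (zeta z.1 z.2)%:E)%E) ->
  eq_law mu nu.
Proof.
move=> H A mA.
apply: (@measure_unique _ _ _ cylinders (fun n =>
  (obox (fun=> - n%:R) (fun=> n%:R) `*` [set g : discr G | true]))) => //.
- exact: cylinders_gen.
- exact: setI_closed_cylinders.
- by move=> n; do 3 eexists.
- exact: cylinders_cover.
- move=> _ [a [b [S ->]]].
  pose zeta n x (g : G) := if S g then prodf (fun j => bump (a j) (b j) n) x else 0.
  have tz n : test_function (zeta n).
    apply: (@test_prodf _ _ _ _ _ (- \sum_j (`|a j|)) (\sum_j `|b j|)).
      by move=> j m; exact: Cn_bump.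
    move=> j y /bump_neq0 /andP[ay yb]; apply/andP; split.
      apply: le_trans ay; rewrite lerNl.
      rewrite (bigD1 j)//= (le_trans (y := `|a j|))// ?lerDl ?sumr_ge0//.
      by rewrite -normrN ler_norm.
    apply: le_trans yb _.
    by rewrite (bigD1 j)//= (le_trans (ler_norm _))// lerDl sumr_ge0.
  have lim (m : probability X R) :
      (\int[m]_z (zeta n z.1 z.2)%:E)%E @[n --> \oo] -->
      m (obox a b `*` [set g | S g]).
    rewrite -[X in _ --> X](_ : \int[m]_z (\1_(obox a b `*` [set g | S g]) z)%:E = _)%E; last first.
      rewrite integral_indic ?setIT//; apply: measurableX => //.
      exact: measurable_obox.
    apply: (@dominated_cvg _ _ _ _ _ _ _ _ (cst 1%E)) => //.
    - move=> n; apply/measurable_EFinP; exact: measurable_test.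
    - move=> [x g] _; apply: cvg_EFin; first exact: nearW.
      rewrite /= indicE /zeta.
      have [Sg|Sg] := boolP (S g); last first.
        rewrite memNset; last by move=> [_] /=; rewrite (negbTE Sg).
        exact: cvg_cst.
      have -> : (((x, g) \in obox a b `*` [set g | S g]) : nat)%:R =
          \prod_(j < d) (((a j < x 0 j < b j)%R)%:R : R).
        case: (boolP [forall j, (a j < x 0 j < b j)%R]) => [/forallP h|].
          rewrite mem_set; last by split.
          by rewrite big1// => j _; rewrite h.
        move=> /forallPn[j hj]; rewrite memNset; last first.
          by move=> [/= /(_ j)]; rewrite (negbTE hj).
        by rewrite (bigD1 j)//= (negbTE hj) mul0r.
      apply: (@cvg_big R 'I_d *%R 1 xpredT (@mul_continuous R) _ _ _
        (fun j n => bump (a j) (b j) n (x 0 j))) => j _.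
      exact: cvg_bump.
    - apply/integrableP; split=> //.
      under eq_integral do rewrite abse1.
      by rewrite integral_cst//= mul1e probability_setT ltry.
    - move=> n [x g] _; rewrite lee_fin /zeta /=; case: ifP => _; last first.
        by rewrite normr0.
      rewrite normr_prod prodr_ile1// => j _; apply/andP; split=> //.
      by rewrite ger0_norm ?bump_ge0// bump_le1.
  have l2 := lim nu; have E : (fun n => \int[mu]_z (zeta n z.1 z.2)%:E)%E =
      (fun n => \int[nu]_z (zeta n z.1 z.2)%:E)%E by apply/funext => n; exact: H.
  have := lim mu; rewrite E => l1.
  exact: (@cvg_unique _ (@ereal_hausdorff R) _ _ _ _ l1 l2).
- move=> n; apply: le_lt_trans (probability_le1 _ _) (ltry _).
  by apply: measurableX => //; exact: measurable_obox.
Qed.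

End law_uniqueness.

(** * Graph Laplacians *)

Section laplacian.
Context {R : realFieldType} {G : finType}.
Implicit Types (W K : G -> G -> R) (f y z : G -> R).

(** The Dirichlet form of the weighted graph. The sum runs over ordered pairs of nodes, as in the
    action, so every edge is counted in both directions. *)
Definition dirichlet W y z : R :=
  \sum_g \sum_g' (y g' - y g) * (z g' - z g) * W g g'.

Lemma dirichletC W y z : dirichlet W y z = dirichlet W z y.
Proof.
by apply: eq_bigr => g _; apply: eq_bigr => g' _; rewrite (mulrC (y _ - _)).
Qed.

Lemma dirichlet_suml (I : finType) W (c : I -> R) (e : I -> G -> R) z :
  dirichlet W (fun g => \sum_i c i * e i g) z =
  \sum_i c i * dirichlet W (e i) z.
Proof.
rewrite /dirichlet; under [RHS]eq_bigr do rewrite mulr_sumr.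
rewrite [RHS]exchange_big; apply: eq_bigr => g _ /=.
under [RHS]eq_bigr do rewrite mulr_sumr.
rewrite [RHS]exchange_big; apply: eq_bigr => g' _ /=.
rewrite -sumrB !mulr_suml; apply: eq_bigr => i _; ring.
Qed.

Lemma dirichlet_cst W y (c : R) : dirichlet W (fun=> c) y = 0.
Proof.
by rewrite /dirichlet big1// => g _; rewrite big1// => g' _; rewrite subrr !mul0r.
Qed.

Lemma dirichlet_ge0 W y : (forall g g', 0 <= W g g') -> 0 <= dirichlet W y y.
Proof.
move=> W0; apply: sumr_ge0 => g _; apply: sumr_ge0 => g' _.
by rewrite mulr_ge0// -expr2 sqr_ge0.
Qed.

Lemma dirichlet_le W K (c : R) y : (forall g g', c * K g g' <= W g g') ->
  c * dirichlet K y y <= dirichlet W y y.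
Proof.
move=> cKW; rewrite /dirichlet mulr_sumr ler_sum// => g _.
rewrite mulr_sumr ler_sum// => g' _.
by rewrite mulrCA ler_wpM2l// -expr2 sqr_ge0.
Qed.

(** A vanishing sum of nonnegative terms forces [y] to agree at the two ends of each edge of [K],
    and paths propagate the equality. *)
Lemma dirichlet0_cst W K y : (forall g g', 0 <= W g g') ->
  (forall g g', 0 < K g g' -> 0 < W g g') ->
  (forall g g', connect [rel a b | 0 < K a b] g g') ->
  dirichlet W y y = 0 -> forall g g', y g = y g'.
Proof.
move=> W0 KW conn yy0 g g'.
have E a b : 0 < K a b -> y a = y b.
  move=> /KW Wab; have s0 h : 0 <= \sum_h' (y h' - y h) * (y h' - y h) * W h h'.
    by apply: sumr_ge0 => h' _; rewrite mulr_ge0// -expr2 sqr_ge0.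
  have /psumr_eq0P/(_ yy0 a isT) : forall h : G, true ->
    0 <= \sum_h' (y h' - y h) * (y h' - y h) * W h h' by move=> h _; exact: s0.
  move=> /psumr_eq0P H.
  have {H} := H (fun h' _ => mulr_ge0 (sqr_ge0 (y h' - y a)) (W0 a h')) b isT.
  by move=> /eqP; rewrite !mulf_eq0 orbb (gt_eqF Wab) orbF subr_eq0 => /eqP.
have /connectP[p pp ->] := conn g g'.
elim: p g pp => //= b p IH a /andP[/E -> /IH].
by [].
Qed.

(* Adding the rank one form [(sum y) (sum z)] makes the Laplacian invertible. *)
Definition laplace_mx W : 'M[R]_#|G| := \matrix_(a, b)
  (dirichlet W (fun g => (g == enum_val a)%:R) (fun g => (g == enum_val b)%:R)
   + 1).

Lemma laplace_mxE W (u v : 'rV[R]_#|G|) :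
  (u *m laplace_mx W *m v^T) 0 0 =
  dirichlet W (fun g => u 0 (enum_rank g)) (fun g => v 0 (enum_rank g)) +
  (\sum_a u 0 a) * (\sum_b v 0 b).
Proof.
have D (w : 'rV[R]_#|G|) : (fun g => w 0 (enum_rank g)) =
    (fun g => \sum_a w 0 a * (g == enum_val a)%:R).
  apply/funext => g; rewrite (bigD1 (enum_rank g))//= enum_rankK eqxx mulr1.
  rewrite big1 ?addr0// => a ag; rewrite (_ : g == _ = false) ?mulr0//.
  by apply: contraNF ag => /eqP ->; rewrite enum_valK.
rewrite (D u) dirichlet_suml mulr_suml -big_split/= !mxE.
transitivity (\sum_b \sum_a u 0 a * laplace_mx W a b * v 0 b).
  by apply: eq_bigr => b _; rewrite !mxE mulr_suml.
rewrite exchange_big/=; apply: eq_bigr => a _.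
rewrite dirichletC (D v) dirichlet_suml !mulr_sumr -big_split/=.
by apply: eq_bigr => b _; rewrite !mxE dirichletC; ring.
Qed.

(** Cramer's formula for the solution of the regularized Laplace equation with source [f].
    Determinant and adjugate depend polynomially on the weights, which makes measurability in
    parameters accessible; if the determinant vanishes the value is 0. *)
Definition potential W f (g : G) : R :=
  (\det (laplace_mx W))^-1 *
  ((\row_a f (enum_val a)) *m \adj (laplace_mx W)) 0 (enum_rank g).

Lemma potential0 W g : potential W (fun=> 0) g = 0.
Proof.
rewrite /potential (_ : \row_a _ = 0) ?mul0mx ?mxE ?mulr0//.
by apply/rowP => a; rewrite !mxE.
Qed.

Lemma sum_enum_rank (u : 'rV[R]_#|G|) : \sum_a u 0 a = \sum_g u 0 (enum_rank g).
Proof. by rewrite (reindex _ (onW_bij _ (@enum_rank_bij G))). Qed.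

(** A vector in the kernel of the regularized matrix has zero Dirichlet energy and zero sum; it is
    therefore constant, and then 0. So the matrix is invertible, and only the rank one term has to
    be removed from the solution. *)
Lemma potentialP W K f : (forall g g', 0 <= W g g') ->
  (forall g g', 0 < K g g' -> 0 < W g g') ->
  (forall g g', connect [rel a b | 0 < K a b] g g') ->
  \sum_g f g = 0 ->
  forall z, dirichlet W z (potential W f) = \sum_g z g * f g.
Proof.
move=> W0 KW conn f0 z.
have detN0 : \det (laplace_mx W) != 0.
  apply/det0P => -[v vN0 vM]; move/eqP: vN0; apply.
  have := laplace_mxE W v v; rewrite vM mul0mx mxE => /esym/eqP.
  rewrite paddr_eq0 ?dirichlet_ge0// -?expr2 ?sqr_ge0// sqrf_eq0.
  move=> /andP[/eqP/(dirichlet0_cst W0 KW conn) vc /eqP].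
  rewrite sum_enum_rank; move=> s0.
  apply/rowP => a; rewrite mxE -(enum_valK a).
  move: s0; under eq_bigr do rewrite (vc _ (enum_val a)).
  rewrite sumr_const => /eqP; rewrite mulrn_eq0 => /orP[|/eqP//].
  by move=> /eqP/card0_eq/(_ (enum_val a)).
pose F : 'rV[R]_#|G| := \row_a f (enum_val a).
pose u := (\det (laplace_mx W))^-1 *: (F *m \adj (laplace_mx W)).
have uE g : potential W f g = u 0 (enum_rank g) by rewrite [RHS]mxE.
have uM : u *m laplace_mx W = F.
  by rewrite -scalemxAl -mulmxA mul_adj_mx mul_mx_scalar scalerA mulVf ?scale1r.
have key y : dirichlet W (potential W f) y + (\sum_g potential W f g) *
    (\sum_g y g) = \sum_g y g * f g.
  have := laplace_mxE W u (\row_a y (enum_val a)); rewrite uM mxE.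
  rewrite !sum_enum_rank (reindex _ (onW_bij _ (@enum_rank_bij G)))/=.
  under eq_bigr do rewrite !mxE enum_rankK mulrC.
  move=> ->; congr (_ + _ * _).
  - congr dirichlet; apply/funext => g; first by rewrite uE.
    by rewrite mxE enum_rankK.
  - by apply: eq_bigr => g _; rewrite uE.
  - by apply: eq_bigr => g _; rewrite mxE enum_rankK.
(* Testing with the constant 1 kills the Dirichlet form, and [f] has zero sum; hence the potential
   has zero sum and the rank one term disappears from [key]. *)
have := key (fun=> 1); rewrite dirichletC dirichlet_cst add0r.
under [RHS]eq_bigr do rewrite mul1r.
rewrite f0 sumr_const => /eqP; rewrite mulf_eq0 => /orP[/eqP s0|].
  by have := key z; rewrite s0 mul0r addr0 dirichletC.
rewrite pnatr_eq0 => /eqP/card0_eq G0.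
rewrite /dirichlet !big1// => g; by have := G0 g.
Qed.

(** Larger conductances dissipate less for the same source. The energy of [psi] equals the mixed
    [K]-form of [psi] and [chi]; Young's inequality with weight [c] bounds it by half of itself plus
    half of the right-hand side. *)
Lemma potential_energy W K f (c : R) (chi psi : G -> R) : 0 < c ->
  (forall g g', 0 <= K g g') ->
  (forall g g', c * K g g' <= W g g') ->
  (forall z, dirichlet K z chi = \sum_g z g * f g) ->
  (forall z, dirichlet W z psi = \sum_g z g * f g) ->
  dirichlet W psi psi <= c^-1 * dirichlet K chi chi.
Proof.
move=> c0 K0 cKW chiP psiP.
have E : dirichlet W psi psi = dirichlet K psi chi by rewrite psiP chiP.
have : dirichlet K psi chi <=
    2^-1 * (c * dirichlet K psi psi) + 2^-1 * (c^-1 * dirichlet K chi chi).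
  rewrite /dirichlet !mulr_sumr -big_split ler_sum// => g _.
  rewrite !mulr_sumr -big_split ler_sum// => g' _ /=.
  set a := psi g' - psi g; set b := chi g' - chi g.
  rewrite -subr_ge0 (_ : _ - _ = (2 * c)^-1 * (c * a - b) ^+ 2 * K g g').
    by rewrite mulr_ge0// mulr_ge0 ?sqr_ge0// invr_ge0 mulr_ge0// ltW.
  by field; rewrite gt_eqF.
have := dirichlet_le psi cKW; rewrite E => h1 h2; lra.
Qed.

End laplacian.

Section measurability.
Context {R : realType}.

Lemma measurable_invr : measurable_fun setT (fun x : R => x^-1).
Proof.
rewrite (_ : (fun x : R => x^-1) =
    (fun x => if x == 0 then 0 else x^-1)); last first.
  by apply/funext => x; case: eqP => [->|//]; rewrite invr0.
apply: measurable_fun_if => //.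
  by apply: measurable_fun_eqr => //; exact: measurable_cst.
rewrite setTI (_ : _ @^-1` _ = [set x : R | x != 0]); last first.
  by apply/seteqP; split => x /=; case: eqP.
apply: open_continuous_measurable_fun.
  rewrite (_ : mkset _ = ~` [set 0]); first exact/closed_openC/closed_eq.
  by apply/seteqP; split => x /= /eqP.
by move=> x; rewrite inE/= => x0; exact: inv_continuous.
Qed.

Context d (T : measurableType d) (D : set T) {G : pfinType}.

Lemma measurable_funV (f : T -> R) : measurable_fun D f ->
  measurable_fun D (fun x => (f x)^-1).
Proof. by move=> mf; apply: (measurableT_comp measurable_invr). Qed.

Lemma measurable_det n (M : T -> 'M[R]_n) :
  (forall i j, measurable_fun D (fun x => M x i j)) ->
  measurable_fun D (fun x => \det (M x)).
Proof.
move=> mM; apply: measurable_sum => s; apply: measurable_funM => //.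
by apply: measurable_prod => i _.
Qed.

Lemma measurable_potential (W : T -> G -> G -> R) (f : T -> G -> R) g :
  (forall g g', measurable_fun D (fun x => W x g g')) ->
  (forall g, measurable_fun D (f^~ g)) ->
  measurable_fun D (fun x => potential (W x) (f x) g).
Proof.
move=> mW mf.
have mM a b : measurable_fun D (fun x => laplace_mx (W x) a b).
  rewrite (_ : (fun x => _) = fun x => dirichlet (W x)
      (fun g => (g == enum_val a)%:R) (fun g => (g == enum_val b)%:R) + 1); last first.
    by apply/funext => x; rewrite mxE.
  apply: measurable_funD => //.
  apply: measurable_sum => h; apply: measurable_sum => h'.
  exact: measurable_funM.
apply: measurable_funM; first by apply: measurable_funV; exact: measurable_det.
under eq_fun do rewrite mxE.
apply: measurable_sum => a; under eq_fun do rewrite !mxE.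
apply: measurable_funM => //; apply: measurable_funM => //.
apply: measurable_det => i j.
by rewrite (_ : (fun x => _) = (fun x => laplace_mx (W x)
  (lift (enum_rank g) i) (lift a j)))//; apply/funext => x; rewrite mxE mxE.
Qed.

End measurability.

(** * Product laws and the measure [hat mu] *)

Section mixture.
Context {R : realType} {d : nat} {G : pfinType}.
Local Notation Rd := 'rV[R]_d.
Local Notation X := ('rV[R]_d * discr G)%type.
Local Open Scope ereal_scope.

Record simplex := Simplex {
  weight :> G -> R ;
  weight_ge0 : forall g, (0 <= weight g)%R ;
  weight_sum : (\sum_g weight g = 1)%R }.

Definition at_node (g : discr G) (x : Rd) : X := (x, g).

Lemma measurable_at_node g : measurable_fun setT (at_node g).
Proof. by apply: measurable_fun_pair => //; exact: measurable_cst. Qed.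

HB.instance Definition _ g :=
  isMeasurableFun.Build _ _ _ _ (at_node g) (measurable_at_node g).

(** The product of a space law and node weights, written as a finite sum of slices so that its
    integrals and its conditional distribution are explicit. *)
Definition mix (U : probability Rd R) (p : simplex) (A : set X) : \bar R :=
  \sum_g (p g)%:E * U (at_node g @^-1` A).

Section instances.
Variables (U : probability Rd R) (p : simplex).

Let node (n : nat) : discr G := nth point (enum G) n.

Let part (n : nat) : {measure set X -> \bar R} :=
  mscale (NngNum (weight_ge0 p (node n))) (distribution U (at_node (node n))).

Let mixE : mix U p = msum part #|G|.
Proof.
apply/funext => A; rewrite /mix /msum.
rewrite (reindex _ (onW_bij _ (@enum_val_bij G))).
by apply: eq_bigr => n _; rewrite (enum_val_nth point).
Qed.

Let mix0 : mix U p set0 = 0. Proof. by rewrite mixE measure0. Qed.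

Let mix_ge0 A : 0 <= mix U p A. Proof. by rewrite mixE. Qed.

Let mix_sigma_additive : semi_sigma_additive (mix U p).
Proof. by rewrite mixE; exact: measure_semi_sigma_additive. Qed.

HB.instance Definition _ := isMeasure.Build _ _ _ (mix U p)
  mix0 mix_ge0 mix_sigma_additive.

Let mix_setT : mix U p setT = 1.
Proof.
rewrite /mix; under eq_bigr do rewrite preimage_setT probability_setT mule1.
by rewrite sumEFin weight_sum.
Qed.

HB.instance Definition _ := Measure_isProbability.Build _ _ _ (mix U p) mix_setT.

Lemma ge0_integral_mix (f : X -> \bar R) :
  measurable_fun setT f -> (forall z, 0 <= f z) ->
  \int[mix U p]_z f z = \sum_g (p g)%:E * \int[U]_x f (x, g).
Proof.
move=> mf f0.
transitivity (\int[msum part #|G|]_z f z).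
  by apply: eq_measure_integral => A _ _; rewrite -[LHS]/(mix U p A) mixE.
rewrite ge0_integral_measure_sum//.
rewrite [RHS](reindex _ (onW_bij _ (@enum_val_bij G))).
apply: eq_bigr => n _; rewrite (enum_val_nth point) ge0_integral_mscale//=.
by congr (_ * _); rewrite ge0_integral_distribution.
Qed.

End instances.

(** The formula for nonnegative functions applies to [f + M]; the constant is then cancelled, all
    terms being finite. *)
Lemma integral_mix_bounded (U : probability Rd R) (p : simplex) (f : X -> R) (M : R) :
  measurable_fun setT f -> (forall z, `|f z| <= M)%R ->
  \int[mix U p]_z (f z)%:E = \sum_g (p g)%:E * \int[U]_x (f (x, g))%:E.
Proof.
move=> mf fM.
have ci (m : probability Rd R) g : m.-integrable setT (fun x => (f (x, g))%:E).
  apply: (@le_integrable _ _ _ m _ measurableT _ (cst M%:E)) => //.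
  - apply/measurable_EFinP; apply: (measurableT_comp mf).
    exact: measurable_at_node.
  - by move=> x _; rewrite /= lee_fin (le_trans (fM _))// ler_norm.
  - exact: finite_measure_integrable_cst.
have mp : measurable_fun setT (fun z => (f z + M)%:E).
  by apply/measurable_EFinP; exact: measurable_funD.
have p0 z : 0 <= (f z + M)%:E.
  by rewrite lee_fin -lerBlDr sub0r; have := fM z; rewrite ler_norml => /andP[].
have ciM (d' : measure_display) (T : measurableType d') (m : probability T R) :
    m.-integrable setT (cst M%:E) by exact: finite_measure_integrable_cst.
have fi : (mix U p).-integrable setT (EFin \o f).
  apply: (@le_integrable _ _ _ (mix U p) _ measurableT _ (cst M%:E)) => //.
  - exact/measurable_EFinP.
  - by move=> x _; rewrite /= lee_fin (le_trans (fM _))// ler_norm.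
  - exact: ciM.
have := ge0_integral_mix U p mp p0.
under eq_integral do rewrite EFinD.
rewrite (integralD measurableT fi (ciM _ _ (mix U p))).
have cM (d' : measure_display) (T : measurableType d') (m : probability T R) :
    \int[m]_x cst M%:E x = M%:E.
  by rewrite integral_cst// -[RHS]mule1; congr (_ * _); exact: probability_setT.
rewrite cM.
have E g : \int[U]_x (f (x, g) + M)%:E = \int[U]_x (f (x, g))%:E + M%:E.
  under eq_integral do rewrite EFinD.
  rewrite (integralD measurableT (ci U g) (ciM _ _ U)).
  by rewrite cM.
under eq_bigr do rewrite E.
have fn g : \int[U]_x (f (x, g))%:E \is a fin_num by exact: integrable_fin_num (ci U g).
under eq_bigr do rewrite muleDr ?fin_num_adde_defl//.
rewrite big_split/= -ge0_sume_distrl ?sumEFin ?weight_sum ?mul1e; last first.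
  by move=> g _; rewrite lee_fin weight_ge0.
by move=> /(congr1 (fun x => x - M%:E)); rewrite !addeK.
Qed.

Lemma marginal_mix U p : marginal (mix U p) = U.
Proof.
apply/funext => A; rewrite /marginal /pushforward /= /mix.
transitivity (\sum_g (p g)%:E * U A); first by apply: eq_bigr.
by rewrite -ge0_sume_distrl ?sumEFin ?weight_sum ?mul1e// => g _;
  rewrite lee_fin weight_ge0.
Qed.

Lemma mix_is_conditional U p : is_conditional (mix U p) (fun=> p).
Proof.
split=> [g|x g|x|A g mA].
- exact: measurable_cst.
- exact: weight_ge0.
- exact: weight_sum.
- rewrite marginal_mix integral_cst// -[LHS]/(mix U p _) /mix.
  rewrite (bigD1 g)//= big1 ?adde0.
    by congr (_ * U _); apply/seteqP; split => x // [].
  move=> h hg; rewrite (_ : _ @^-1` _ = set0) ?measure0 ?mule0//.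
  by apply/seteqP; split => x // -[_ /= hg']; rewrite hg' eqxx in hg.
Qed.

(** When no conditional distribution is available, [xget] returns the zero function, which satisfies
    the same bounds. *)
Lemma conditionalP (mu : probability X R) g :
  measurable_fun setT (fun x => conditional mu x g) /\
  forall x, (0 <= conditional mu x g <= 1)%R.
Proof.
rewrite /conditional; case: xgetP => [k _ [mk k0 k1 _]|_].
  split=> // x; rewrite k0/= -(k1 x) (bigD1 g)//= lerDl sumr_ge0//.
by split=> [|x]; [exact: measurable_cst|rewrite /= lexx ler01].
Qed.

Lemma measurable_set1_rV (x : Rd) : measurable [set x].
Proof.
rewrite (_ : [set x] = \bigcap_(j in [set: 'I_d])
    ((fun y : Rd => y ord0 j) @^-1` [set x ord0 j])).
  apply: fin_bigcap_measurable => [|j _]; first exact: finite_finset.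
  rewrite -[X in measurable X]setTI; apply: continuous_measurable_fun_rV => //.
  exact: coord_continuous.
apply/seteqP; split => [y -> //|y h]; apply/rowP => j; exact: h.
Qed.

(** Conditional distributions are determined only up to null sets of the marginal. Integrating the
    defining identity over the single point [x] and cancelling its positive mass gives the exact
    value at an atom. *)
Lemma conditional_mix (U : probability Rd R) (p : simplex) (x : Rd) g :
  U [set x] != 0 -> conditional (mix U p) x g = p g.
Proof.
move=> Ux; have : is_conditional (mix U p) (conditional (mix U p)).
  apply: (@xgetPex _ _ [set k | is_conditional (mix U p) k]).
  by exists (fun=> weight p); exact: mix_is_conditional.
move=> [mk k0 _ /(_ [set x] g (measurable_set1_rV x))].
have [_ _ _ ->] := mix_is_conditional U p; last exact: measurable_set1_rV.
rewrite marginal_mix integral_cst//; last exact: measurable_set1_rV.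
rewrite (_ : \int[U]_(y in [set x]) (conditional (mix U p) y g)%:E =
             (conditional (mix U p) x g)%:E * U [set x]); last first.
  rewrite -(integral_cst U (measurable_set1_rV x)).
  by apply: eq_integral => y; rewrite inE /= => ->.
have Ufin : U [set x] \is a fin_num.
  by rewrite fin_num_measure//; exact: measurable_set1_rV.
have E (a : R) : a%:E * U [set x] = (a * fine (U [set x]))%:E.
  by rewrite EFinM fineK.
move=> /esym; rewrite [LHS]E [RHS]E => -[].
apply: mulIf; apply: contra Ux => /eqP.
by move=> U0; rewrite -(fineK Ufin) U0.
Qed.

End mixture.
Arguments simplex R G : clear implicits.

Lemma measurable_fun_pair_on d d1 d2 (T : measurableType d)
    (T1 : measurableType d1) (T2 : measurableType d2) (D : set T)
    (f : T -> T1) (g : T -> T2) : measurable D ->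
  measurable_fun D f -> measurable_fun D g ->
  measurable_fun D (fun x => (f x, g x)).
Proof.
move=> mD mf mg; apply: (measurability _ (measurable_prod_measurableType T1 T2)).
move=> _ [_ [A mA [B mB <-]] <-].
rewrite (_ : _ `&` _ = (D `&` f @^-1` A) `&` (D `&` g @^-1` B)).
  by apply: measurableI; [exact: mf|exact: mg].
by apply/seteqP; split => x /= => [[? []//]|[[? ?] []//]].
Qed.

Section hat.
Context {R : realType} {d : nat} {G : pfinType}.
Local Notation Rd := 'rV[R]_d.
Local Notation X := ('rV[R]_d * discr G)%type.
Variable theta : mobility R d G.
Implicit Types mu nu : probability X R.

Definition space_of (z : X) : Rd := z.1.

Lemma measurable_space_of : measurable_fun setT space_of.
Proof. exact: measurable_fst. Qed.

HB.instance Definition _ :=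
  isMeasurableFun.Build _ _ _ _ space_of measurable_space_of.

(** [hat_base] repackaged as a bundled measure, to which the integration lemmas apply. *)
Definition hat_measure mu : {measure set Rd -> \bar R} :=
  if `[< A0 theta >] then lebesgue_rV d else distribution mu space_of.

Lemma hat_baseE mu : hat_base theta mu = hat_measure mu.
Proof. by rewrite /hat_base /hat_measure; case: ifP. Qed.

Hypothesis theta_ge0 : mobility_ge0 theta.
Hypothesis mtheta : mobility_measurable theta.

Lemma hat_density_ge0 mu x g g' : 0 <= hat_density theta mu x g g'.
Proof.
by apply: theta_ge0; [have [_ /(_ x)/andP[]] := conditionalP mu g|
  have [_ /(_ x)/andP[]] := conditionalP mu g'].
Qed.

Lemma measurable_theta_comp (d' : measure_display) (T : measurableType d')
    (D : set T) (x : T -> Rd) (s t : T -> R) g g' : measurable D ->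
  measurable_fun D x -> measurable_fun D s -> measurable_fun D t ->
  (forall y, D y -> 0 <= s y) -> (forall y, D y -> 0 <= t y) ->
  measurable_fun D (fun y => theta (x y) g g' (s y) (t y)).
Proof.
move=> mD mx ms mt s0 t0.
pose Q := [set p : Rd * (R * R) | 0 <= p.2.1 /\ 0 <= p.2.2].
have mQ : measurable Q.
  rewrite (_ : Q = setT `*` (`[0, +oo[%classic `*` `[0, +oo[%classic)).
    by apply: measurableX => //; apply: measurableX => //; exact: measurable_itv.
  apply/seteqP; split => -[y [u v]] /=; rewrite !in_itv/= !andbT; first by [].
  by case=> _ [].
apply: (@measurable_comp _ _ _ _ _ _ Q (fun p => theta p.1 g g' p.2.1 p.2.2) D
  (fun y => (x y, (s y, t y)))) => //.
- by move=> _ [y Dy <-] /=; split; [exact: s0|exact: t0].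
- by apply: measurable_fun_pair_on => //; exact: measurable_fun_pair_on.
Qed.

Lemma measurable_hat_density mu g g' :
  measurable_fun setT (fun x => hat_density theta mu x g g').
Proof.
apply: measurable_theta_comp => //.
- by have [] := conditionalP mu g.
- by have [] := conditionalP mu g'.
- by move=> x _; have [_ /(_ x)/andP[]] := conditionalP mu g.
- by move=> x _; have [_ /(_ x)/andP[]] := conditionalP mu g'.
Qed.

Definition hat_int mu (F : Rd -> G -> G -> R) (x : Rd) : R :=
  \sum_g \sum_g' F x g g' * hat_density theta mu x g g'.

Lemma hat_integralE mu D (F : Rd -> G -> G -> R) :
  hat_integral theta mu D F = (\int[hat_measure mu]_(x in D) (hat_int mu F x)%:E)%E.
Proof. by rewrite /hat_integral hat_baseE. Qed.

Lemma measurable_hat_int mu (D : set Rd) (F : Rd -> G -> G -> R) :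
  (forall g g', measurable_fun D (fun x => F x g g')) ->
  measurable_fun D (hat_int mu F).
Proof.
move=> mF; apply: measurable_sum => g; apply: measurable_sum => g'.
apply: measurable_funM => //; apply: measurable_funTS.
exact: measurable_hat_density.
Qed.

Lemma hat_int_ge0 mu (F : Rd -> G -> G -> R) x :
  (forall g g', 0 <= F x g g') -> 0 <= hat_int mu F x.
Proof.
move=> F0; apply: sumr_ge0 => g _; apply: sumr_ge0 => g' _.
by rewrite mulr_ge0// hat_density_ge0.
Qed.

End hat.

Lemma integral_cst_prob d (T : measurableType d) (R : realType)
    (m : probability T R) (c : R) : (\int[m]__ c%:E = c%:E)%E.
Proof.
rewrite (integral_cst m measurableT c%:E) -[RHS]mule1; congr (_ * _)%E.
exact: probability_setT.
Qed.

(** * Rates and energies of a pair of fields at a frozen time *)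

Section fields.
Context {R : realType} {d : nat} {G : pfinType}.
Local Notation Rd := 'rV[R]_d.
Local Notation X := ('rV[R]_d * discr G)%type.
Variables (theta : mobility R d G) (K : G -> G -> R).
Hypothesis theta_ge0 : mobility_ge0 theta.
Hypothesis mtheta : mobility_measurable theta.
Hypothesis K_ge0 : forall g g', 0 <= K g g'.
Implicit Types (m : probability X R) (v : Rd -> G -> Rd) (h : Rd -> G -> G -> R)
  (zeta : Rd -> G -> R).

Definition drift_of zeta v (z : X) : R :=
  dot (grad (zeta ^~ z.2) z.1) (v z.1 z.2).

Definition reaction_of zeta h (x : Rd) (g g' : G) : R :=
  grad_g zeta x g g' * h x g g' * K g g'.

Definition rate_of m v h zeta : \bar R :=
  (\int[m]_z (drift_of zeta v z)%:E +
   hat_integral theta m setT (reaction_of zeta h))%E.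

Definition energy_of m v h : \bar R :=
  (\int[m]_z (sqnorm (v z.1 z.2))%:E +
   hat_integral theta m setT (fun x g g' => (h x g g' ^+ 2 * K g g')%R))%E.

(** Integrability for all test functions at once. For such fields the rate is finite and scales with
    the fields, also by negative factors. *)
Definition admissible m v h := forall zeta, test_function zeta ->
  m.-integrable setT (EFin \o drift_of zeta v) /\
  (hat_integral theta m setT
     (fun x g g' => `|reaction_of zeta h x g g'|%R) < +oo)%E.

Definition measurable_fields v h :=
  (forall g i, measurable_fun setT (fun x => v x g 0 i)) /\
  (forall g g', measurable_fun setT (fun x => h x g g')).

Lemma measurable_drift zeta v h : test_function zeta -> measurable_fields v h ->
  measurable_fun setT (drift_of zeta v).
Proof.
move=> tz [mv _].
apply: (measurable_fun_discr (f := fun x g => dot (grad (zeta ^~ g) x) (v x g))).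
move=> g; apply: measurable_sum => i; apply: measurable_funM => //.
under eq_fun do rewrite mxE.
apply: continuous_measurable_fun_rV.
by have [_ /(_ i)[_]] := (tz g).1 1%N.
Qed.

Lemma measurable_reaction zeta v h g g' :
  test_function zeta -> measurable_fields v h ->
  measurable_fun setT (fun x => reaction_of zeta h x g g').
Proof.
move=> tz [_ mh]; apply: measurable_funM => //; apply: measurable_funM => //.
by apply: measurable_funB; apply: continuous_measurable_fun_rV;
  [exact: (tz g').1 0%N|exact: (tz g).1 0%N].
Qed.

Lemma reaction_integrable zeta m v h : test_function zeta ->
  measurable_fields v h ->
  (hat_integral theta m setT
     (fun x g g' => `|reaction_of zeta h x g g'|%R) < +oo)%E ->
  (hat_measure theta m).-integrable setT
    (EFin \o hat_int theta m (reaction_of zeta h)).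
Proof.
move=> tz mvh; rewrite hat_integralE => fin.
have mr g g' := measurable_reaction g g' tz mvh.
apply/integrableP; split.
  by apply/measurable_EFinP; exact: measurable_hat_int.
apply: le_lt_trans fin; apply: ge0_le_integral => //.
- by apply/measurable_EFinP/measurableT_comp => //; exact: measurable_hat_int.
- apply/measurable_EFinP; apply: measurable_hat_int => // g g'.
  by apply: measurableT_comp.
- move=> x _; rewrite lee_fin; apply: le_trans (ler_norm_sum _ _ _) _.
  apply: ler_sum => g _; apply: le_trans (ler_norm_sum _ _ _) _.
  by apply: ler_sum => g' _; rewrite normrM (@ger0_norm _ (hat_density _ _ _ _ _))
    ?hat_density_ge0.
Qed.

Lemma rate_of_fin_num m v h zeta : test_function zeta ->
  measurable_fields v h -> admissible m v h -> rate_of m v h zeta \is a fin_num.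
Proof.
move=> tz mvh /(_ _ tz)[i1 /(reaction_integrable tz mvh) i2].
rewrite /rate_of fin_numD integrable_fin_num//= hat_integralE.
exact: integrable_fin_num i2.
Qed.

Lemma dotZr (u w : Rd) (c : R) : dot u (c *: w) = c * dot u w.
Proof.
by rewrite /dot mulr_sumr; apply: eq_bigr => i _; rewrite mxE mulrCA.
Qed.

Lemma hat_intZ m (c : R) (F F' : Rd -> G -> G -> R) x :
  (forall g g', F' x g g' = c * F x g g') ->
  hat_int theta m F' x = c * hat_int theta m F x.
Proof.
move=> E; rewrite /hat_int mulr_sumr; apply: eq_bigr => g _.
by rewrite mulr_sumr; apply: eq_bigr => g' _; rewrite E mulrA.
Qed.

Lemma rate_ofZ m (c : R) v h v' h' zeta : test_function zeta ->
  measurable_fields v h -> admissible m v h ->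
  (forall x g, v' x g = c *: v x g) -> (forall x g g', h' x g g' = c * h x g g') ->
  rate_of m v' h' zeta = (c%:E * rate_of m v h zeta)%E.
Proof.
move=> tz mvh /(_ _ tz)[i1 /(reaction_integrable tz mvh) i2] vE hE.
rewrite /rate_of muleDr//; last first.
  by rewrite fin_num_adde_defr// integrable_fin_num.
rewrite -integralZl// !hat_integralE -integralZl//; congr (_ + _)%E.
  by apply: eq_integral => z _; rewrite /= -EFinM /drift_of vE dotZr.
apply: eq_integral => x _; rewrite /= -EFinM (@hat_intZ m c (reaction_of zeta h))//.
by move=> g g'; rewrite /reaction_of hE; ring.
Qed.

Lemma admissibleZ m (c : R) v h v' h' : measurable_fields v h ->
  admissible m v h ->
  (forall x g, v' x g = c *: v x g) -> (forall x g g', h' x g g' = c * h x g g') ->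
  admissible m v' h'.
Proof.
move=> mvh adm vE hE zeta tz; have [i1 i2] := adm _ tz; split.
  rewrite (_ : EFin \o _ = (fun z => c%:E * (EFin \o drift_of zeta v) z)%E).
    exact: integrableZl.
  by apply/funext => z; rewrite /= -EFinM /drift_of vE dotZr.
rewrite hat_integralE in i2; rewrite hat_integralE.
have mr g g' := measurable_reaction g g' tz mvh.
have E x : ((hat_int theta m (fun x g g' => `|reaction_of zeta h' x g g'|%R) x)%:E =
    `|c|%:E * (hat_int theta m
    (fun x g g' => `|reaction_of zeta h x g g'|%R) x)%:E)%E.
  rewrite -EFinM; congr EFin; apply: hat_intZ => g g'.
  by rewrite -normrM /reaction_of hE; congr (`| _ |); ring.
under eq_integral do rewrite E.
rewrite ge0_integralZl//.
- exact: lte_mul_pinfty.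
- apply/measurable_EFinP; apply: measurable_hat_int => // g g'.
  exact: measurableT_comp.
- by move=> x _; rewrite lee_fin hat_int_ge0.
Qed.

Lemma sqnorm_ge0 (u : Rd) : 0 <= sqnorm u.
Proof. by apply: sumr_ge0 => i _; exact: sqr_ge0. Qed.

Lemma measurable_sqnorm_field v h : measurable_fields v h ->
  measurable_fun setT (fun z : X => sqnorm (v z.1 z.2)).
Proof.
move=> [mv _]; apply: (measurable_fun_discr (f := fun x g => sqnorm (v x g))).
by move=> g; apply: measurable_sum => i; exact: measurable_funX.
Qed.

Lemma energy_of_ge0 m v h : (0 <= energy_of m v h)%E.
Proof.
rewrite /energy_of hat_integralE adde_ge0//.
  by apply: integral_ge0 => z _; rewrite lee_fin sqnorm_ge0.
apply: integral_ge0 => x _; rewrite lee_fin hat_int_ge0// => g g'.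
by rewrite mulr_ge0// sqr_ge0.
Qed.

Lemma energy_ofZ m (c : R) v h v' h' : measurable_fields v h ->
  (forall x g, v' x g = c *: v x g) -> (forall x g g', h' x g g' = c * h x g g') ->
  energy_of m v' h' = ((c ^+ 2)%:E * energy_of m v h)%E.
Proof.
move=> mvh vE hE; have [mv mh] := mvh; rewrite /energy_of muleDr//; last first.
  apply: ge0_adde_def; rewrite inE.
    by apply: integral_ge0 => z _; rewrite lee_fin sqnorm_ge0.
  rewrite hat_integralE; apply: integral_ge0 => x _.
  by rewrite lee_fin hat_int_ge0// => g g'; rewrite mulr_ge0// sqr_ge0.
rewrite !hat_integralE -!ge0_integralZl//.
- congr (_ + _)%E.
    apply: eq_integral => z _; rewrite -EFinM vE /sqnorm mulr_sumr; congr EFin.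
    by apply: eq_bigr => i _; rewrite mxE exprMn.
  apply: eq_integral => x _; rewrite -EFinM; congr EFin; apply: hat_intZ => g g'.
  by rewrite hE exprMn mulrA.
- apply/measurable_EFinP; apply: measurable_hat_int => // g g'.
  by apply: measurable_funM => //; exact: measurable_funX.
- move=> x _; rewrite lee_fin hat_int_ge0// => g g'.
  by rewrite mulr_ge0// sqr_ge0.
- by rewrite lee_fin sqr_ge0.
- by apply/measurable_EFinP; exact: measurable_sqnorm_field mvh.
- by move=> z _; rewrite lee_fin sqnorm_ge0.
- by rewrite lee_fin sqr_ge0.
Qed.

Lemma young (e a b : R) : 0 < e -> `|a * b| <= 2^-1 * (e * a ^+ 2 + e^-1 * b ^+ 2).
Proof.
move=> e0; rewrite normrM -(real_normK (num_real a)) -(real_normK (num_real b)).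
rewrite -subr_ge0 (_ : _ - _ = (2 * e)^-1 * (e * `|a| - `|b|) ^+ 2).
  by rewrite mulr_ge0 ?sqr_ge0// invr_ge0 mulr_ge0// ltW.
by field; rewrite gt_eqF.
Qed.

Lemma normr_sqr_le (a M : R) : `|a| <= M -> a ^+ 2 <= M ^+ 2.
Proof.
move=> aM; rewrite -(real_normK (num_real a)) lerXn2r// nnegrE//.
exact: le_trans aM.
Qed.

(** If one of the energies is infinite, so are both sides, because [k] and [c] are positive;
    otherwise this is a ring identity. *)
Lemma adde_young (k a b c : R) (E1 E2 : \bar R) :
  0 < k -> 0 < c -> (0 <= E1)%E -> (0 <= E2)%E ->
  (k%:E * (a%:E + c%:E * E1) + k%:E * (b%:E + c%:E * E2) =
   k%:E * ((a + b)%:E + c%:E * (E1 + E2)))%E.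
Proof.
move=> k0 c0; have cy : (c%:E * +oo = +oo)%E by rewrite gt0_muley.
have ky : (k%:E * +oo = +oo)%E by rewrite gt0_muley.
by case: E1 => [r1| |]//; case: E2 => [r2| |]// _ _;
  rewrite ?(cy, ky, addye, addey)//= -!EFinM -!EFinD -?EFinM; congr EFin; ring.
Qed.

(* Young's inequality with a free parameter [e] replaces Cauchy-Schwarz. *)
Lemma rate_le_energy m v h zeta (M B : R) (C : set Rd) : test_function zeta ->
  measurable_fields v h -> bounded_test zeta M C ->
  (hat_integral theta m C (fun _ g g' => K g g') <= B%:E)%E ->
  forall e : R, 0 < e ->
  (`|rate_of m v h zeta| <= (2^-1)%:E *
    ((e * (M ^+ 2 * (d%:R + 4 * B)))%:E + (e^-1)%:E * energy_of m v h))%E.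
Proof.
move=> tz mvh [M0 cC zM dzM] BC e e0; have [mv mh] := mvh.
have mC := measurable_compact cC.
pose Q := hat_int theta m (fun x g g' => h x g g' ^+ 2 * K g g').
pose P := hat_int theta m (fun _ g g' => K g g').
have mQ : measurable_fun setT Q.
  apply: measurable_hat_int => // g g'.
  by apply: measurable_funM => //; exact: measurable_funX.
have mP : measurable_fun setT P by exact: measurable_hat_int.
have Q0 x : 0 <= Q x.
  by apply: hat_int_ge0 => // g g'; rewrite mulr_ge0// sqr_ge0.
have P0 x : 0 <= P x by exact: hat_int_ge0.
have msq := measurable_sqnorm_field mvh.
have e0' := ltW e0; have h0 : 0 <= (2^-1 : R) by [].
have D1 z : `|drift_of zeta v z| <=
    2^-1 * (e * (d%:R * M ^+ 2) + e^-1 * sqnorm (v z.1 z.2)).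
  rewrite /drift_of /dot; apply: le_trans (ler_norm_sum _ _ _) _.
  rewrite (_ : d%:R * M ^+ 2 = \sum_(i < d) M ^+ 2); last first.
    by rewrite sumr_const card_ord mulr_natl.
  rewrite /sqnorm !mulr_sumr -big_split/= mulr_sumr.
  apply: ler_sum => i _; apply: le_trans (young _ _ e0) _.
  rewrite ler_wpM2l// lerD2r ler_wpM2l// mxE normr_sqr_le//.
  by have [] := dzM i z.1 z.2.
(* The constant 4 comes from squaring the bound [M + M] on a difference of two values of [zeta]; off
   [C] this difference is 0, whence the indicator. *)
have D2 x : `|hat_int theta m (reaction_of zeta h) x| <=
    2^-1 * (e * (4 * M ^+ 2) * (P x * \1_C x) + e^-1 * Q x).
  apply: le_trans (ler_norm_sum _ _ _) _.
  rewrite /P /Q /hat_int !mulr_suml !mulr_sumr -big_split/= mulr_sumr.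
  apply: ler_sum => g _; apply: le_trans (ler_norm_sum _ _ _) _.
  rewrite !mulr_suml !mulr_sumr -big_split/= mulr_sumr.
  apply: ler_sum => g' _; rewrite /reaction_of 2!normrM.
  rewrite (ger0_norm (K_ge0 _ _)) (ger0_norm (hat_density_ge0 theta_ge0 _ _ _ _)).
  have KH0 : 0 <= K g g' * hat_density theta m x g g'.
    by rewrite mulr_ge0// hat_density_ge0.
  apply: (@le_trans _ _ (2^-1 * (e * (4 * M ^+ 2 * \1_C x) + e^-1 * h x g g' ^+ 2)
      * (K g g' * hat_density theta m x g g'))); last by rewrite le_eqVlt; apply/orP; left; apply/eqP; ring.
  rewrite -mulrA ler_wpM2r// (le_trans (young _ _ e0))//.
  rewrite ler_wpM2l// lerD2r ler_wpM2l//.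
  rewrite indicE; have [Cx|Cx] := boolP (x \in C).
    rewrite mulr1 (_ : 4 * M ^+ 2 = (M + M) ^+ 2); last by ring.
    rewrite normr_sqr_le//; apply: le_trans (ler_normB _ _) _.
    by apply: lerD; [have [] := zM x g'|have [] := zM x g].
  have nCx : ~ C x by move=> Cx'; rewrite mem_set in Cx.
  by rewrite /grad_g (zM x g').2// (zM x g).2// subrr expr0n mulr0.
have I1 : (\int[m]_z `|(drift_of zeta v z)%:E| <= (2^-1)%:E *
    ((e * (d%:R * M ^+ 2))%:E +
     (e^-1)%:E * \int[m]_z (sqnorm (v z.1 z.2))%:E))%E.
  apply: (@le_trans _ _ (\int[m]_z ((2^-1)%:E * ((e * (d%:R * M ^+ 2))%:E +
     (e^-1)%:E * (sqnorm (v z.1 z.2))%:E)))%E).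
    apply: ge0_le_integral_lower => // z _; have := D1 z.
    by rewrite -lee_fin.
  rewrite ge0_integralZl//; last 2 first.
  - by apply/measurable_EFinP; apply: measurable_funD => //; exact: measurable_funM.
  - by move=> z _; rewrite -EFinM -EFinD lee_fin addr_ge0// !mulr_ge0 ?sqnorm_ge0
      ?sqr_ge0 ?invr_ge0.
  rewrite ge0_integralD//.
  - rewrite ge0_integralZl//; [|exact/measurable_EFinP| |]; last 2 first.
    + by move=> z _; rewrite lee_fin sqnorm_ge0.
    + by rewrite lee_fin invr_ge0.
    by rewrite integral_cst_prob.
  - by move=> z _; rewrite lee_fin !mulr_ge0 ?sqr_ge0.
  - by move=> z _; rewrite mule_ge0// lee_fin ?invr_ge0// sqnorm_ge0.
  - by apply/measurable_EFinP; exact: measurable_funM.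
have I2 : (\int[hat_measure theta m]_x
      `|(hat_int theta m (reaction_of zeta h) x)%:E| <= (2^-1)%:E *
    ((e * (4 * M ^+ 2) * B)%:E + (e^-1)%:E * \int[hat_measure theta m]_x (Q x)%:E))%E.
  have m1C : measurable_fun setT (fun x => P x * \1_C x).
    by apply: measurable_funM => //; exact: measurable_indic.
  apply: (@le_trans _ _ (\int[hat_measure theta m]_x ((2^-1)%:E *
     ((e * (4 * M ^+ 2))%:E * (P x * \1_C x)%:E + (e^-1)%:E * (Q x)%:E)))%E).
    apply: ge0_le_integral_lower => // x _; have := D2 x.
    by rewrite -lee_fin.
  rewrite ge0_integralZl//; last 2 first.
  - apply/measurable_EFinP; apply: measurable_funD; exact: measurable_funM.
  - by move=> x _; rewrite -!EFinM -EFinD lee_fin addr_ge0// !mulr_ge0 ?sqr_ge0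
      ?invr_ge0.
  rewrite lee_wpmul2l//.
  rewrite ge0_integralD//; last 4 first.
  - by move=> x _; rewrite -EFinM lee_fin !mulr_ge0 ?sqr_ge0.
  - by apply/measurable_EFinP; exact: measurable_funM.
  - by move=> x _; rewrite -EFinM lee_fin mulr_ge0 ?invr_ge0.
  - by apply/measurable_EFinP; exact: measurable_funM.
  rewrite ge0_integralZl//; last 3 first.
  - exact/measurable_EFinP.
  - by move=> x _; rewrite lee_fin mulr_ge0.
  - by rewrite lee_fin !mulr_ge0 ?sqr_ge0.
  rewrite ge0_integralZl//; last 3 first.
  - exact/measurable_EFinP.
  - by move=> x _; rewrite lee_fin.
  - by rewrite lee_fin invr_ge0.
  apply: leeD2r; rewrite [leRHS]EFinM.
  apply: lee_wpmul2l; first by rewrite lee_fin !mulr_ge0 ?sqr_ge0.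
  move: BC; rewrite hat_integralE; apply: le_trans.
  rewrite [leRHS]integral_mkcond le_eqVlt; apply/orP; left; apply/eqP.
  apply: eq_integral => x _; rewrite patchE indicE.
  by case: (x \in C); rewrite ?mulr1 ?mulr0.
rewrite /rate_of /energy_of; apply: le_trans (lee_abs_add _ _) _.
rewrite (_ : e * (M ^+ 2 * (d%:R + 4 * B)) =
  e * (d%:R * M ^+ 2) + e * (4 * M ^+ 2) * B); last by ring.
rewrite -adde_young ?invr_gt0//; last 2 first.
- by apply: integral_ge0 => z _; rewrite lee_fin sqnorm_ge0.
- by rewrite hat_integralE; apply: integral_ge0 => x _; rewrite lee_fin; exact: Q0.
rewrite hat_integralE -/Q.
apply: leeD.
  apply: le_trans I1; apply: le_abse_integral => //.
  by apply/measurable_EFinP; exact: measurable_drift mvh.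
rewrite hat_integralE; apply: le_trans I2; apply: le_abse_integral => //.
apply/measurable_EFinP; apply: measurable_hat_int => // g g'.
exact: measurable_reaction mvh.
Qed.

End fields.

Section probes.
Context {R : realType} {d : nat} {G : pfinType}.
Local Notation Rd := 'rV[R]_d.
Local Notation X := ('rV[R]_d * discr G)%type.

Lemma is_derive_coord (i k : 'I_d) (x : Rd) :
  is_derive x (delta_mx 0 k : Rd) (fun y : Rd => y 0 i) ((i == k)%:R : R).
Proof.
have H : h^-1 *: ((h *: (delta_mx 0 k : Rd) + x) 0 i - x 0 i) @[h --> (0 : R)^'] -->
    ((i == k)%:R : R).
  apply: cvg_near_cst; near=> h.
  have h0 : h != 0 by near: h; exact: nbhs_dnbhs_neq.
  by rewrite !mxE eqxx addrK /GRing.scale /= mulrA mulVf// mul1r.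
apply: DeriveDef; first by apply/cvg_ex; eexists; exact: H.
by apply/cvg_lim => //; exact: H.
Unshelve. all: by end_near. Qed.

Lemma normr_coord_le (x : Rd) i : `|x 0 i| <= `|x|.
Proof.
rewrite [leRHS]/Num.norm /= mx_normrE.
by apply/bigmax_geP; right => /=; exists (ord0, i).
Qed.

Lemma compact_coord_bounded (C : set Rd) : compact C ->
  exists n : nat, forall x i, C x -> `|x 0 i| <= n%:R.
Proof.
move=> /compact_bounded[M [Mr MP]].
exists (Num.truncn (`|M| + 1)).+1 => x i Cx.
apply: le_trans (normr_coord_le _ _) _.
apply: (@le_trans _ _ (`|M| + 1)); last by rewrite ltW// truncnS_gt.
by apply: MP => //; rewrite (le_lt_trans (ler_norm _))// ltrDl.
Qed.

(* A smooth cutoff which is bounded below on the cube of radius [n.+1], possibly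
   multiplied by a coordinate, and placed on one node: integrating these
   countably many test functions detects local integrability of the fields. *)
Definition cutoff (n : nat) (x : R) : R := bump (- n.+2%:R) n.+2%:R 1 x.

Definition probe (n : nat) (o : option 'I_d) (a : G) (x : Rd) (g : G) : R :=
  if g == a then
    prodf (fun j => if o == Some j then id * cutoff n else cutoff n) x
  else 0.

Definition plateau n : Rd -> R := prodf (fun=> cutoff n).

Lemma test_probe n o a : test_function (probe n o a).
Proof.
apply: (@test_prodf _ _ _ _ (fun g => g == a) (- n.+2%:R) n.+2%:R).
  move=> j m; case: ifP => _; last exact: Cn_bump.
  by apply: CnM; [exact: Cn_id|exact: Cn_bump].
move=> j y; case: ifP => _; last exact: bump_neq0.
by rewrite mulf_eq0 negb_or => /andP[_]; exact: bump_neq0.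
Qed.

Lemma plateau_ge0 n x : 0 <= plateau n x.
Proof. by apply: prodr_ge0 => j _; exact: bump_ge0. Qed.

(** The cutoff ends at radius [n.+2], so on the cube of radius [n.+1] both arguments of [flat 1] are
    at least 1 and each of the [d] factors is at least the square of [expR (-1)]. *)
Lemma plateau_gt0 n : exists2 c : R, 0 < c &
  forall x : Rd, (forall j, `|x 0 j| <= n.+1%:R) -> c <= plateau n x.
Proof.
exists ((expR (-1) * expR (-1)) ^+ d); first by rewrite exprn_gt0// mulr_gt0 ?expR_gt0.
have f1 y : 1 <= y -> expR (-1) <= flat 1 y :> R.
  move=> y1; have y0 : 0 < y by apply: lt_le_trans y1.
  by rewrite /flat y0 hornerE mul1r ler_expR lerN2 invf_le1.
move=> x xn; rewrite /plateau /prodf -{1}(card_ord d) -prodr_const.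
apply: ler_prod => j _; rewrite mulr_ge0 ?expR_ge0//=.
have := xn j; rewrite ler_norml => /andP[h1 h2].
rewrite /cutoff /bump !mul1r.
have E : n.+2%:R = n.+1%:R + 1 :> R by rewrite -natr1.
by apply: ler_pM; rewrite ?expR_ge0// f1// E; lra.
Qed.

Lemma grad_probe n o a g x : grad (probe n o a ^~ g) x =
  if g == a then
    if o is Some i then x 0 i *: grad (plateau n) x + plateau n x *: delta_mx 0 i
    else grad (plateau n) x
  else 0.
Proof.
have [_ dpl] : is_Cn 1 (plateau n).
  by apply: is_Cn_prodf => j m; exact: Cn_bump.
rewrite /probe; case: eqP => [_|_]; last first.
  by apply/rowP => k; rewrite !mxE derive_cst.
case: o => [i|]; last by [].
rewrite (_ : prodf _ = (fun y : Rd => y 0 i) * plateau n); last first.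
  apply/funext => y; transitivity (y 0 i * plateau n y); last by [].
  rewrite /plateau /prodf (bigD1 i)//= eqxx [in RHS](bigD1 i)//= [RHS]mulrA.
  congr (_ * _); apply: eq_bigr => j ji.
  by case: eqP => // -[ij]; rewrite ij eqxx in ji.
apply/rowP => k; rewrite !mxE.
have [dc cE] := is_derive_coord i k x.
rewrite (deriveM dc ((dpl k).1 x)) cE.
by rewrite eqxx (eq_sym k).
Qed.

Variables (theta : mobility R d G) (K : G -> G -> R).
Hypothesis theta_ge0 : mobility_ge0 theta.
Hypothesis mtheta : mobility_measurable theta.
Hypothesis K_ge0 : forall g g', 0 <= K g g'.

Lemma drift_probe n o a (v : Rd -> G -> Rd) (x : Rd) (g : discr G) :
  drift_of (probe n o a) v (x, g) =
  if g == a then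
    if o is Some i then
      x 0 i * dot (grad (plateau n) x) (v x g) + plateau n x * v x g 0 i
    else dot (grad (plateau n) x) (v x g)
  else 0.
Proof.
rewrite /drift_of /= grad_probe; case: eqP => _; last first.
  by rewrite /dot big1// => i _; rewrite mxE mul0r.
case: o => [i|//]; rewrite /dot mulr_sumr.
rewrite (_ : plateau n x * v x g 0 i =
    \sum_k plateau n x * (delta_mx 0 i : Rd) 0 k * v x g 0 k); last first.
  rewrite (bigD1 i)//= big1 ?addr0; first by rewrite mxE !eqxx mulr1.
  by move=> k ki; rewrite mxE (negbTE ki) andbF mulr0 mul0r.
by rewrite -big_split; apply: eq_bigr => k _ /=; rewrite !mxE; ring.
Qed.

(** Only the probe placed on the source node [g] is kept: its difference along a jump leaving [g] is
    minus the plateau. *)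
Lemma reaction_probe n (h : Rd -> G -> G -> R) x g g' : g != g' ->
  plateau n x * `|h x g g'| * K g g' <=
  \sum_a `|reaction_of K (probe n None a) h x g g'|.
Proof.
move=> gg'; rewrite (bigD1 g)//= /reaction_of /grad_g /probe eqxx.
rewrite (eq_sym g') (negbTE gg') sub0r.
rewrite -[leLHS]addr0 lerD ?sumr_ge0// !normrM normrN.
by rewrite (ger0_norm (plateau_ge0 n x)) (ger0_norm (K_ge0 _ _)).
Qed.

(** A test function lives on a compact set, where some plateau is bounded below. There the
    components of [v] and the jumps [h] across distinct nodes are controlled by finitely many
    probes, and these dominate drift and reaction. *)
Lemma admissible_probes (m : probability X R) v h : measurable_fields v h ->
  (forall n o a,
    m.-integrable setT (EFin \o drift_of (probe n o a) v) /\
    (hat_integral theta m setT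
     (fun x g g' => `|reaction_of K (probe n o a) h x g g'|%R) < +oo)%E) ->
  admissible theta K m v h.
Proof.
move=> mvh probes zeta tz; have [mv mh] := mvh.
have [M [C [M0 cC zM dzM]]] := test_bound tz.
have [n nP] := compact_coord_bounded cC.
have [c c0 cP] := plateau_gt0 n.
have Cc x : C x -> c <= plateau n x.
  by move=> Cx; apply: cP => j; rewrite (le_trans (nP _ _ Cx))// ler_nat.
have mdr o a := measurable_drift (test_probe n o a) mvh.
split.
  pose B z := \sum_(i < d) \sum_(a : G) (M * c^-1) *
    (`|drift_of (probe n (Some i) a) v z| +
     n%:R * `|drift_of (probe n None a) v z|).
  apply: (@le_integrable _ _ _ _ _ measurableT _ (EFin \o B)) => //.
  - by apply/measurable_EFinP; exact: measurable_drift mvh.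
  - move=> [x g] _; rewrite /= lee_fin; apply: le_trans (ler_norm _).
    rewrite /drift_of /dot /=; apply: le_trans (ler_norm_sum _ _ _) _.
    apply: ler_sum => i _.
    have [Cx|nCx] := pselect (C x); last first.
      rewrite mxE (dzM i x g).2// mul0r normr0.
      by apply: sumr_ge0 => a _; rewrite !mulr_ge0 ?addr_ge0 ?mulr_ge0 ?invr_ge0 ?(ltW c0).
    rewrite (bigD1 (g : G))//= -[leLHS]addr0 lerD//; last first.
      by apply: sumr_ge0 => a _; rewrite !mulr_ge0 ?addr_ge0 ?mulr_ge0 ?invr_ge0 ?(ltW c0).
    rewrite normrM -mulrA ler_pM//.
      by rewrite mxE; have [] := dzM i x g.
    rewrite ler_pdivlMl// !drift_probe eqxx.
    apply: (@le_trans _ _ `|plateau n x * v x g 0 i|).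
      by rewrite normrM ler_wpM2r// (le_trans (Cc _ Cx))// ler_norm.
    (* Subtracting [x 0 i] times the plain probe from the probe with coordinate [i] isolates the
       component [v x g 0 i], times the plateau. *)
    set D := dot _ _; set E := plateau n x * _.
    rewrite [X in `|X| <= _](_ : E = (x 0 i * D + E) - x 0 i * D); last by ring.
    apply: le_trans (ler_normB _ _) _; rewrite lerD2l normrM ler_wpM2r//.
    exact: nP.
  - rewrite (_ : EFin \o B = (fun z => \sum_(i < d) \sum_(a : G) ((M * c^-1)%:E *
      (`|(drift_of (probe n (Some i) a) v z)%:E| +
       n%:R%:E * `|(drift_of (probe n None a) v z)%:E|)))%E); last first.
      apply/funext => z; rewrite /= /B -sumEFin; apply: eq_bigr => i _.
      by rewrite -sumEFin; apply: eq_bigr.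
    apply: integrable_sum => // i _; apply: integrable_sum => // a _.
    apply: integrableZl => //; apply: integrableD => //.
      by apply: integrable_abse; exact: (probes n (Some i) a).1.
    by apply: integrableZl => //; apply: integrable_abse; exact: (probes n None a).1.
pose B x := \sum_(a : G) hat_int theta m
  (fun x g g' => `|reaction_of K (probe n None a) h x g g'|) x.
have mB a : measurable_fun setT (hat_int theta m
    (fun x g g' => `|reaction_of K (probe n None a) h x g g'|)).
  apply: measurable_hat_int => // g g'; apply: measurableT_comp => //.
  exact: measurable_reaction (test_probe n None a) mvh.
have B0 a x : 0 <= hat_int theta m
    (fun x g g' => `|reaction_of K (probe n None a) h x g g'|) x.
  exact: hat_int_ge0.
rewrite hat_integralE.
apply: (@le_lt_trans _ _ (\int[hat_measure theta m]_x (((M + M) * c^-1)%:E *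
    \sum_(a : G) (hat_int theta m
  (fun x g g' => `|reaction_of K (probe n None a) h x g g'|) x)%:E))%E).
  apply: ge0_le_integral_lower => x _.
    by rewrite lee_fin hat_int_ge0.
  rewrite sumEFin -EFinM lee_fin mulr_sumr.
  under [leRHS]eq_bigr do rewrite /hat_int mulr_sumr.
  rewrite exchange_big/=; apply: ler_sum => g _.
  under [leRHS]eq_bigr do rewrite mulr_sumr.
  rewrite exchange_big/=; apply: ler_sum => g' _.
  under [leRHS]eq_bigr do rewrite mulrA.
  rewrite -mulr_suml ler_wpM2r// ?hat_density_ge0// -mulr_sumr.
  have [->|gg'] := eqVneq g g'.
    rewrite /reaction_of /grad_g subrr !mul0r normr0.
    by rewrite mulr_ge0 ?sumr_ge0// mulr_ge0 ?addr_ge0 ?invr_ge0 ?(ltW c0).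
  have [Cx|nCx] := pselect (C x); last first.
    rewrite /reaction_of /grad_g (zM x g).2// (zM x g').2// subrr !mul0r normr0.
    by rewrite mulr_ge0 ?sumr_ge0// mulr_ge0 ?addr_ge0 ?invr_ge0 ?(ltW c0).
  apply: le_trans (ler_wpM2l _ (@reaction_probe n h x g g' gg')); last first.
    by rewrite mulr_ge0 ?addr_ge0 ?invr_ge0 ?(ltW c0).
  rewrite /reaction_of 2!normrM (ger0_norm (K_ge0 _ _)) mulrA ler_wpM2r//.
  rewrite -mulrA ler_pM//.
    apply: le_trans (ler_normB _ _) _.
    by apply: lerD; [have [] := zM x g'|have [] := zM x g].
  by rewrite ler_pdivlMl// ler_wpM2r// Cc.
rewrite ge0_integralZl//; last 3 first.
- by apply: emeasurable_sum => a; exact/measurable_EFinP.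
- by move=> x _; apply: sume_ge0 => a _; rewrite lee_fin.
- by rewrite lee_fin mulr_ge0 ?addr_ge0 ?invr_ge0 ?(ltW c0).
apply: lte_mul_pinfty => //.
  by rewrite lee_fin mulr_ge0 ?addr_ge0 ?invr_ge0 ?(ltW c0).
rewrite ge0_integral_sum//; [|by move=> a; exact/measurable_EFinP|
  by move=> a x _; rewrite lee_fin].
apply: lte_sum_pinfty => a _; rewrite -hat_integralE.
exact: (probes n None a).2.
Qed.

End probes.

Lemma integrable_sub01 (R : realType) (f : R -> \bar R) (D : set R) :
  (@lebesgue_measure R).-integrable `[0, 1] f ->
  measurable D -> D `<=` `[0, 1] -> (@lebesgue_measure R).-integrable D f.
Proof.
move=> fi mD sD.
apply: (@integrableS _ (measurableTypeR R) R _ `[0, 1]%classic D f) => //.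
Qed.

(** * Regularization and time reversal of curves *)

Section curves.
Context {R : realType} {d : nat} {G : pfinType}.
Local Notation Rd := 'rV[R]_d.
Local Notation X := ('rV[R]_d * discr G)%type.
Local Notation leb := (@lebesgue_measure R).
Variables (theta : mobility R d G) (K : G -> G -> R).
Hypothesis theta_ge0 : mobility_ge0 theta.
Hypothesis mtheta : mobility_measurable theta.
Hypothesis K_ge0 : forall g g', 0 <= K g g'.
Implicit Types (mu : R -> probability X R) (v : R -> Rd -> G -> Rd)
  (h : R -> Rd -> G -> G -> R) (phi psi : R -> Rd -> G -> R).

Lemma grad_scale (f : Rd -> R) x (c : R) : differentiable f x ->
  grad (fun y => c * f y) x = c *: grad f x.
Proof.
move=> df; apply/rowP => i; rewrite !mxE.
by rewrite (@deriveZ _ _ _ f c x (delta_mx 0 i))//; exact: diff_derivable.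
Qed.

Lemma grad_g_scale (f : Rd -> G -> R) x g g' (c : R) :
  grad_g (fun x g => c * f x g) x g g' = c * grad_g f x g g'.
Proof. by rewrite /grad_g mulrBr. Qed.

Lemma rate_of0 (m : probability X R) (v : Rd -> G -> Rd) (h : Rd -> G -> G -> R) zeta :
  (forall x g, v x g = 0) -> (forall x g g', h x g g' = 0) ->
  rate_of theta K m v h zeta = 0%E.
Proof.
move=> v0 h0; rewrite /rate_of integral0_eq.
  rewrite add0e hat_integralE integral0_eq// => x _; congr EFin.
  by rewrite /hat_int big1// => g _; rewrite big1// => g' _;
    rewrite /reaction_of h0 mulr0 !mul0r.
move=> z _; congr EFin; rewrite /drift_of /dot big1// => i _.
by rewrite v0 [X in _ * X]mxE mulr0.
Qed.

Lemma admissible0 (m : probability X R) (v : Rd -> G -> Rd) (h : Rd -> G -> G -> R) :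
  (forall x g, v x g = 0) -> (forall x g g', h x g g' = 0) ->
  admissible theta K m v h.
Proof.
move=> v0 h0 zeta tz; split.
  rewrite (_ : EFin \o _ = cst 0%E); first exact: integrable0.
  apply/funext => z; congr EFin; rewrite /drift_of /dot big1// => i _.
  by rewrite v0 [X in _ * X]mxE mulr0.
rewrite hat_integralE integral0_eq// => x _; congr EFin.
by rewrite /hat_int big1// => g _; rewrite big1// => g' _;
  rewrite /reaction_of h0 mulr0 !mul0r normr0 mul0r.
Qed.

Lemma energy_of0 (m : probability X R) (v : Rd -> G -> Rd) (h : Rd -> G -> G -> R) :
  (forall x g, v x g = 0) -> (forall x g g', h x g g' = 0) ->
  energy_of theta K m v h = 0%E.
Proof.
move=> v0 h0; rewrite /energy_of integral0_eq.
  rewrite add0e hat_integralE integral0_eq// => x _; congr EFin.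
  by rewrite /hat_int big1// => g _; rewrite big1// => g' _;
    rewrite h0 expr0n !mul0r.
move=> z _; congr EFin; rewrite /sqnorm big1// => i _.
by rewrite v0 mxE expr0n.
Qed.

Lemma test_integrable (m : probability X R) (zeta : Rd -> G -> R) :
  test_function zeta -> m.-integrable setT (fun z => (zeta z.1 z.2)%:E).
Proof.
move=> tz; have [M [C [M0 cC zM dzM]]] := test_bound tz.
apply: (@le_integrable _ _ _ _ _ measurableT _ (cst M%:E)) => //.
- by apply/measurable_EFinP; exact: measurable_test.
- move=> z _; rewrite /= lee_fin (le_trans _ (ler_norm _))//.
  by have [] := zM z.1 z.2.
- exact: finite_measure_integrable_cst.
Qed.

Lemma curve_fields mu v h t : continuity_equation theta K mu v h ->
  0 <= t <= 1 -> measurable_fields (v t) (h t).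
Proof.
move=> [_ mv mh _] t01.
have mD : measurable (`[0, 1] `*` setT : set (R * Rd)).
  by apply: measurableX => //; exact: measurable_itv.
have mp : measurable_fun setT (fun x : Rd => (t, x) : R * Rd).
  by apply: measurable_fun_pair => //; exact: measurable_cst.
have sD : (fun x : Rd => (t, x) : R * Rd) @` setT `<=` `[0, 1] `*` setT.
  by move=> _ [x _ <-]; split=> //=; rewrite in_itv.
by split=> [g i|g g'];
  [exact: (measurable_comp mD sD (mv g i) mp)|
   exact: (measurable_comp mD sD (mh g g') mp)].
Qed.

(** Each probe has its own negligible set of bad times; there are countably many probes, so one null
    set covers them all, and off it the probes control every test function. *)
Lemma exceptional_times mu v h : continuity_equation theta K mu v h ->
  exists N : set R, [/\ measurable N, leb N = 0%E &
    forall t, 0 <= t <= 1 -> ~ N t -> admissible theta K (mu t) (v t) (h t)].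
Proof.
move=> ce; have [_ _ _ H] := ce.
pose bad (k : nat * option 'I_d * G) : set R := [set t | 0 <= t <= 1 /\
  ~ ((mu t).-integrable setT (EFin \o drift_of (probe k.1.1 k.1.2 k.2) (v t)) /\
     (hat_integral theta (mu t) setT (fun x g g' =>
       `|reaction_of K (probe k.1.1 k.1.2 k.2) (h t) x g g'|%R) < +oo)%E)].
have nbad k : leb.-negligible (bad k).
  have [ae _ _] := H _ (test_probe k.1.1 k.1.2 k.2).
  by apply: negligibleS ae => t [t01 nt] /(_ t01).
have [N [mN N0 NP]] : leb.-negligible (\bigcup_n
    (if unpickle n is Some k then bad k else set0)).
  apply: negligible_bigcup => n; case: unpickle => [k|]; first exact: nbad.
  exact: negligible_set0.
exists N; split=> // t t01 nNt; apply: (admissible_probes theta_ge0 mtheta K_ge0).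
  exact: curve_fields ce t01.
move=> n o a; apply: contra_notP nNt => nt; apply: NP.
by exists (pickle (n, o, a)) => //; rewrite pickleK.
Qed.

(** Admissibility at every time of the unit interval, not only almost everywhere, is what lets rates
    be rescaled pointwise under a change of time. *)
Definition regular_curve mu phi psi := grad_curve theta K mu phi psi /\
  forall t, 0 <= t <= 1 ->
    admissible theta K (mu t) (fun x g => grad (phi t ^~ g) x) (grad_g (psi t)).

Definition curve_rate mu phi psi zeta t : \bar R :=
  rate_of theta K (mu t) (fun x g => grad (phi t ^~ g) x) (grad_g (psi t)) zeta.

Definition curve_energy mu phi psi t : \bar R :=
  energy_of theta K (mu t) (fun x g => grad (phi t ^~ g) x) (grad_g (psi t)).

Lemma curve_energy_ge0 mu phi psi t : (0 <= curve_energy mu phi psi t)%E.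
Proof. exact: energy_of_ge0. Qed.

Lemma actionE mu phi psi : action theta K mu phi psi =
  (\int[leb]_(t in `[0%R, 1%R]) curve_energy mu phi psi t)%E.
Proof. by []. Qed.

Lemma regular_curveP mu phi psi :
  (forall t, 0 <= t <= 1 -> P2 (mu t)) ->
  (forall t, 0 <= t <= 1 -> forall g x, differentiable (phi t ^~ g) x) ->
  (forall g i, measurable_fun (`[0, 1] `*` setT : set (R * Rd))
     (fun p => grad (phi p.1 ^~ g) p.2 0 i)) ->
  (forall g g', measurable_fun (`[0, 1] `*` setT : set (R * Rd))
     (fun p => grad_g (psi p.1) p.2 g g')) ->
  (forall t, 0 <= t <= 1 ->
    admissible theta K (mu t) (fun x g => grad (phi t ^~ g) x) (grad_g (psi t))) ->
  (forall zeta : Rd -> G -> R, test_function zeta ->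
    leb.-integrable `[0, 1] (curve_rate mu phi psi zeta) /\
    forall t, 0 <= t <= 1 -> (\int[mu t]_z (zeta z.1 z.2)%:E =
      \int[mu 0%R]_z (zeta z.1 z.2)%:E +
      \int[leb]_(s in `[0%R, t]) curve_rate mu phi psi zeta s)%E) ->
  regular_curve mu phi psi.
Proof.
move=> mu2 dphi mv mh adm H; split=> //; split=> //; split=> // zeta tz.
by have [i0 E] := H _ tz; split=> //; apply: aeW => t t01; exact: adm.
Qed.

Lemma grad_curve_rate mu phi psi zeta : grad_curve theta K mu phi psi ->
  test_function zeta ->
  leb.-integrable `[0, 1] (curve_rate mu phi psi zeta) /\
  forall t, 0 <= t <= 1 -> (\int[mu t]_z (zeta z.1 z.2)%:E =
      \int[mu 0%R]_z (zeta z.1 z.2)%:E +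
      \int[leb]_(s in `[0%R, t]) curve_rate mu phi psi zeta s)%E.
Proof. by move=> [_ [_ _ _ H]] /H[_ ? ?]. Qed.

Lemma eq_integrable_in (D : set R) (f g : R -> \bar R) : measurable D ->
  (forall x, D x -> f x = g x) -> leb.-integrable D f -> leb.-integrable D g.
Proof.
move=> mD fg; apply: eq_integrable => // x; rewrite inE; exact: fg.
Qed.

(* The fields vanish on a null set of times outside of which every test function
   gives an integrable rate, so that rates become linear in the fields. *)
Lemma regularize mu phi psi : grad_curve theta K mu phi psi ->
  exists phi' psi', regular_curve mu phi' psi' /\
    (action theta K mu phi' psi' <= action theta K mu phi psi)%E.
Proof.
move=> gc; have [dphi ce] := gc; have [mu2 mv mh _] := ce.
have [N [mN N0 NP]] := exceptional_times ce.
(* The potentials, rather than the fields, are multiplied by this indicator, so that the new fields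
   are still gradients. *)
pose c (t : R) : R := \1_(~` N) t.
have mc : measurable_fun setT c by apply: measurable_indic; exact: measurableC.
have mD : measurable (`[0, 1] `*` setT : set (R * Rd)).
  by apply: measurableX => //; exact: measurable_itv.
have mcD : measurable_fun (`[0, 1] `*` setT : set (R * Rd)) (fun p => c p.1).
  by apply: measurable_funTS; exact: measurableT_comp.
have gE t : 0 <= t <= 1 -> forall x g, grad ((fun x => c t * phi t x g)) x =
    c t *: grad (phi t ^~ g) x.
  by move=> t01 x g; apply: grad_scale; exact: dphi.
have hE t x g g' := grad_g_scale (psi t) x g g' (c t).
have c1 t : ~ N t -> c t = 1 by move=> nNt; rewrite /c indicE mem_set.
have c0 t : N t -> c t = 0 by move=> Nt; rewrite /c indicE memNset// => /(_ Nt).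
exists (fun t x g => c t * phi t x g), (fun t x g => c t * psi t x g).
have adm t : 0 <= t <= 1 -> admissible theta K (mu t)
    (fun x g => grad (fun y => c t * phi t y g) x)
    (grad_g (fun x g => c t * psi t x g)).
  move=> t01; have [Nt|nNt] := pselect (N t).
    apply: admissible0 => [x g|x g g']; first by rewrite gE// c0// scale0r.
    by rewrite hE c0// mul0r.
  apply: (admissibleZ theta_ge0 mtheta (curve_fields ce t01) (NP t t01 nNt)).
    by move=> x g; exact: gE.
  by move=> x g g'; exact: hE.
have rE zeta t : test_function zeta -> 0 <= t <= 1 ->
    curve_rate mu (fun t x g => c t * phi t x g) (fun t x g => c t * psi t x g)
      zeta t = ((c t)%:E * curve_rate mu phi psi zeta t)%E.
  move=> tz t01; have [Nt|nNt] := pselect (N t).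
    rewrite c0// mul0e; apply: rate_of0 => [x g|x g g'].
      by rewrite gE// c0// scale0r.
    by rewrite hE c0// mul0r.
  apply: (rate_ofZ theta_ge0 mtheta tz (curve_fields ce t01) (NP t t01 nNt)).
    by move=> x g; exact: gE.
  by move=> x g g'; exact: hE.
split; last first.
  rewrite !actionE; apply: ge0_le_integral_lower => t; rewrite /= in_itv/= => t01.
    exact: energy_of_ge0.
  have [Nt|nNt] := pselect (N t).
    rewrite {1}/curve_energy energy_of0 ?curve_energy_ge0//.
      by move=> x g; rewrite gE// c0// scale0r.
    by move=> x g g'; rewrite hE c0// mul0r.
  rewrite {1}/curve_energy (energy_ofZ theta_ge0 mtheta K_ge0 _
    (curve_fields ce t01) (gE t t01) (hE t)).
  by rewrite c1// expr1n mul1e.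
apply: regular_curveP => //.
- move=> t t01 g x; have := dphi t t01 g x.
  exact: (@differentiableZ _ _ _ (phi t ^~ g) (c t)).
- move=> g i; apply: (eq_measurable_fun (fun p : R * Rd => c p.1 * grad (phi p.1 ^~ g) p.2 0 i)).
    move=> [t x]; rewrite inE /= => -[]; rewrite in_itv/= => t01 _.
    by rewrite (gE t t01 x g) [RHS]mxE.
  exact: measurable_funM.
- move=> g g'; apply: (eq_measurable_fun (fun p : R * Rd => c p.1 * grad_g (psi p.1) p.2 g g')).
    by move=> [t x] _; rewrite hE.
  exact: measurable_funM.
- move=> zeta tz; have [ri E] := grad_curve_rate gc tz.
  have ci : leb.-integrable `[0, 1]
     (fun t => (c t)%:E * curve_rate mu phi psi zeta t)%E.
    apply: (le_integrable _ _ _ ri) => //.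
      apply: emeasurable_funM; last by case/integrableP : ri.
      by apply/measurable_EFinP; exact: measurable_funTS.
    move=> t _; have [Nt|nNt] := pselect (N t); first by rewrite c0// mul0e abse0.
    by rewrite c1// mul1e.
  split.
    apply: eq_integrable_in ci => // t; rewrite /= in_itv/= => t01.
    by rewrite rE.
  move=> t t01.
  have st : (`[0, t]%classic : set R) `<=` `[0, 1].
    move=> s /=; rewrite !in_itv/= => /andP[-> st].
    by rewrite (le_trans st)//; case/andP : t01.
  suff II : (\int[leb]_(s in `[0%R, t]) curve_rate mu phi psi zeta s =
      \int[leb]_(s in `[0%R, t]) curve_rate mu (fun t x g => c t * phi t x g)%R
        (fun t x g => c t * psi t x g)%R zeta s)%E by rewrite (E t t01) II.
  apply: ae_eq_integral.
  + exact: measurable_itv.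
  + by apply: measurable_funS st _ => //; case/integrableP : ri.
  + apply: measurable_funS st _ => //.
    apply: (eq_measurable_fun (fun t => (c t)%:E * curve_rate mu phi psi zeta t)%E).
      by move=> s; rewrite inE /= in_itv/= => s01; rewrite rE.
    by case/integrableP : ci.
  + exists N; split=> // s /= /not_implyP[/st /=]; rewrite in_itv/= => s01 ne.
    by apply: contra_notP ne => nNs; rewrite rE// c1// mul1e.
Qed.

Lemma integral_itv_cat (a b c : R) (f : R -> \bar R) : a <= b -> b <= c ->
  leb.-integrable `[a, c] f ->
  (\int[leb]_(x in `[a, c]) f x =
   \int[leb]_(x in `[a, b]) f x + \int[leb]_(x in `[b, c]) f x)%E.
Proof.
move=> ab bc /integrableP[mf _].
have E : `[a, c]%classic = `[a, b] `|` `]b, c] :> set R.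
  by rewrite (@itv_bndbnd_setU _ _ _ (BRight b))// bnd_simp.
rewrite -[X in _ = _ + X]integral_itv_obnd_cbnd; last first.
  by apply: measurable_funS mf => //; apply: subset_itv; rewrite bnd_simp.
rewrite {1}E integral_setU//; first by rewrite -E.
apply/disj_setPS => x [] /=; rewrite !in_itv/= => /andP[_ xb] /andP[bx _].
by move: bx; rewrite ltNge xb.
Qed.

Lemma measurable_time_change (f : R -> Rd -> R) (a c : R) (D D' : set R) :
  measurable D -> measurable D' -> D' `<=` affine a c @^-1` D ->
  measurable_fun (D `*` setT : set (R * Rd)) (fun p => f p.1 p.2) ->
  measurable_fun (D' `*` setT : set (R * Rd)) (fun p => f (affine a c p.1) p.2).
Proof.
move=> mD mD' sD mf.
apply: (@measurable_comp _ _ _ _ _ _ (D `*` setT) (fun p : R * Rd => f p.1 p.2)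
  (D' `*` setT) (fun p : R * Rd => ((affine a c p.1 : R), p.2))) => //.
- by apply: measurableX.
- by move=> _ [[t x] [/= /sD Dt _] <-].
- apply: measurable_funTS; apply: measurable_fun_pair => //.
  apply: (measurableT_comp (measurable_affine a c)); exact: measurable_fst.
Qed.

Lemma affine_rev : affine 1 (-1) @^-1` `[0, 1] = `[0, 1]%classic :> set R.
Proof.
by apply/seteqP; split => t /=; rewrite !in_itv/= /affine => /andP[? ?];
  apply/andP; split; lra.
Qed.

(** Reflecting time changes the sign of the fields, hence of the rates, and leaves the energy
    unchanged. The reflection is an involution, so the one-sided change of variables for lower
    integrals gives the bound on the action. *)
Lemma reverse_curve mu phi psi : regular_curve mu phi psi ->
  exists mu' phi' psi', [/\ regular_curve mu' phi' psi', mu' 0 = mu 1,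
    mu' 1 = mu 0 &
    (action theta K mu' phi' psi' <= action theta K mu phi psi)%E].
Proof.
move=> [gc adm]; have [dphi ce] := gc; have [mu2 mv mh _] := ce.
have r01 (t : R) : 0 <= t <= 1 -> 0 <= affine 1 (-1) t <= 1.
  by rewrite /affine => /andP[? ?]; apply/andP; split; lra.
have r01' : (`[0, 1]%classic : set R) `<=` affine 1 (-1) @^-1` `[0, 1].
  by rewrite affine_rev.
have N1 : -1 != 0 :> R by rewrite oppr_eq0 oner_neq0.
pose mu' t := mu (affine 1 (-1) t).
pose phi' t x g := -1 * phi (affine 1 (-1) t) x g.
pose psi' t x g := -1 * psi (affine 1 (-1) t) x g.
have gE t : 0 <= t <= 1 -> forall x g, grad (phi' t ^~ g) x =
    -1 *: grad (phi (affine 1 (-1) t) ^~ g) x.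
  by move=> t01 x g; apply: grad_scale; apply: dphi; exact: r01.
have hE t x g g' := grad_g_scale (psi (affine 1 (-1) t)) x g g' (-1).
have rE zeta t : test_function zeta -> 0 <= t <= 1 ->
    curve_rate mu' phi' psi' zeta t =
    ((-1)%:E * curve_rate mu phi psi zeta (affine 1 (-1) t))%E.
  move=> tz /[dup] t01 /r01 t01'.
  exact: (rate_ofZ theta_ge0 mtheta tz (curve_fields ce t01') (adm _ t01')
    (gE t t01) (hE t)).
exists mu', phi', psi'; split.
- apply: regular_curveP.
  + by move=> t /r01 /mu2.
  + move=> t t01 g x; have := dphi _ (r01 t t01) g x.
    exact: (@differentiableZ _ _ _ (phi (affine 1 (-1) t) ^~ g) (-1)).
  + move=> g i; have m1 := measurable_time_change
      (f := fun t x => grad (phi t ^~ g) x 0 i) (measurable_itv _)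
      (measurable_itv _) r01' (mv g i).
    apply: (eq_measurable_fun (fun p : R * Rd => -1 * grad (phi (affine 1 (-1) p.1) ^~ g) p.2 0 i)).
      move=> [t x]; rewrite inE /= => -[]; rewrite in_itv/= => t01 _.
      by rewrite (gE t t01 x g) [RHS]mxE.
    exact: measurable_funM.
  + move=> g g'; have m1 := measurable_time_change
      (f := fun t x => grad_g (psi t) x g g') (measurable_itv _)
      (measurable_itv _) r01' (mh g g').
    apply: (eq_measurable_fun (fun p : R * Rd => -1 * grad_g (psi (affine 1 (-1) p.1)) p.2 g g')).
      by move=> [t x] _; rewrite hE.
    exact: measurable_funM.
  + move=> t /[dup] t01 /r01 t01'.
    exact: (admissibleZ theta_ge0 mtheta (curve_fields ce t01') (adm _ t01')
      (gE t t01) (hE t)).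
  + move=> zeta tz; have [ri E] := grad_curve_rate gc tz.
    have ri' := integrable_affine 1 N1 (measurable_itv _) ri.
    rewrite affine_rev in ri'.
    have ri2 : leb.-integrable `[0, 1] (curve_rate mu' phi' psi' zeta).
      apply: (eq_integrable_in _ _ (integrableZl _ (-1)%R ri')) => //.
      by move=> t; rewrite /= in_itv/= => t01; rewrite rE.
    split; first exact: ri2.
    move=> t t01; have t01' := r01 t t01.
    have [t0 t1] : 0 <= t /\ t <= 1 by case/andP : t01.
    have st (a b : itv_bound R) : (BLeft 0 <= a)%O -> (b <= BRight 1)%O ->
        [set` Interval a b] `<=` `[0, 1].
      by move=> a0 b1; apply: subset_itv.
    have rS (D : set R) : measurable D -> D `<=` `[0, 1] ->
        leb.-integrable D (curve_rate mu phi psi zeta).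
      exact: integrable_sub01 ri.
    have Iaff : (\int[leb]_(s in `[0%R, t]) curve_rate mu' phi' psi' zeta s =
        - \int[leb]_(s in `[(1 - t)%R, 1%R]) curve_rate mu phi psi zeta s)%E.
      have ri1 : leb.-integrable `[1 - t, 1] (curve_rate mu phi psi zeta).
        by apply: rS => //; apply: st; rewrite bnd_simp//; lra.
      rewrite (integral_affine 1 N1 (measurable_itv _) ri1).
      rewrite normrN normr1 mul1e.
      rewrite (_ : affine 1 (-1) @^-1` `[(1 - t)%R, 1%R] = `[0, t]%classic);
          last first.
        by apply/seteqP; split => s /=; rewrite !in_itv/= /affine => /andP[? ?];
          apply/andP; split; lra.
      rewrite -[RHS]mulN1e -integralZl//; last first.
        apply: integrableS ri' => //; apply: subset_itv; rewrite bnd_simp//.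
      apply: eq_integral => s; rewrite inE /= in_itv/= => /andP[s0 s1].
      by rewrite rE//; apply/andP; split; lra.
    rewrite Iaff /mu' (E _ t01') (E (affine 1 (-1) 0)); last first.
      by rewrite r01// lexx ler01.
    have -> : affine 1 (-1) 0 = 1 :> R by rewrite /affine mulr0 addr0.
    have -> : affine 1 (-1) t = 1 - t :> R by rewrite /affine mulN1r.
    set a0 := (\int[mu 0%R]_z _)%E.
    have a0f : a0 \is a fin_num by exact: integrable_fin_num (test_integrable _ tz).
    have t0' : 0 <= 1 - t by lra.
    have t1' : 1 - t <= 1 by lra.
    rewrite (integral_itv_cat t0' t1' ri) addeA addeK//.
    apply: integrable_fin_num => //; apply: rS => //; apply: st.
      by rewrite bnd_simp.
    by rewrite bnd_simp.
- by rewrite /mu' /affine mulr0 addr0.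
- by rewrite /mu' /affine mulr1 subrr.
- rewrite !actionE; apply: le_trans (ge0_integral_lower_affine 1 N1 _ _) _ => //.
    by move=> t _; exact: curve_energy_ge0.
  rewrite normrN normr1 mul1e affine_rev.
  apply: ge0_le_integral_lower => t; rewrite /= in_itv/= => t01.
    exact: curve_energy_ge0.
  have AA : affine 1 (-1) (affine 1 (-1) t) = t by rewrite /affine; ring.
  rewrite {1}/curve_energy (energy_ofZ theta_ge0 mtheta K_ge0 _
    (curve_fields ce (r01 _ (r01 _ t01))) (gE _ (r01 _ t01)) (hE _)).
  by rewrite sqrrN expr1n mul1e /mu' AA.
Qed.

End curves.

(** * Concatenation of two curves *)

Section gluing.
Context {R : realType} {d : nat} {G : pfinType}.
Local Notation Rd := 'rV[R]_d.
Local Notation X := ('rV[R]_d * discr G)%type.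
Local Notation leb := (@lebesgue_measure R).
Variables (theta : mobility R d G) (K : G -> G -> R).
Hypothesis theta_ge0 : mobility_ge0 theta.
Hypothesis mtheta : mobility_measurable theta.
Hypothesis K_ge0 : forall g g', 0 <= K g g'.
Implicit Types (mu : R -> probability X R) (phi psi : R -> Rd -> G -> R).

(** The effect, at one time, of running a curve at speed [c]. The potentials enter through
    equations, so that the lemma applies to slices of potentials defined by cases. *)
Lemma scaled_slice mu phi psi (s c : R) (p q : Rd -> G -> R) :
  regular_curve theta K mu phi psi -> 0 <= s <= 1 ->
  p = (fun x g => c * phi s x g) -> q = (fun x g => c * psi s x g) ->
  [/\ forall g x, differentiable (p ^~ g) x,
    forall g x, grad (p ^~ g) x = c *: grad (phi s ^~ g) x,
    admissible theta K (mu s) (fun x g => grad (p ^~ g) x) (grad_g q),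
    forall zeta, test_function zeta ->
      rate_of theta K (mu s) (fun x g => grad (p ^~ g) x) (grad_g q) zeta =
      (c%:E * curve_rate theta K mu phi psi zeta s)%E &
    energy_of theta K (mu s) (fun x g => grad (p ^~ g) x) (grad_g q) =
      ((c ^+ 2)%:E * curve_energy theta K mu phi psi s)%E].
Proof.
move=> [[dphi ce] adm] s01 pE qE.
have gE x g : grad (p ^~ g) x = c *: grad (phi s ^~ g) x.
  by rewrite pE; apply: grad_scale; exact: dphi.
have hE x g g' : grad_g q x g g' = c * grad_g (psi s) x g g'.
  by rewrite qE; exact: grad_g_scale.
have mf := curve_fields ce s01.
split=> [g x|g x|||].
- by rewrite pE; have := dphi s s01 g x;
    exact: (@differentiableZ _ _ _ (phi s ^~ g) c).
- exact: gE.
- exact: (admissibleZ theta_ge0 mtheta mf (adm s s01) gE hE).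
- move=> zeta tz; exact: (rate_ofZ theta_ge0 mtheta tz mf (adm s s01) gE hE).
- exact: (energy_ofZ theta_ge0 mtheta K_ge0 _ mf gE hE).
Qed.

Lemma ge0_subset_integral_lower (D E : set R) (f : R -> \bar R) :
  (forall x, E x -> (0 <= f x)%E) -> D `<=` E ->
  (\int[leb]_(x in D) f x <= \int[leb]_(x in E) f x)%E.
Proof.
move=> f0 DE; rewrite integral_mkcond [leRHS]integral_mkcond.
apply: ge0_le_integral_lower => x _; rewrite !patchE.
  by case: ifPn => // /set_mem /DE; exact: f0.
case: ifPn => [/set_mem/DE Ex|_]; first by rewrite mem_set.
by case: ifPn => // /set_mem; exact: f0.
Qed.

Lemma integral_affine_piece (a c : R) (D D' : set R) (r r' : R -> \bar R) :
  0 < c -> measurable D -> measurable D' -> affine a c @^-1` D' = D ->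
  leb.-integrable D' r' ->
  (forall s, D s -> r s = (c%:E * r' (affine a c s))%E) ->
  leb.-integrable D r /\
  (\int[leb]_(s in D) r s = \int[leb]_(s in D') r' s)%E.
Proof.
move=> c0 mD mD' DE i' rE; have cN0 : c != 0 by rewrite gt_eqF.
have i1 := integrable_affine a cN0 mD' i'; rewrite DE in i1.
split.
  by apply: (eq_integrable_in _ _ (integrableZl _ c i1)) => // s Ds; rewrite rE.
rewrite (integral_affine a cN0 mD' i') DE gtr0_norm// -integralZl//.
by apply: eq_integral => s; rewrite inE; exact: rE.
Qed.

(** The first curve is run on [[0, l]] and the second on []l, 1]]. Speed 1/l multiplies the energy
    by its square while the duration is [l], hence the factor [l^-1]; likewise for the second. At
    the junction the laws need only agree on measurable sets, because the equation sees them through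
    integrals. *)
Lemma glue_curves (l : R) mu1 phi1 psi1 mu2 phi2 psi2 : 0 < l < 1 ->
  regular_curve theta K mu1 phi1 psi1 -> regular_curve theta K mu2 phi2 psi2 ->
  eq_law (mu1 1) (mu2 0) ->
  exists mu phi psi, [/\ regular_curve theta K mu phi psi, mu 0 = mu1 0,
    mu 1 = mu2 1 &
    (action theta K mu phi psi <= (l^-1)%:E * action theta K mu1 phi1 psi1 +
      ((1 - l)^-1)%:E * action theta K mu2 phi2 psi2)%E].
Proof.
move=> /andP[l0 l1] rc1 rc2 e12.
have [gc1 _] := rc1; have [_ [mu12 mv1 mh1 _]] := gc1.
have [gc2 _] := rc2; have [_ [mu22 mv2 mh2 _]] := gc2.
have k0 : 0 < 1 - l by rewrite subr_gt0.
have lN0 : l != 0 by rewrite gt_eqF.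
have kN0 : 1 - l != 0 by rewrite gt_eqF.
have liN0 : l^-1 != 0 by rewrite invr_eq0.
have kiN0 : (1 - l)^-1 != 0 by rewrite invr_eq0.
pose a1 := affine 0 l^-1; pose a2 := affine (- (l / (1 - l))) (1 - l)^-1.
have a1E t : a1 t = t / l :> R by rewrite /a1 /affine add0r mulrC.
have a2E t : a2 t = (t - l) / (1 - l) :> R by rewrite /a2 /affine; field.
have a101 t : 0 <= t -> t <= l -> 0 <= a1 t <= 1.
  move=> t0 tl; rewrite a1E divr_ge0 ?(ltW l0)//= ler_pdivrMr// mul1r//.
have a201 t : l < t -> t <= 1 -> 0 <= a2 t <= 1.
  move=> lt t1; rewrite a2E; apply/andP; split.
    by rewrite divr_ge0 ?(ltW k0)// subr_ge0 ltW.
  by rewrite ler_pdivrMr// mul1r lerB.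
pose mu t := if t <= l then mu1 (a1 t) else mu2 (a2 t).
pose phi t := if t <= l then fun x g => l^-1 * phi1 (a1 t) x g
  else fun x g => (1 - l)^-1 * phi2 (a2 t) x g.
pose psi t := if t <= l then fun x g => l^-1 * psi1 (a1 t) x g
  else fun x g => (1 - l)^-1 * psi2 (a2 t) x g.
have L t : t <= l -> [/\ mu t = mu1 (a1 t), phi t = (fun x g => l^-1 * phi1 (a1 t) x g) &
    psi t = (fun x g => l^-1 * psi1 (a1 t) x g)].
  by move=> tl; rewrite /mu /phi /psi tl.
have U t : l < t -> [/\ mu t = mu2 (a2 t),
    phi t = (fun x g => (1 - l)^-1 * phi2 (a2 t) x g) &
    psi t = (fun x g => (1 - l)^-1 * psi2 (a2 t) x g)].
  by move=> lt; rewrite /mu /phi /psi leNgt lt.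
have SL t : 0 <= t -> t <= l ->
  [/\ forall g x, differentiable (phi t ^~ g) x,
    forall g x, grad (phi t ^~ g) x = l^-1 *: grad (phi1 (a1 t) ^~ g) x,
    admissible theta K (mu t) (fun x g => grad (phi t ^~ g) x) (grad_g (psi t)),
    forall zeta, test_function zeta -> curve_rate theta K mu phi psi zeta t =
      ((l^-1)%:E * curve_rate theta K mu1 phi1 psi1 zeta (a1 t))%E &
    curve_energy theta K mu phi psi t =
      ((l^-1 ^+ 2)%:E * curve_energy theta K mu1 phi1 psi1 (a1 t))%E].
  move=> t0 tl; have [mE pE qE] := L _ tl.
  have := scaled_slice rc1 (a101 _ t0 tl) pE qE.
  by rewrite -mE.
have SU t : l < t -> t <= 1 ->
  [/\ forall g x, differentiable (phi t ^~ g) x,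
    forall g x, grad (phi t ^~ g) x = (1 - l)^-1 *: grad (phi2 (a2 t) ^~ g) x,
    admissible theta K (mu t) (fun x g => grad (phi t ^~ g) x) (grad_g (psi t)),
    forall zeta, test_function zeta -> curve_rate theta K mu phi psi zeta t =
      (((1 - l)^-1)%:E * curve_rate theta K mu2 phi2 psi2 zeta (a2 t))%E &
    curve_energy theta K mu phi psi t =
      (((1 - l)^-1 ^+ 2)%:E * curve_energy theta K mu2 phi2 psi2 (a2 t))%E].
  move=> lt t1; have [mE pE qE] := U _ lt.
  have := scaled_slice rc2 (a201 _ lt t1) pE qE.
  by rewrite -mE.
have I01 : (`[0, 1]%classic : set R) = `[0, l] `|` `]l, 1].
  by rewrite (@itv_bndbnd_setU _ _ _ (BRight l))// bnd_simp ltW.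
have IX : (`[0, 1] `*` setT : set (R * Rd)) =
    (`[0, l] `*` setT) `|` (`]l, 1] `*` setT).
  rewrite I01; apply/seteqP; split=> -[t x] /= => [[[?|?] _]|[[? _]|[? _]]];
    by [left|right|split=> //; left|split=> //; right].
have mIl : measurable (`[0, l] `*` setT : set (R * Rd)) by exact: measurableX.
have mIu : measurable (`]l, 1] `*` setT : set (R * Rd)) by exact: measurableX.
have s1 : (`[0, l]%classic : set R) `<=` affine 0 l^-1 @^-1` `[0, 1].
  by move=> t /=; rewrite !in_itv/= => /andP[t0 tl]; exact: a101.
have s2 : (`]l, 1]%classic : set R) `<=` affine (- (l / (1 - l))) (1 - l)^-1 @^-1` `[0, 1].
  by move=> t /=; rewrite !in_itv/= => /andP[lt t1]; exact: a201.
exists mu, phi, psi; split.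
- apply: regular_curveP.
  + move=> t /andP[t0 t1]; have [tl|lt] := leP t l.
      by have [-> _ _] := L _ tl; apply: mu12; exact: a101.
    by have [-> _ _] := U _ lt; apply: mu22; exact: a201.
  + move=> t /andP[t0 t1]; have [tl|lt] := leP t l.
      by have [] := SL _ t0 tl.
    by have [] := SU _ lt t1.
  + move=> g i; rewrite IX; apply/measurable_funU => //; split.
      apply: (eq_measurable_fun (fun p : R * Rd =>
          l^-1 * grad (phi1 (a1 p.1) ^~ g) p.2 0 i)).
        move=> [t x]; rewrite inE /= => -[]; rewrite in_itv/= => /andP[t0 tl] _.
        by have [_ -> _ _ _] := SL _ t0 tl; rewrite [RHS]mxE.
      apply: measurable_funM => //.
      exact: (measurable_time_change (f := fun t x => grad (phi1 t ^~ g) x 0 i)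
        (measurable_itv _) (measurable_itv _) s1 (mv1 g i)).
    apply: (eq_measurable_fun (fun p : R * Rd =>
        (1 - l)^-1 * grad (phi2 (a2 p.1) ^~ g) p.2 0 i)).
      move=> [t x]; rewrite inE /= => -[]; rewrite in_itv/= => /andP[lt t1] _.
      by have [_ -> _ _ _] := SU _ lt t1; rewrite [RHS]mxE.
    apply: measurable_funM => //.
    exact: (measurable_time_change (f := fun t x => grad (phi2 t ^~ g) x 0 i)
      (measurable_itv _) (measurable_itv _) s2 (mv2 g i)).
  + move=> g g'; rewrite IX; apply/measurable_funU => //; split.
      apply: (eq_measurable_fun (fun p : R * Rd =>
          l^-1 * grad_g (psi1 (a1 p.1)) p.2 g g')).
        move=> [t x]; rewrite inE /= => -[]; rewrite in_itv/= => /andP[t0 tl] _.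
        by have [_ _ ->] := L _ tl; rewrite grad_g_scale.
      apply: measurable_funM => //.
      exact: (measurable_time_change (f := fun t x => grad_g (psi1 t) x g g')
        (measurable_itv _) (measurable_itv _) s1 (mh1 g g')).
    apply: (eq_measurable_fun (fun p : R * Rd =>
        (1 - l)^-1 * grad_g (psi2 (a2 p.1)) p.2 g g')).
      move=> [t x]; rewrite inE /= => -[]; rewrite in_itv/= => /andP[lt t1] _.
      by have [_ _ ->] := U _ lt; rewrite grad_g_scale.
    apply: measurable_funM => //.
    exact: (measurable_time_change (f := fun t x => grad_g (psi2 t) x g g')
      (measurable_itv _) (measurable_itv _) s2 (mh2 g g')).
  + move=> t /andP[t0 t1]; have [tl|lt] := leP t l.
      by have [] := SL _ t0 tl.
    by have [] := SU _ lt t1.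
  + move=> zeta tz.
    have [ri1 E1] := grad_curve_rate gc1 tz; have [ri2 E2] := grad_curve_rate gc2 tz.
    set r := curve_rate theta K mu phi psi zeta.
    set r1 := curve_rate theta K mu1 phi1 psi1 zeta in ri1 E1 *.
    set r2 := curve_rate theta K mu2 phi2 psi2 zeta in ri2 E2 *.
    have rL t : 0 <= t -> t <= l -> r t = ((l^-1)%:E * r1 (a1 t))%E.
      by move=> t0 tl; have [_ _ _ H _] := SL _ t0 tl; exact: H.
    have rU t : l < t -> t <= 1 -> r t = (((1 - l)^-1)%:E * r2 (a2 t))%E.
      by move=> lt t1; have [_ _ _ H _] := SU _ lt t1; exact: H.
    clearbody r r1 r2.
    have li0 : 0 < l^-1 by rewrite invr_gt0.
    have ki0 : 0 < (1 - l)^-1 by rewrite invr_gt0.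
    have intL t : 0 <= t -> t <= l -> leb.-integrable `[0, t] r /\
        (\int[leb]_(s in `[0%R, t]) r s = \int[leb]_(s in `[0%R, a1 t]) r1 s)%E.
      move=> t0 tl; apply: (@integral_affine_piece 0 l^-1) => //.
      - apply/seteqP; split => s /=; rewrite !in_itv/= -/a1 !a1E;
          by rewrite pmulr_lge0 ?invr_gt0// ler_pM2r ?invr_gt0.
      - apply: (integrable_sub01 ri1) => //; apply: subset_itv; rewrite bnd_simp//.
        by have /andP[] := a101 _ t0 tl.
      - move=> s; rewrite /= in_itv/= => /andP[s0 st].
        by rewrite rL// (le_trans st).
    have intU t : l < t -> t <= 1 -> leb.-integrable `]l, t] r /\
        (\int[leb]_(s in `]l, t]) r s = \int[leb]_(s in `[0%R, a2 t]) r2 s)%E.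
      move=> lt t1; have /andP[_ a2t1] := a201 _ lt t1.
      (* The second piece excludes the junction time [l], so the change of variables ends on an
         interval open at 0; the missing endpoint has measure zero. *)
      have iU : leb.-integrable `]0, a2 t] r2.
        by apply: (integrable_sub01 ri2) => //; apply: subset_itv; rewrite bnd_simp.
      rewrite -integral_itv_obnd_cbnd; last by case/integrableP : iU.
      apply: (@integral_affine_piece (- (l / (1 - l))) (1 - l)^-1) => //.
      - apply/seteqP; split => s /=; rewrite !in_itv/= -/a2 !a2E;
          by rewrite pmulr_lgt0 ?invr_gt0// subr_gt0 ler_pM2r ?invr_gt0// lerD2r.
      - move=> s; rewrite /= in_itv/= => /andP[s0 st].
        by rewrite rU// (le_trans st).
    have ri : leb.-integrable `[0, 1] r.
      have [iL _] := intL l (ltW l0) (lexx _); have [iU _] := intU 1 l1 (lexx _).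
      have [mL fL] := integrableP _ _ _ iL; have [mU fU] := integrableP _ _ _ iU.
      have mr : measurable_fun (`[0, l]%classic `|` `]l, 1]%classic) r.
        exact/measurable_funU.
      rewrite I01; apply/integrableP; split=> //.
      apply: le_lt_trans (ge0_integral_lowerU _ _ _ _ _) _ => //.
        apply/disj_setPS => x [] /=; rewrite !in_itv/= => /andP[_ xb] /andP[bx _].
        by move: bx; rewrite ltNge xb.
      exact: lte_add_pinfty.
    split; first exact: ri.
    have m0 : mu 0 = mu1 0 by rewrite /mu ltW// /a1 /affine mulr0 addr0.
    move=> t /andP[t0 t1]; rewrite m0; have [tl|lt] := leP t l.
      have [-> _ _] := L _ tl; have [_ ->] := intL _ t0 tl.
      exact: E1 (a101 _ t0 tl).
    have [-> _ _] := U _ lt; rewrite (E2 _ (a201 _ lt t1)).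
    have E12 : (\int[mu2 0%R]_z (zeta z.1 z.2)%:E = \int[mu1 1%R]_z (zeta z.1 z.2)%:E)%E.
      by apply: eq_measure_integral => A mA _; exact/esym/e12.
    rewrite E12 (E1 1); last by rewrite lexx ler01.
    have [_ IL] := intL l (ltW l0) (lexx _); have [_ IU] := intU _ lt t1.
    have a1l : a1 l = 1 by rewrite a1E divff.
    rewrite a1l in IL; rewrite -IL -IU -addeA -integral_setU//.
    + by rewrite -(@itv_bndbnd_setU _ _ _ (BRight l))// bnd_simp ltW.
    + rewrite -(@itv_bndbnd_setU _ _ _ (BRight l)) ?bnd_simp ?(ltW l0) ?(ltW lt)//.
      case/integrableP : ri => mr _; apply: measurable_funS mr => //.
      by apply: subset_itv; rewrite bnd_simp.
    + apply/disj_setPS => x [] /=; rewrite !in_itv/= => /andP[_ xb] /andP[bx _].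
      by move: bx; rewrite ltNge xb.
- by rewrite /mu ltW// /a1 /affine mulr0 add0r.
- by rewrite /mu leNgt l1/= a2E divff.
- rewrite !actionE {1}I01.
  apply: le_trans (ge0_integral_lowerU _ _ _ _ _) _ => //.
  + apply/disj_setPS => x [] /=; rewrite !in_itv/= => /andP[_ xb] /andP[bx _].
    by move: bx; rewrite ltNge xb.
  + by move=> t _; exact: curve_energy_ge0.
  apply: leeD.
  + apply: le_trans (ge0_integral_lower_affine 0 lN0 _ _) _ => //.
      by move=> t _; exact: curve_energy_ge0.
    rewrite (_ : affine 0 l @^-1` `[0, l] = `[0, 1]%classic); last first.
      apply/seteqP; split => s /=; rewrite !in_itv/= /affine add0r;
        by rewrite pmulr_rge0// -{2}[l]mulr1 ler_pM2l.
    have H : (\int[leb]_(s in `[0%R, 1%R])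
          curve_energy theta K mu phi psi (affine 0 l s) <=
        (l^-1 ^+ 2)%:E *
        \int[leb]_(s in `[0%R, 1%R]) curve_energy theta K mu1 phi1 psi1 s)%E.
      apply: le_trans (ge0_integral_lowerZl _ _ _ _) => //; last 2 first.
      - by rewrite exprn_gt0// invr_gt0.
      - by move=> s _; exact: curve_energy_ge0.
      apply: ge0_le_integral_lower => s; rewrite /= in_itv/= => /andP[s0 s1'].
        exact: curve_energy_ge0.
      have ls0 : 0 <= affine 0 l s by rewrite /affine add0r mulr_ge0// ltW.
      have lsl : affine 0 l s <= l by rewrite /affine add0r -[leRHS]mulr1 ler_pM2l.
      have [_ _ _ _ ->] := SL _ ls0 lsl.
      have -> : a1 (affine 0 l s) = s by rewrite a1E /affine add0r (mulrC l) mulfK.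
      by [].
    rewrite gtr0_norm//; apply: le_trans (lee_wpmul2l _ H) _.
      by rewrite lee_fin ltW.
    by rewrite muleA -EFinM (_ : l * l^-1 ^+ 2 = l^-1)//; field.
  + apply: le_trans (ge0_integral_lower_affine l kN0 _ _) _ => //.
      by move=> t _; exact: curve_energy_ge0.
    rewrite (_ : affine l (1 - l) @^-1` `]l, 1] = `]0, 1]%classic); last first.
      apply/seteqP; split => s /=; rewrite !in_itv/= /affine ltrDl pmulr_rgt0//;
        by rewrite -lerBrDl -{2}[1 - l]mulr1 ler_pM2l.
    have H : (\int[leb]_(s in `]0%R, 1%R])
          curve_energy theta K mu phi psi (affine l (1 - l) s) <=
        ((1 - l)^-1 ^+ 2)%:E *
        \int[leb]_(s in `[0%R, 1%R]) curve_energy theta K mu2 phi2 psi2 s)%E.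
      apply: le_trans (ge0_integral_lowerZl _ _ _ _) => //; last 2 first.
      - by rewrite exprn_gt0// invr_gt0.
      - by move=> s _; exact: curve_energy_ge0.
      apply: le_trans (@ge0_subset_integral_lower `]0%R, 1%R]%classic `[0%R, 1%R]%classic _ _ _); last 2 first.
      - move=> s _; rewrite mule_ge0 ?curve_energy_ge0// lee_fin.
        by rewrite exprn_ge0// invr_ge0 ltW.
      - by apply: subset_itv; rewrite bnd_simp.
      apply: ge0_le_integral_lower => s; rewrite /= in_itv/= => /andP[s0 s1'].
        exact: curve_energy_ge0.
      have ls0 : l < affine l (1 - l) s by rewrite /affine ltrDl mulr_gt0.
      have lsl : affine l (1 - l) s <= 1.
        by rewrite /affine -lerBrDl -[leRHS]mulr1 ler_pM2l.
      have [_ _ _ _ ->] := SU _ ls0 lsl.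
      have -> : a2 (affine l (1 - l) s) = s.
        by rewrite a2E /affine; field.
      by [].
    rewrite gtr0_norm//; apply: le_trans (lee_wpmul2l _ H) _.
      by rewrite lee_fin ltW.
    by rewrite muleA -EFinM (_ : (1 - l) * (1 - l)^-1 ^+ 2 = (1 - l)^-1)//; field.
Qed.

End gluing.

(** * Separation *)

Section uniform_bound.
Context {R : realType} {d : nat} {G : pfinType}.
Local Notation Rd := 'rV[R]_d.
Local Notation X := ('rV[R]_d * discr G)%type.
Variables (theta : mobility R d G) (K : G -> G -> R).
Hypothesis theta_ge0 : mobility_ge0 theta.
Hypothesis mtheta : mobility_measurable theta.
Hypothesis K_ge0 : forall g g', 0 <= K g g'.

(** A sequence of points seen as a random variable on the natural numbers, along which a discrete
    law is transported to space. *)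
Definition atom (x : nat -> Rd) (n : nat) : Rd := x n.

Lemma measurable_atom x : measurable_fun setT (atom x).
Proof. by []. Qed.

HB.instance Definition _ x :=
  isMeasurableFun.Build _ _ _ _ (atom x) (measurable_atom x).

Lemma card_pfin_gt0 : (0 < #|G|)%N.
Proof. by apply/card_gt0P; exists point. Qed.

Fact uniform_ge0 (g : G) : 0 <= (#|G|%:R^-1 : R).
Proof. by rewrite invr_ge0. Qed.

Fact uniform_sum : \sum_(g : G) (#|G|%:R^-1 : R) = 1.
Proof.
rewrite sumr_const -[LHS]mulr_natr; apply: mulVf.
rewrite pnatr_eq0 -lt0n; exact: card_pfin_gt0.
Qed.

Definition uniform_simplex : simplex R G := Simplex uniform_ge0 uniform_sum.

Lemma measurable_sqnorm : measurable_fun setT (@sqnorm R d).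
Proof.
apply: measurable_sum => i; apply: measurable_funX.
by apply: continuous_measurable_fun_rV; exact: coord_continuous.
Qed.

Lemma integral_sqnorm_mix (U : probability Rd R) (p : simplex R G) :
  (\int[mix U p]_z (sqnorm z.1)%:E = \int[U]_x (sqnorm x)%:E)%E.
Proof.
rewrite ge0_integral_mix; last 2 first.
- apply/measurable_EFinP; apply: measurableT_comp => //.
  exact: measurable_sqnorm.
- by move=> z; rewrite lee_fin sqnorm_ge0.
rewrite /= -ge0_sume_distrl; last by move=> h _; rewrite lee_fin weight_ge0.
by rewrite sumEFin weight_sum mul1e.
Qed.

Lemma sqnorm_bounded (C : set Rd) : compact C ->
  exists M : R, forall x, C x -> sqnorm x <= M.
Proof.
move=> /compact_coord_bounded[n nP]; exists (\sum_(i < d) n%:R ^+ 2) => x Cx.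
by apply: ler_sum => i _; apply: normr_sqr_le; exact: nP.
Qed.

Lemma integral_sqnorm_lty (U : probability Rd R) (C : set Rd) :
  compact C -> U (~` C) = 0%E -> (\int[U]_x (sqnorm x)%:E < +oo)%E.
Proof.
move=> cC UC; have mC := measurable_compact cC.
have [M MP] := sqnorm_bounded cC.
have -> : (\int[U]_y (sqnorm y)%:E = \int[U]_(y in C) (sqnorm y)%:E)%E.
  rewrite -(@setUv _ C) ge0_integral_setU//; last 4 first.
  - exact: measurableC.
  - by rewrite setUv; apply/measurable_EFinP; exact: measurable_sqnorm.
  - by move=> y _; rewrite lee_fin sqnorm_ge0.
  - by apply/disj_setPS => y [].
  rewrite [X in (_ + X)%E](_ : _ = 0%E) ?adde0//.
  apply: null_set_integral => //; first exact: measurableC.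
  apply/measurable_EFinP; apply: measurable_funTS; exact: measurable_sqnorm.
apply: (@le_lt_trans _ _ (\int[U]_(y in C) M%:E)%E).
  apply: ge0_le_integral_lower => y Cy; rewrite lee_fin ?sqnorm_ge0//.
  exact: MP.
rewrite integral_cst// ltey_eq fin_numM//.
by apply: fin_num_measure.
Qed.

Lemma A15_notA0 : A15 theta -> ~ A0 theta.
Proof.
move=> [_ _ _ a4 _] [_ _ _ /(_ [set 0])[]]; first exact: compact_set1.
move=> c c0 /(_ 0 point point 0 0 erefl (lexx _) (lexx _)).
have := a4 0 point point 0 0 0 (lexx _) (lexx _) (lexx _).
by rewrite !mul0r => ->; rewrite leNgt c0.
Qed.

Lemma A15_hat_measure m : A15 theta ->
  hat_measure theta m = distribution m space_of.
Proof. by move=> /A15_notA0 a0; rewrite /hat_measure asboolF. Qed.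

Lemma A15_diag x g g' s : A15 theta -> 0 <= s ->
  theta x g g' s s = s * theta x g g' 1 1.
Proof. by move=> [_ _ _ a4 _] s0; rewrite -a4 ?mulr1. Qed.

Lemma A15_mono x g g' s t s' t' : A15 theta -> 0 <= s -> s <= s' ->
  0 <= t -> t <= t' -> theta x g g' s t <= theta x g g' s' t'.
Proof.
move=> [a1 _ a3 _ _] s0 ss t0 tt; have s0' := le_trans s0 ss.
have t0' := le_trans t0 tt.
apply: (@le_trans _ _ (theta x g g' s' t)); first exact: a3.
by rewrite [leLHS]a1// [leRHS]a1//; exact: a3.
Qed.

(** If [theta x g g' 1 1] were unbounded on [C], points with values above [n%:R / p n] could be
    given mass [p n] each. With uniform node weights the resulting law lies in [P2], since it is
    carried by [C], but the n-th atom alone contributes at least a fixed multiple of [n] to the hat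
    mass of [C]. *)
Lemma A15_bounded (C : set Rd) : A15 theta -> hat_locally_finite theta ->
  compact C -> exists M : R, forall x g g', C x -> theta x g g' 1 1 <= M.
Proof.
move=> a15 hlf cC.
suff /choice[M MP] : forall p : G * G, exists M : R,
    forall x, C x -> theta x p.1 p.2 1 1 <= M.
  exists (\sum_p `|M p|) => x g g' Cx.
  apply: le_trans (MP (g, g') x Cx) _; apply: le_trans (ler_norm _) _.
  by rewrite (bigD1 (g, g'))//= lerDl sumr_ge0.
move=> [g g'] /=; apply: contrapT => /forallNP H.
(* The Poisson law serves as a probability on the natural numbers that charges every integer. *)
pose p n : R := poisson_pmf 1 n.
have p0 n : 0 < p n.
  by rewrite /p /poisson_pmf ltr01 expr1n mul1r mulr_gt0 ?expR_gt0// invr_gt0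
    ltr0n fact_gt0.
have /choice[x xP] : forall n : nat, exists x, C x /\
    n%:R / p n < theta x g g' 1 1.
  move=> n; apply: contrapT => /forallNP nx; apply: (H (n%:R / p n)) => x Cx.
  by rewrite leNgt; apply/negP => lt; exact: (nx x).
pose U : probability Rd R := distribution (poisson_prob (1 : R) 0%N) (atom x).
have mC := measurable_compact cC.
have UE A : U A = poisson_prob (1 : R) 0%N (x @^-1` A) by [].
have UC : U (~` C) = 0%E.
  rewrite UE (_ : x @^-1` _ = set0) ?measure0//.
  by apply/seteqP; split => // n; case; exact: (xP n).1.
(* An inequality only, since the chosen points may coincide. *)
have Ux n : ((p n)%:E <= U [set x n])%E.
  rewrite UE; apply: (@le_trans _ _ (poisson_prob (1 : R) 0%N [set n])).
    by rewrite /poisson_prob ltr01 esum_set1// lee_fin poisson_pmf_ge0.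
  by apply: le_measure; rewrite ?inE// => _ ->.
pose m := mix U uniform_simplex.
have m2 : P2 m.
  rewrite /P2 integral_sqnorm_mix.
  exact: integral_sqnorm_lty cC UC.
have := hlf m m2 C cC; rewrite hat_integralE A15_hat_measure//.
have E : forall A, measurable A ->  A `<=` setT -> distribution m space_of A = U A.
  by move=> A mA _; rewrite -[LHS]/(marginal m A) /m marginal_mix.
rewrite (eq_measure_integral U)//; last first.
  by move=> A mA AC; exact: E.
set I := (\int[U]_(y in C) _)%E => Ifin.
(* The common conditional weight at every atom; by homogeneity the density there is
   [c * theta (x n) g g' 1 1]. *)
pose c : R := #|G|%:R^-1.
have c0 : 0 < c by rewrite invr_gt0 ltr0n card_pfin_gt0.
have nI n : ((c * n%:R)%:E <= I)%E.
  have Ux0 : U [set x n] != 0.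
    by apply: contraTN (Ux n) => /eqP ->; rewrite -ltNge lte_fin.
  apply: (@le_trans _ _ (\int[U]_(y in [set x n])
      (hat_int theta m (fun _ _ _ => 1%R) y)%:E)%E); last first.
    apply: ge0_subset_integral => //.
    - exact: measurable_set1_rV.
    - by apply/measurable_EFinP; exact: measurable_hat_int.
    - by move=> y _; rewrite lee_fin hat_int_ge0.
    - by move=> _ ->; exact: (xP n).1.
  rewrite (_ : (\int[U]_(y in [set x n]) _)%E =
      ((hat_int theta m (fun _ _ _ => 1%R) (x n))%:E * U [set x n])%E); last first.
    rewrite -integral_cst; last exact: measurable_set1_rV.
    by apply: eq_integral => y; rewrite inE /= => ->.
  apply: (@le_trans _ _ ((c * (n%:R / p n))%:E * (p n)%:E)%E).
    by rewrite -EFinM -mulrA divfK// gt_eqF.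
  apply: lee_pmul => //.
  - by rewrite lee_fin mulr_ge0 ?divr_ge0// ltW.
  - by rewrite lee_fin ltW.
  rewrite lee_fin; apply: (@le_trans _ _ (hat_density theta m (x n) g g')).
    rewrite /hat_density !conditional_mix//= -/c A15_diag ?(ltW c0)//.
    by rewrite ler_wpM2l ?(ltW c0)// ltW//; exact: (xP n).2.
  rewrite /hat_int (bigD1 g)//= (bigD1 g')//= mul1r -addrA lerDl addr_ge0//.
    by apply: sumr_ge0 => h _; rewrite mul1r hat_density_ge0.
  by apply: sumr_ge0 => h _; apply: sumr_ge0 => h' _; rewrite mul1r hat_density_ge0.
have If : I \is a fin_num.
  by rewrite ge0_fin_numE// (le_trans _ (nI 0%N))// mulr0.
move: nI; rewrite -(fineK If) => nI.
have := nI (Num.truncn (fine I / c)).+1; rewrite lee_fin -ler_pdivlMl// mulrC.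
by rewrite leNgt truncnS_gt.
Qed.

(** Under A0 the hat measure is the same for all laws, so local finiteness for the single law [m0]
    suffices. Under A1-A5 conditional weights are at most 1, so by monotonicity the density is at
    most [theta x g g' 1 1], and the marginal has total mass 1. *)
Lemma uniform_hat_bound (m0 : probability X R) (C : set Rd) : A0 theta \/ A15 theta ->
  hat_locally_finite theta -> compact C -> P2 m0 ->
  exists B : R, forall m, (hat_integral theta m C (fun _ g g' => K g g') <= B%:E)%E.
Proof.
move=> a hlf cC m02.
have mC := measurable_compact cC.
pose k := \sum_g \sum_g' K g g'.
have kK g g' : K g g' <= k.
  rewrite /k (bigD1 g)//= (bigD1 g')//= -addrA lerDl addr_ge0 ?sumr_ge0//.
  by move=> h _; exact: sumr_ge0.
have k0 : 0 <= k by apply: sumr_ge0 => h _; exact: sumr_ge0.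
have cond0 (m : probability X R) x g : 0 <= conditional m x g.
  by have [_ /(_ x)/andP[]] := conditionalP m g.
have cond1 (m : probability X R) x g : conditional m x g <= 1.
  by have [_ /(_ x)/andP[]] := conditionalP m g.
case: a => [a0|a15].
  have [_ ec _ _] := a0.
  have hE m : hat_measure theta m = lebesgue_rV d.
    by rewrite /hat_measure asboolT.
  have I1 := hlf m0 m02 C cC.
  exists (fine (k%:E * hat_integral theta m0 C (fun _ _ _ => 1%R))) => m.
  have I0 : (0 <= hat_integral theta m0 C (fun _ _ _ => 1%R))%E.
    rewrite hat_integralE; apply: integral_ge0 => x _.
    by rewrite lee_fin hat_int_ge0.
  rewrite fineK; last by rewrite fin_numM// ge0_fin_numE.
  rewrite !hat_integralE !hE -ge0_integralZl//; last 2 first.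
  - by apply/measurable_EFinP; exact: measurable_hat_int.
  - by move=> x _; rewrite lee_fin hat_int_ge0.
  apply: ge0_le_integral_lower => x _; first by rewrite lee_fin hat_int_ge0.
  rewrite -EFinM lee_fin /hat_int mulr_sumr; apply: ler_sum => g _.
  rewrite mulr_sumr; apply: ler_sum => g' _; rewrite mul1r.
  rewrite /hat_density (ec _ _ _ _ _ (conditional m0 x g) (conditional m0 x g'))//.
  by rewrite ler_wpM2r// theta_ge0.
have [M MP] := A15_bounded a15 hlf cC.
exists (\sum_(g : G) \sum_(g' : G) k * `|M|) => m; rewrite hat_integralE A15_hat_measure//.
apply: (@le_trans _ _ (\int[distribution m space_of]_(x in C)
    (\sum_(g : G) \sum_(g' : G) k * `|M|)%:E)%E).
  apply: ge0_le_integral_lower => x Cx; first by rewrite lee_fin hat_int_ge0.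
  rewrite lee_fin; apply: ler_sum => g _; apply: ler_sum => g' _.
  apply: ler_pM => //; first exact: hat_density_ge0.
  apply: le_trans (ler_norm M); apply: le_trans (MP x g g' Cx).
  by apply: A15_mono.
rewrite integral_cst// -[leRHS]mule1; apply: lee_wpmul2l; last first.
  exact: probability_le1.
by rewrite lee_fin; apply: sumr_ge0 => g _; apply: sumr_ge0 => g' _; rewrite mulr_ge0.
Qed.

End uniform_bound.

Lemma integral_cst01 (R : realType) (c : R) :
  (\int[@lebesgue_measure R]_(t in `[0%R, 1%R]) c%:E = c%:E)%E.
Proof.
rewrite (integral_cst (@lebesgue_measure R) (measurable_itv `[0%R, 1%R]) c%:E).
rewrite -[RHS]mule1; congr (_ * _)%E.
by rewrite [LHS](@lebesgue_measure_itv R `[0%R, 1%R])/= lte_fin ltr01 oppr0 adde0.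
Qed.

(** * From curves of bounded action to the metric axioms *)

Section linked.
Context {R : realType} {d : nat} {G : pfinType}.
Local Notation Rd := 'rV[R]_d.
Local Notation X := ('rV[R]_d * discr G)%type.
Local Notation leb := (@lebesgue_measure R).
Variables (theta : mobility R d G) (K : G -> G -> R).
Hypothesis theta_ge0 : mobility_ge0 theta.
Hypothesis mtheta : mobility_measurable theta.
Hypothesis K_ge0 : forall g g', 0 <= K g g'.
Implicit Types (m n l : probability X R).

(** A substitute for [W2] being at most [r] without infimum or square root: it implies that bound,
    and it holds as soon as [W2] is smaller than [r]. *)
Definition linked (r : R) m n := exists mu phi psi,
  [/\ regular_curve theta K mu phi psi, eq_law (mu 0) m, eq_law (mu 1) n &
    (action theta K mu phi psi <= (r ^+ 2)%:E)%E].

Lemma linked_sym r m n : linked r m n -> linked r n m.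
Proof.
move=> [mu [phi [psi [rc m0 m1 ar]]]].
have [mu' [phi' [psi' [rc' m0' m1' ar']]]] := reverse_curve theta_ge0 mtheta K_ge0 rc.
exists mu', phi', psi'; rewrite m0' m1'.
by split; [exact: rc'|exact: m1|exact: m0|exact: le_trans ar' ar].
Qed.

(** With the first curve taking the fraction r/(r+s) of the time, the two rescaled actions r(r+s)
    and s(r+s) add up to the square of r + s. Positivity keeps the junction time strictly inside the
    unit interval. *)
Lemma linked_trans r s m n l : 0 < r -> 0 < s ->
  linked r m n -> linked s n l -> linked (r + s) m l.
Proof.
move=> r0 s0 [mu1 [phi1 [psi1 [rc1 m1 n1 a1]]]] [mu2 [phi2 [psi2 [rc2 n2 l2 a2]]]].
have rs0 : 0 < r + s by rewrite addr_gt0.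
have t01 : 0 < r / (r + s) < 1.
  by rewrite divr_gt0//= ltr_pdivrMr// mul1r ltrDl.
have e12 : eq_law (mu1 1) (mu2 0) by move=> A mA; rewrite n1// n2.
have [mu [phi [psi [rc e0 e1 a]]]] :=
  glue_curves theta_ge0 mtheta K_ge0 t01 rc1 rc2 e12.
exists mu, phi, psi; rewrite e0 e1; split=> //; apply: le_trans a _.
rewrite (_ : 1 - r / (r + s) = s / (r + s)); last by field; rewrite gt_eqF.
rewrite (_ : (r + s) ^+ 2 = (r / (r + s))^-1 * r ^+ 2 + (s / (r + s))^-1 * s ^+ 2);
  last by field; rewrite !gt_eqF.
by rewrite EFinD !EFinM; apply: leeD; apply: lee_wpmul2l => //;
  rewrite lee_fin invr_ge0 divr_ge0// ltW.
Qed.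

Lemma W2_ge0 m n : (0 <= W2 theta K m n)%E.
Proof. exact: sqrte_ge0. Qed.

Lemma linked_W2 r m n : 0 <= r -> linked r m n -> (W2 theta K m n <= r%:E)%E.
Proof.
move=> r0 [mu [phi [psi [[gc _] e0 e1 a]]]].
rewrite /W2 (_ : r%:E = sqrte (r ^+ 2)%:E); last by rewrite /= sqrtr_sqr ger0_norm.
rewrite lee_sqrt; last by rewrite lee_fin exprn_ge0.
apply: le_trans a; apply: ereal_inf_lbound.
by exists mu, phi, psi.
Qed.

(** The strict inequality provides a curve of action at most [r ^+ 2], which is then regularized
    without raising its action. *)
Lemma W2_linked r m n : 0 <= r -> (W2 theta K m n < r%:E)%E -> linked r m n.
Proof.
move=> r0; rewrite /W2; set S := [set a | _] => lt.
have : (ereal_inf S < (r ^+ 2)%:E)%E.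
  rewrite ltNge; apply: contraTN lt => le; rewrite -leNgt.
  rewrite (_ : r%:E = sqrte (r ^+ 2)%:E); last by rewrite /= sqrtr_sqr ger0_norm.
  by rewrite lee_sqrt// (le_trans _ le)// lee_fin exprn_ge0.
move=> /ereal_inf_lt[_ [mu [phi [psi [gc e0 e1 ->]]]] /ltW a].
have [phi' [psi' [rc a']]] := regularize theta_ge0 mtheta K_ge0 gc.
exists mu, phi', psi'.
by split; [exact: rc|exact: e0|exact: e1|exact: le_trans a' a].
Qed.

Lemma W2_sym_le m n : (W2 theta K m n <= W2 theta K n m)%E.
Proof.
have := W2_ge0 n m; case E : (W2 theta K n m) => [r| |]//; last first.
  by move=> _; rewrite leey.
rewrite lee_fin => r0.
apply/lee_addgt0Pr => e e0; rewrite -EFinD.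
have re0 : 0 <= r + e by rewrite addr_ge0// ltW.
apply: linked_W2 => //; apply: linked_sym; apply: W2_linked => //.
by rewrite E lte_fin ltrDl.
Qed.

Lemma W2_triangle m n l :
  (W2 theta K m l <= W2 theta K m n + W2 theta K n l)%E.
Proof.
have := W2_ge0 n l; case E2 : (W2 theta K n l) => [s| |]//; last first.
  by move=> _; rewrite addey ?leey// gt_eqF// (lt_le_trans _ (W2_ge0 m n)).
have := W2_ge0 m n; case E1 : (W2 theta K m n) => [r| |]//; last first.
  by move=> _ _; rewrite addye ?leey.
rewrite !lee_fin => r0 s0; apply/lee_addgt0Pr => e e0; rewrite -!EFinD.
(* Adding [e / 2] to each distance provides both the strict inequality needed to pick a curve and
   the positivity needed to glue. *)
have h0 : 0 < e / 2 by rewrite divr_gt0.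
rewrite (_ : r + s + e = (r + e / 2) + (s + e / 2)); last by field.
have r0' : 0 < r + e / 2 by rewrite ltr_wpDl.
have s0' : 0 < s + e / 2 by rewrite ltr_wpDl.
apply: linked_W2; first by rewrite addr_ge0// ltW.
by apply: (linked_trans (n := n)) => //; apply: W2_linked; rewrite ?ltW//
  ?E1 ?E2 lte_fin ltrDl.
Qed.

Lemma grad_cst x (c : R) : grad (cst c : Rd -> R) x = 0.
Proof. by apply/rowP => i; rewrite !mxE derive_cst. Qed.

Lemma linked_refl m n : P2 m -> eq_law m n -> linked 0 m n.
Proof.
move=> m2 mn.
pose z (t : R) (x : Rd) (g : G) : R := 0.
have g0 t x g : grad (z t ^~ g) x = 0 by exact: grad_cst.
have h0 t x g g' : grad_g (z t) x g g' = 0 by rewrite /grad_g subrr.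
exists (fun=> m), z, z; split => //.
  apply: regular_curveP.
  - by [].
  - by move=> t _ g x; exact: differentiable_cst.
  - move=> g i; rewrite (_ : (fun _ => _) = cst 0); first exact: measurable_cst.
    by apply/funext => p; rewrite g0 mxE.
  - move=> g g'; rewrite (_ : (fun _ => _) = cst 0); first exact: measurable_cst.
    by apply/funext => p; rewrite h0.
  - move=> t _; apply: admissible0 => *; [exact: g0|exact: h0].
  - move=> zeta tz.
    have r0 t : curve_rate theta K (fun=> m) z z zeta t = 0%E.
      by apply: rate_of0 => *; [exact: g0|exact: h0].
    split; first by rewrite (_ : curve_rate _ _ _ _ _ _ = cst 0%E);
      [exact: integrable0|apply/funext].
    by move=> t _; rewrite [X in (_ + X)%E]integral0_eq ?adde0.
rewrite actionE integral0_eq ?expr0n// => t _.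
by apply: energy_of0 => *; [exact: g0|exact: h0].
Qed.

(** The variation of the integral of [zeta] is the time integral of its rate, which Young's
    inequality bounds by the energy at almost no cost once [e] is chosen. The work lies in
    integrating this bound although the energy may not be measurable in time. *)
Lemma linked_test zeta (M B : R) (C : set Rd) r m n (e : R) :
  test_function zeta -> bounded_test zeta M C ->
  (forall l, (hat_integral theta l C (fun _ g g' => K g g') <= B%:E)%E) ->
  linked r m n -> 0 < e ->
  (`|\int[n]_z (zeta z.1 z.2)%:E - \int[m]_z (zeta z.1 z.2)%:E| <=
    (2^-1 * (e * (M ^+ 2 * (d%:R + 4 * B)) + e^-1 * r ^+ 2))%:E)%E.
Proof.
move=> tz bz Bh [mu [phi [psi [rc e0 e1 a]]]] ep.
have [gc _] := rc; have [ri E] := grad_curve_rate gc tz.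
have [_ ce] := gc.
have i01 : 0 <= (1 : R) <= 1 by rewrite ler01 lexx.
have lawE (k k' : probability X R) : eq_law k k' ->
    (\int[k']_z (zeta z.1 z.2)%:E = \int[k]_z (zeta z.1 z.2)%:E)%E.
  by move=> kk; apply: eq_measure_integral => A mA _; exact/esym/kk.
rewrite (lawE _ _ e0) (lawE _ _ e1) (E 1 i01).
rewrite addeAC subee ?add0e; last exact: integrable_fin_num (test_integrable _ tz).
set c := M ^+ 2 * (d%:R + 4 * B).
have [mr rfin] := integrableP _ _ _ ri.
apply: le_trans (le_abse_integral _ _ _) _ => //.
pose q t := curve_rate theta K mu phi psi zeta t.
have c0 : 0 <= c.
  have [M0 _ _ _] := bz; rewrite mulr_ge0 ?exprn_ge0// addr_ge0// mulr_ge0//.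
  rewrite -lee_fin; apply: le_trans (Bh m); rewrite hat_integralE.
  by apply: integral_ge0 => x _; rewrite lee_fin hat_int_ge0.
have bd t : 0 <= t <= 1 -> (`|q t| <= (2^-1)%:E * ((e * c)%:E + (e^-1)%:E *
    curve_energy theta K mu phi psi t))%E.
  move=> t01; exact: (rate_le_energy theta_ge0 mtheta K_ge0 tz
    (curve_fields ce t01) bz (Bh _) ep).
have qf t : 0 <= t <= 1 -> q t \is a fin_num.
  move=> t01; apply: (rate_of_fin_num theta_ge0 mtheta tz (curve_fields ce t01)).
  by have [_ adm] := rc; exact: adm.
have e2 : 0 <= 2 * e by rewrite mulr_ge0// ltW.
(* Young's inequality solved for the energy and cut at 0: [p] is measurable in time and lies below
   the energy, so its integral is at most the action. *)
pose p t := Order.max ((2 * e)%:E * `|q t| - (e ^+ 2 * c)%:E)%E 0%E.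
have mq : measurable_fun (`[0, 1]%classic : set R) (fun t => `|q t|%E) by exact: measurableT_comp.
have mp : measurable_fun (`[0, 1]%classic : set R) p.
  apply: measurable_maxe => //; apply: emeasurable_funB => //.
  exact: measurable_funeM.
have pE t : 0 <= t <= 1 -> (p t <= curve_energy theta K mu phi psi t)%E.
  have Et := curve_energy_ge0 theta_ge0 K_ge0 mu phi psi t.
  move=> t01; rewrite /p ge_max Et andbT.
  have := bd t t01; move: Et.
  move: (qf t t01); case: (q t) => [q0| |]//= _.
  case: (curve_energy _ _ _ _ _ _) => [b| |]//= _; last by rewrite leey.
  move=> H0; have H : `|q0| <= 2^-1 * (e * c + e^-1 * b) by rewrite -lee_fin.
  suff : 2 * e * `|q0| - e ^+ 2 * c <= b by rewrite -lee_fin.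
  rewrite -(ler_pM2l (x := 2 * e)) ?mulr_gt0// in H.
  rewrite lerBlDr (le_trans H)// le_eqVlt; apply/orP; left; apply/eqP.
  by field; rewrite gt_eqF.
have Ip : (\int[leb]_(t in `[0%R, 1%R]) p t <= (r ^+ 2)%:E)%E.
  apply: le_trans a; rewrite actionE.
  apply: ge0_le_integral_lower => t; rewrite /= in_itv/= => t01.
    by rewrite /p le_max lexx orbT.
  exact: pE.
have Iq : ((2 * e)%:E * \int[leb]_(t in `[0%R, 1%R]) `|q t| <=
    (r ^+ 2 + e ^+ 2 * c)%:E)%E.
  rewrite -ge0_integralZl//.
  apply: (@le_trans _ _ (\int[leb]_(t in `[0%R, 1%R]) (p t + (e ^+ 2 * c)%:E))%E).
    apply: ge0_le_integral_lower => t _; first by rewrite mule_ge0.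
    by rewrite -leeBlDr// /p le_max lexx.
  rewrite ge0_integralD//.
  - by rewrite integral_cst01 EFinD leeD2r.
  - by move=> t _; rewrite /p le_max lexx orbT.
  - by move=> t _; rewrite lee_fin mulr_ge0// exprn_ge0// ltW.
rewrite -lee_pdivlMl ?mulr_gt0// in Iq; apply: le_trans Iq _.
by rewrite lee_fin le_eqVlt; apply/orP; left; apply/eqP; field; rewrite gt_eqF.
Qed.

Lemma linked_eq_law m n : A0 theta \/ A15 theta -> hat_locally_finite theta ->
  P2 m -> (forall r, 0 < r -> linked r m n) -> eq_law m n.
Proof.
move=> a hlf m2 H; apply: law_unique => zeta tz.
have [M [C bz]] := test_bound tz; have [M0 cC _ _] := bz.
have [B BP] := uniform_hat_bound theta_ge0 mtheta K_ge0 a hlf cC m2.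
have fi (l : probability X R) : (\int[l]_z (zeta z.1 z.2)%:E)%E \is a fin_num.
  exact: integrable_fin_num (test_integrable _ tz).
set c := M ^+ 2 * (d%:R + 4 * B).
(* Taking curves with [r] equal to [e] makes both terms of the bound linear in [e]. *)
have D (e : R) : 0 < e ->
   `|fine (\int[n]_z (zeta z.1 z.2)%:E)%E - fine (\int[m]_z (zeta z.1 z.2)%:E)%E|
    <= e * (2^-1 * (c + 1)).
  move=> e0; have := linked_test tz bz BP (H e e0) e0.
  rewrite -(fineK (fi m)) -(fineK (fi n)) -EFinB abse_EFin lee_fin => /le_trans; apply.
  by rewrite le_eqVlt; apply/orP; left; apply/eqP; rewrite /c; field; rewrite gt_eqF.
rewrite -(fineK (fi m)) -(fineK (fi n)); congr EFin; apply/esym/eqP.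
rewrite -subr_eq0 -normr_le0; apply/ler_addgt0Pr => e e0; rewrite add0r.
have c1 : 0 < 2^-1 * (`|c| + 1) by rewrite mulr_gt0// ltr_wpDl.
have := D _ (divr_gt0 e0 c1) => /le_trans; apply.
rewrite -[leRHS](divfK (lt0r_neq0 c1)) ler_wpM2l ?divr_ge0 ?(ltW e0) ?(ltW c1)//.
by rewrite ler_wpM2l// lerD2r ler_norm.
Qed.

Lemma W2_pseudometric : A0 theta \/ A15 theta -> hat_locally_finite theta ->
  (forall m n, P2 m -> P2 n -> exists2 r, 0 < r & linked r m n) ->
  metric_on_P2 (W2 theta K).
Proof.
move=> a hlf H; split.
- move=> m n m2 n2; split; first exact: W2_ge0.
  have [r r0 rl] := H m n m2 n2; rewrite ge0_fin_numE ?W2_ge0//.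
  by apply: le_lt_trans (linked_W2 (ltW r0) rl) _; rewrite ltry.
- move=> m n m2 n2; split=> [W0|mn].
    apply: linked_eq_law => // r r0; apply: W2_linked; first exact: ltW.
    by rewrite W0 lte_fin.
  apply/eqP; rewrite eq_le W2_ge0 andbT; apply: linked_W2 => //.
  exact: linked_refl.
- by move=> m n _ _; apply/eqP; rewrite eq_le !W2_sym_le.
- by move=> m n l _ _ _; exact: W2_triangle.
Qed.

End linked.

(** * Contraction of the space coordinates *)

Section fubini_itv.
Context {R : realType}.
Local Notation leb := (@lebesgue_measure R).

(** The bound [b] is uniform in [s] and the interval has finite length, so [k] times the indicator
    of the interval is integrable for the product measure. *)
Lemma fubini_itv (d' : measure_display) (T : measurableType d')
    (m : probability T R) (k : R -> T -> R) (b : T -> R) (u w : R) :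
  measurable_fun setT (fun p : R * T => k p.1 p.2) ->
  (forall s z, `|k s z| <= b z) -> m.-integrable setT (EFin \o b) ->
  leb.-integrable `[u, w] (fun s => \int[m]_z (k s z)%:E)%E /\
  (\int[m]_z \int[leb]_(s in `[u, w]) (k s z)%:E =
   \int[leb]_(s in `[u, w]) \int[m]_z (k s z)%:E)%E.
Proof.
move=> mk kb bi.
pose f (p : measurableTypeR R * T) : \bar R := (\1_(`[u, w]%classic : set R) p.1 * k p.1 p.2)%:E.
have mf : measurable_fun setT f.
  apply/measurable_EFinP; apply: measurable_funM => //.
  have mI : measurable_fun setT (\1_(`[u, w]%classic : set R) : R -> R).
    by apply: measurable_indic.
  exact: (measurableT_comp mI measurable_fst).
have b0 z : 0 <= b z by apply: le_trans (kb u z).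
have fi : (leb \x m)%E.-integrable setT f.
  apply/(integrable21ltyP _ _ mf).
  apply: (@le_lt_trans _ _ (\int[m]_z ((b z)%:E * leb (`[u, w]%classic : set R)))%E).
    apply: ge0_le_integral_lower => z _; first exact: integral_ge0.
    rewrite -integral_cst//.
    rewrite [leRHS]integral_mkcond; apply: ge0_le_integral_lower => // s _.
    rewrite patchE /f /= indicE; case: (s \in _); last by rewrite mul0r normr0.
    by rewrite mul1r lee_fin.
  have mb := measurable_int _ bi.
  rewrite ge0_integralZr//; last by move=> z _; rewrite lee_fin.
  apply: lte_mul_pinfty.
  - by apply: integral_ge0 => z _; rewrite lee_fin.
  - exact: integrable_fin_num.
  - have L := @lebesgue_measure_itv R `[u, w].
    by rewrite [X in (X < _)%E]L/=; case: ifP => _; rewrite -?EFinB ltry.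
have FE s : fubini_F m f s = ((fun s => \int[m]_z (k s z)%:E)%E \_ (`[u, w]%classic : set R)) s.
  rewrite /fubini_F /f patchE /= indicE; case: (s \in _).
    by apply: eq_integral => z _; rewrite mul1r.
  by apply: integral0_eq => z _; rewrite mul0r.
split.
  have := integrable_fubini_F fi.
  by rewrite (funext FE) -integrable_mkcond//.
rewrite [RHS]integral_mkcond -(funext FE) [RHS](Fubini fi).
apply: eq_integral => z _; rewrite [LHS]integral_mkcond; apply: eq_integral => s _.
rewrite patchE /f /= indicE.
by case: (s \in _); rewrite ?mul1r ?mul0r.
Qed.

End fubini_itv.

Section contraction.
Context {R : realType} {d : nat} {G : pfinType}.
Local Notation Rd := 'rV[R]_d.
Local Notation X := ('rV[R]_d * discr G)%type.
Local Notation leb := (@lebesgue_measure R).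
Variables (theta : mobility R d G) (K : G -> G -> R).
Hypothesis theta_ge0 : mobility_ge0 theta.
Hypothesis mtheta : mobility_measurable theta.
Hypothesis K_ge0 : forall g g', 0 <= K g g'.

(** The dilation of the [i]-th coordinate by [1 - t], written as a translation along a basis vector
    to match the directional derivatives of test functions. *)
Definition flatten_coord (i : 'I_d) (t : R) (x : Rd) : Rd :=
  x - (t * x 0 i) *: delta_mx 0 i.

Lemma flatten_coordE i t x j :
  flatten_coord i t x 0 j = (1 - (j == i)%:R * t) * x 0 j.
Proof.
by rewrite /flatten_coord !mxE eqxx /=; case: eqP => [->|_];
  rewrite ?mulr1n ?mulr0n; ring.
Qed.

Lemma flatten_coord0 i x : flatten_coord i 0 x = x.
Proof. by rewrite /flatten_coord mul0r scale0r subr0. Qed.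

Lemma measurable_flatten_coord_pair i : measurable_fun setT
  (fun p : R * Rd => flatten_coord i p.1 p.2).
Proof.
apply: measurable_fun_rV => j; under eq_fun do rewrite flatten_coordE.
apply: measurable_funM.
  apply: measurable_funB => //; exact: measurable_funM.
apply: (measurableT_comp (f := fun x : Rd => x 0 j)) => //.
by apply: continuous_measurable_fun_rV; exact: coord_continuous.
Qed.

Definition flatten_at i t (z : X) : X := (flatten_coord i t z.1, z.2).

Lemma measurable_flatten_at i t : measurable_fun setT (flatten_at i t).
Proof.
apply: measurable_fun_pair => //.
apply: (measurableT_comp (f := flatten_coord i t)) => //.
apply: (measurableT_comp (measurable_flatten_coord_pair i)
   (f := fun p : R * Rd => flatten_coord i p.1 p.2) (g := fun x : Rd => (t, x) : R * Rd)).
by apply: measurable_fun_pair => //; exact: measurable_cst.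
Qed.

HB.instance Definition _ i t :=
  isMeasurableFun.Build _ _ _ _ (flatten_at i t) (measurable_flatten_at i t).

Lemma is_derive_line (f : Rd -> R) (x e : Rd) (s : R) :
  derivable f (x + s *: e) e ->
  is_derive s (1 : R) (fun s => f (x + s *: e)) ('D_e f (x + s *: e)).
Proof.
move=> df.
have E (h : R) : h^-1 *: (f (x + (h *: 1 + s) *: e) - f (x + s *: e)) =
    h^-1 *: (f (h *: e + (x + s *: e)) - f (x + s *: e)).
  by rewrite [h *: 1]mulr1 scalerDl addrCA.
have H : h^-1 *: (f (x + (h *: 1 + s) *: e) - f (x + s *: e)) @[h --> (0 : R)^']
    --> ('D_e f (x + s *: e) : R).
  under eq_fun do rewrite E; exact: df.
apply: DeriveDef; first by apply/cvg_ex; eexists; exact: H.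
by apply/cvg_lim => //; exact: H.
Qed.

(* The factor [(1 - s)^-1 * (1 - s)] is [1] except at [s = 1], where it is [0]. *)
Lemma flatten_FTC i (f : Rd -> R) (x : Rd) (t : R) : is_Cn 1 f -> 0 <= t <= 1 ->
  (\int[leb]_(s in `[0%R, t])
     (- ((1 - s)^-1 * (1 - s)) * x 0 i *
      'D_(delta_mx 0 i) f (flatten_coord i s x))%:E =
   (f (flatten_coord i t x) - f x)%:E)%E.
Proof.
move=> [cf /(_ i)[df cdf]] /andP[t0 t1].
have [->|tN0] := eqVneq t 0.
  by rewrite set_itv1 integral_set1 flatten_coord0 subrr.
have tp : 0 < t by rewrite lt_def tN0.
pose u s := f (flatten_coord i s x).
pose k s := - x 0 i * 'D_(delta_mx 0 i) f (flatten_coord i s x).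
have lE s : flatten_coord i s x = x + (- (x 0 i) * s) *: delta_mx 0 i.
  by rewrite /flatten_coord -scaleNr mulNr mulrC.
have du s : is_derive s (1 : R) u (k s).
  rewrite /k lE.
  have D1 := is_derive_line (x := x) (s := - x 0 i * s) (df _).
  have D2 : is_derive s (1 : R) (fun s => - x 0 i * s) (- x 0 i).
    by apply: is_derive_eq; rewrite /GRing.scale /= mulr1.
  have := is_derive1_comp D1 D2.
  rewrite (_ : _ \o _ = u); last by apply/funext => y /=; rewrite /u lE.
  by rewrite mulrC.
have ck : continuous k.
  have cl : continuous (fun s : R => flatten_coord i s x).
    move=> s; rewrite (funext lE); apply: cvgD; first exact: cvg_cst.
    apply: cvgZr_tmp; apply: cvgM; [exact: cvg_cst|exact: cvg_id].
  move=> s; apply: cvgM; first exact: cvg_cst.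
  exact: (continuous_comp (cl s) (cdf _)).
have cu : continuous u.
  by move=> s; apply/differentiable_continuous/derivable1_diffP; have [] := du s.
transitivity (\int[leb]_(s in `[0%R, t]) (k s)%:E)%E.
  have mk : measurable_fun setT k by exact: continuous_measurable_fun.
  rewrite -[LHS]integral_itv_bndo_bndc; last first.
    apply/measurable_EFinP; apply: measurable_funTS.
    rewrite (_ : (fun _ => _) = (fun s => (1 - s)^-1 * (1 - s) * k s)).
      apply: measurable_funM => //; apply: measurable_funM.
        by apply: measurable_funV; exact: measurable_funB.
      exact: measurable_funB.
    by apply/funext => s; rewrite /k; ring.
  rewrite -[RHS]integral_itv_bndo_bndc; last first.
    by apply/measurable_EFinP; exact: measurable_funTS.
  apply: eq_integral => s; rewrite inE /= in_itv/= => /andP[_ st].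
  have s1 : 1 - s != 0 by rewrite subr_eq0 gt_eqF// (lt_le_trans st).
  by rewrite mulVf// /k; congr EFin; ring.
rewrite (@continuous_FTC2 _ k u 0 t tp).
- by rewrite EFinB /u flatten_coord0.
- exact: continuous_subspaceT.
- split=> [s _||]; first by have [] := du s.
  + exact/cvg_at_right_filter/cu.
  + exact/cvg_at_left_filter/cu.
- by move=> s _; rewrite derive1E; have [_ ->] := du s.
Qed.

Lemma sqnorm_flatten i t x : 0 <= t <= 1 ->
  sqnorm (flatten_coord i t x) <= sqnorm x.
Proof.
move=> /andP[t0 t1]; apply: ler_sum => j _; rewrite flatten_coordE exprMn.
rewrite -[leRHS]mul1r ler_wpM2r ?sqr_ge0// expr_le1//.
  by case: (j == i); rewrite ?mulr1n ?mulr0n ?mul1r ?mul0r; lra.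
by case: (j == i); rewrite ?mulr1n ?mulr0n ?mul1r ?mul0r; lra.
Qed.

(** A point whose initial [i]-th coordinate is a sits at y = (1 - t) a with velocity -a = -y/(1 -
    t); this is the gradient of -y^2/(2(1 - t)). At [t = 1] the inverse is 0 and so is the
    potential. *)
Definition slide (i : 'I_d) (t : R) (x : Rd) (g : G) : R :=
  - (2^-1 * (1 - t)^-1) * (x 0 i * x 0 i).

Lemma differentiable_slide i t g x : differentiable (slide i t ^~ g) x.
Proof.
apply: (@differentiableM _ _ (cst _) (fun x : Rd => x 0 i * x 0 i)) => //.
by apply: (@differentiableM _ _ (fun x : Rd => x 0 i) (fun x : Rd => x 0 i));
  exact: differentiable_coord.
Qed.

Lemma grad_slide i t g x : grad (slide i t ^~ g) x =
  (- (1 - t)^-1 * x 0 i) *: delta_mx 0 i.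
Proof.
apply/rowP => j; rewrite !mxE eqxx /=.
have D := is_derive_coord i j x.
have D2 : is_derive x (delta_mx 0 j : Rd) (fun y : Rd => y 0 i * y 0 i)
    (x 0 i * (i == j)%:R + x 0 i * (i == j)%:R).
  by apply: is_deriveM.
have D3 : is_derive x (delta_mx 0 j : Rd) (slide i t ^~ g)
    (- (2^-1 * (1 - t)^-1) * (x 0 i * (i == j)%:R + x 0 i * (i == j)%:R)).
  by apply: is_deriveZ.
by rewrite derive_val [in RHS]eq_sym; set c := (1 - t)^-1; field.
Qed.

Lemma dot_delta (u : Rd) (c : R) i : dot u (c *: delta_mx 0 i) = c * u 0 i.
Proof.
rewrite /dot (bigD1 i)//= big1 => [|j ji]; rewrite !mxE eqxx /=.
  by rewrite eqxx mulr1 addr0 mulrC.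
by rewrite (negbTE ji) !mulr0.
Qed.

Lemma sqnorm_delta (c : R) i : sqnorm (c *: delta_mx 0 i : Rd) = c ^+ 2.
Proof.
rewrite /sqnorm (bigD1 i)//= big1 => [|j ji]; rewrite !mxE eqxx /=.
  by rewrite eqxx mulr1 addr0.
by rewrite (negbTE ji) mulr0 expr0n.
Qed.

Lemma coord_sqnorm (x : Rd) i : x 0 i ^+ 2 <= sqnorm x.
Proof.
by rewrite /sqnorm (bigD1 i)//= lerDl sumr_ge0// => j _; exact: sqr_ge0.
Qed.

Lemma normr_coord_sqnorm (x : Rd) i : `|x 0 i| <= 1 + sqnorm x.
Proof.
apply: (@le_trans _ _ (1 + x 0 i ^+ 2)); last by rewrite lerD2l coord_sqnorm.
by rewrite -real_normK ?num_real//; nra.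
Qed.

Lemma integrable_sqnorm (m : probability X R) (a : R) : P2 m ->
  m.-integrable setT (fun z : X => (a * (1 + sqnorm z.1))%:E).
Proof.
move=> m2; rewrite (_ : (fun _ => _) =
  (fun z : X => a%:E * ((1 : R)%:E + (sqnorm z.1)%:E))%E); last first.
  by apply/funext => z; rewrite -EFinD -EFinM.
apply: integrableZl => //; apply: integrableD => //.
  exact: finite_measure_integrable_cst.
have ms : measurable_fun setT (fun z : X => sqnorm z.1).
  apply: measurableT_comp => //; exact: measurable_sqnorm.
apply/integrableP; split; first exact/measurable_EFinP.
under eq_integral do rewrite gee0_abs ?lee_fin ?sqnorm_ge0//.
exact: m2.
Qed.

Lemma P2_flatten i t (m : probability X R) : 0 <= t <= 1 -> P2 m ->
  P2 (distribution m (flatten_at i t)).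
Proof.
move=> t01 m2; rewrite /P2 ge0_integral_distribution; last 2 first.
- apply/measurable_EFinP; apply: measurableT_comp => //; exact: measurable_sqnorm.
- by move=> z; rewrite lee_fin sqnorm_ge0.
apply: le_lt_trans m2; apply: ge0_le_integral_lower => z _.
  by rewrite lee_fin sqnorm_ge0.
by rewrite lee_fin; exact: sqnorm_flatten.
Qed.

(** Before time 1 each point moves at the constant speed given by the size of its initial [i]-th
    coordinate, so the energy never exceeds the second moment of [m]. The continuity equation is the
    fundamental theorem of calculus along each trajectory, integrated by Fubini. *)
Lemma linked_flatten i (m : probability X R) : P2 m ->
  exists2 r, 0 < r & linked theta K r m (distribution m (flatten_at i 1)).
Proof.
move=> m2.
pose mu t : probability X R := distribution m (flatten_at i t).
pose z0 (t : R) (x : Rd) (g : G) : R := 0.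
have h0 t x g g' : grad_g (z0 t) x g g' = 0 by rewrite /grad_g subrr.
pose E := fine (\int[m]_z (sqnorm z.1)%:E)%E.
have EE : (\int[m]_z (sqnorm z.1)%:E = E%:E)%E.
  rewrite fineK// ge0_fin_numE//.
  by apply: integral_ge0 => z _; rewrite lee_fin sqnorm_ge0.
have E0 : 0 <= E.
  by rewrite fine_ge0//; apply: integral_ge0 => z _; rewrite lee_fin sqnorm_ge0.
(* The action is at most [E], and [E] is at most the square of [E + 1], which is positive even when
   [E] is 0. *)
exists (E + 1); first by rewrite ltr_wpDl.
have mc (j : 'I_d) : measurable_fun setT (fun x : Rd => x 0 j).
  by apply: continuous_measurable_fun_rV; exact: coord_continuous.
have driftE zeta t z : drift_of zeta (fun x g => grad (slide i t ^~ g) x) z =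
    - (1 - t)^-1 * z.1 0 i * 'D_(delta_mx 0 i) (zeta ^~ z.2) z.1.
  by rewrite /drift_of grad_slide dot_delta mxE.
have mflds t : measurable_fields (fun x g => grad (slide i t ^~ g) x) (grad_g (z0 t)).
  split=> [g j|g g'].
    under eq_fun do rewrite grad_slide mxE.
    by apply: measurable_funM => //; exact: measurable_funM.
  rewrite (_ : grad_g (z0 t) ^~ g ^~ g' = cst 0)//.
  by apply/funext => x; exact: h0.
exists mu, (slide i), z0; split.
- apply: regular_curveP.
  + by move=> t t01; exact: P2_flatten.
  + by move=> t _ g x; exact: differentiable_slide.
  + move=> g j; apply: measurable_funTS; under eq_fun do rewrite grad_slide mxE.
    apply: measurable_funM => //; apply: measurable_funM.
      apply: measurableT_comp => //; apply: measurable_funV.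
      exact: measurable_funB.
    exact: (measurableT_comp (mc i) measurable_snd).
  + move=> g g'; rewrite (_ : (fun _ => _) = cst 0); first exact: measurable_cst.
    by apply/funext => p; rewrite h0.
  + move=> t t01 zeta tz; have [M [C [M0 _ _ dM]]] := test_bound tz; split.
      apply: (le_integrable _ _ _ (integrable_sqnorm (`|(1 - t)^-1| * M)
        (P2_flatten i t01 m2))) => //.
        apply/measurable_EFinP; exact: measurable_drift tz (mflds t).
      move=> z _; rewrite /= lee_fin driftE !normrM normrN.
      rewrite (ger0_norm M0) normr_id (@ger0_norm _ (1 + _)); last first.
        by rewrite addr_ge0// sqnorm_ge0.
      rewrite -!mulrA ler_wpM2l// mulrC ler_pM//; last exact: normr_coord_sqnorm.
      by have [] := dM i z.1 z.2.
    rewrite hat_integralE integral0_eq// => x _; congr EFin.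
    rewrite /hat_int big1// => g _; rewrite big1// => g' _.
    by rewrite /reaction_of h0 mulr0 mul0r normr0 mul0r.
  + move=> zeta tz; have [M [C [M0 _ _ dM]]] := test_bound tz.
    (* The drift pulled back to the initial law: the singular factor of the velocity meets the
       contraction factor of the coordinate, so that [k] has a bound independent of time. *)
    pose k t (z : X) := - ((1 - t)^-1 * (1 - t)) * z.1 0 i *
      'D_(delta_mx 0 i) (zeta ^~ z.2) (flatten_coord i t z.1).
    have mH : measurable_fun setT
        (fun z : X => 'D_(delta_mx 0 i) (zeta ^~ z.2) z.1).
      apply: (measurable_fun_discr (f := fun x g => 'D_(delta_mx 0 i) (zeta ^~ g) x)).
      move=> g; apply: continuous_measurable_fun_rV.
      by have [_ /(_ i)[_]] := (tz g).1 1%N.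
    have mk : measurable_fun setT (fun p : R * X => k p.1 p.2).
      apply: measurable_funM.
        apply: measurable_funM.
          apply: measurableT_comp => //; apply: measurable_funM.
            apply: measurable_funV; exact: measurable_funB.
          exact: measurable_funB.
        apply: (measurableT_comp (mc i)).
        exact: (measurableT_comp measurable_fst measurable_snd).
      apply: (measurableT_comp mH
        (g := fun p : R * X => (flatten_coord i p.1 p.2.1, p.2.2) : X)).
      apply: measurable_fun_pair.
        apply: (measurableT_comp (measurable_flatten_coord_pair i)
          (g := fun p : R * X => (p.1, p.2.1))).
        apply: measurable_fun_pair => //.
        exact: (measurableT_comp measurable_fst measurable_snd).
      exact: (measurableT_comp measurable_snd measurable_snd).
    have kb t z : `|k t z| <= M * (1 + sqnorm z.1).
      rewrite /k !normrM mulrC; apply: ler_pM => //.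
        by have [] := dM i (flatten_coord i t z.1) z.2.
      rewrite -[leRHS]mul1r; apply: ler_pM => //; last exact: normr_coord_sqnorm.
      by rewrite normrN; have [->|N0] := eqVneq (1 - t) 0;
        rewrite ?mulr0 ?normr0// mulVf// normr1.
    have bi := integrable_sqnorm M m2.
    have km t : m.-integrable setT (EFin \o k t).
      apply: (le_integrable _ _ _ bi) => //.
        apply/measurable_EFinP.
        apply: (measurableT_comp mk (g := fun z : X => (t, z) : R * X)).
        by apply: measurable_fun_pair => //; exact: measurable_cst.
      move=> z _; rewrite /= lee_fin (le_trans (kb t z))//; exact: ler_norm.
    have rE t : curve_rate theta K mu (slide i) z0 zeta t = (\int[m]_z (k t z)%:E)%E.
      rewrite /curve_rate /rate_of hat_integralE [X in (_ + X)%E]integral0_eq; last first.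
        move=> x _; congr EFin; rewrite /hat_int big1// => g _.
        by rewrite big1// => g' _; rewrite /reaction_of h0 mulr0 !mul0r.
      have E1 : (EFin \o drift_of zeta (fun x g => grad (slide i t ^~ g) x)) \o
          flatten_at i t = EFin \o k t.
        apply/funext => z; congr EFin; rewrite driftE /= flatten_coordE eqxx mulr1n.
        by rewrite /k; ring.
      rewrite adde0 /mu integral_distribution ?E1//.
      apply/measurable_EFinP; exact: measurable_drift tz (mflds t).
    have [ki _] := fubini_itv 0 1 mk kb bi.
    split; first by rewrite (funext rE).
    move=> t t01; have [_ F] := fubini_itv 0 t mk kb bi.
    under [X in (_ + X)%E]eq_integral do rewrite rE.
    have tI t' : m.-integrable setT (fun z => (zeta (flatten_coord i t' z.1) z.2)%:E).
      have [M' [C' [_ _ zM' _]]] := test_bound tz.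
      apply: (@le_integrable _ _ _ _ _ measurableT _ (cst M'%:E)) => //.
      - apply/measurable_EFinP.
        apply: (measurableT_comp (measurable_test tz) (measurable_flatten_at i t')).
      - move=> z _; rewrite /= lee_fin (le_trans _ (ler_norm _))//.
        by have [] := zM' (flatten_coord i t' z.1) z.2.
      - exact: finite_measure_integrable_cst.
    have zE t' : (\int[mu t']_z (zeta z.1 z.2)%:E =
        \int[m]_z (zeta (flatten_coord i t' z.1) z.2)%:E)%E.
      rewrite /mu integral_distribution//; last exact: tI.
      apply/measurable_EFinP; exact: measurable_test.
    rewrite -F !zE -integralD//.
      apply: eq_integral => z _; rewrite flatten_FTC//; last exact: (tz z.2).1.
      by rewrite flatten_coord0 -EFinD addrC subrK.
    rewrite (_ : (fun _ => _) = (fun z => (zeta (flatten_coord i t z.1) z.2)%:E -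
      (zeta (flatten_coord i 0 z.1) z.2)%:E)%E); first exact: integrableB.
    apply/funext => z; rewrite flatten_FTC//; last exact: (tz z.2).1.
    by rewrite flatten_coord0 -EFinB.
- move=> A mA; rewrite -[LHS]/(m (flatten_at i 0 @^-1` A)).
  rewrite (_ : flatten_at i 0 = id)//.
  by apply/funext => z; rewrite /flatten_at flatten_coord0; case: z.
- by [].
- rewrite actionE.
  apply: (@le_trans _ _ (\int[leb]_(t in `[0%R, 1%R]) E%:E)%E).
    apply: ge0_le_integral_lower => t; rewrite /= in_itv/= => t01.
      exact: curve_energy_ge0.
    rewrite /curve_energy /energy_of hat_integralE [X in (_ + X)%E]integral0_eq;
        last first.
      move=> x _; congr EFin; rewrite /hat_int big1// => g _.
      by rewrite big1// => g' _; rewrite h0 expr0n !mul0r.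
    rewrite adde0 /mu ge0_integral_distribution; last 2 first.
    + by apply/measurable_EFinP; exact: measurable_sqnorm_field (mflds t).
    + by move=> z; rewrite lee_fin sqnorm_ge0.
    rewrite -EE; apply: ge0_le_integral_lower => z _; first by rewrite lee_fin sqnorm_ge0.
    rewrite lee_fin /= grad_slide sqnorm_delta; apply: le_trans (coord_sqnorm _ i).
    rewrite flatten_coordE eqxx mulr1n mul1r.
    have [->|N0] := eqVneq (1 - t) 0; first by rewrite mul0r mulr0 expr0n sqr_ge0.
    by rewrite mulrA mulNr mulVf// mulN1r sqrrN.
  by rewrite integral_cst01 lee_fin; nra.
Qed.

End contraction.

(** * Contraction to the origin and node weights *)

Section reach.
Context {R : realType} {d : nat} {G : pfinType}.
Local Notation Rd := 'rV[R]_d.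
Local Notation X := ('rV[R]_d * discr G)%type.
Local Notation leb := (@lebesgue_measure R).
Variables (theta : mobility R d G) (K : G -> G -> R).
Hypothesis theta_ge0 : mobility_ge0 theta.
Hypothesis mtheta : mobility_measurable theta.
Hypothesis K_ge0 : forall g g', 0 <= K g g'.
Implicit Types m n l : probability X R.

Definition reachable m n := exists2 r, 0 < r & linked theta K r m n.

Lemma reachable_refl m n : P2 m -> eq_law m n -> reachable m n.
Proof.
move=> m2 mn; exists 1 => //; have [mu [phi [psi [rc e0 e1 a]]]] := linked_refl theta K m2 mn.
exists mu, phi, psi; split=> //; apply: le_trans a _.
by rewrite expr0n expr1n lee_fin.
Qed.

Lemma reachable_sym m n : reachable m n -> reachable n m.
Proof. by move=> [r r0 rl]; exists r => //; exact: linked_sym. Qed.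

Lemma reachable_trans m n l : reachable m n -> reachable n l -> reachable m l.
Proof.
move=> [r r0 rl] [s s0 sl]; exists (r + s); first by rewrite addr_gt0.
exact: (linked_trans theta_ge0 mtheta K_ge0 r0 s0 rl sl).
Qed.

Definition flatten_all (s : seq 'I_d) (z : X) : X :=
  foldr (fun i => flatten_at i 1) z s.

Lemma flatten_allE (s : seq 'I_d) z :
  (forall j, (flatten_all s z).1 0 j = if j \in s then 0 else z.1 0 j) /\
  (flatten_all s z).2 = z.2.
Proof.
elim: s => [|i s [IH1 IH2]]; first by split.
split=> [j|]; last exact: IH2.
rewrite /= flatten_coordE IH1 inE mulr1.
case: eqP => [->|_]/=; first by rewrite mulr1n subrr mul0r.
by rewrite mulr0n subr0 mul1r.
Qed.

Lemma reachable_flatten (s : seq 'I_d) m : P2 m -> exists n, [/\ P2 n,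
  reachable m n & forall A, measurable A -> n A = m (flatten_all s @^-1` A)].
Proof.
move=> m2; elim: s => [|i s [n [n2 mn nE]]].
  by exists m; split=> //; exact: reachable_refl.
exists (distribution n (flatten_at i 1)); split.
- by apply: P2_flatten => //; rewrite ler01 lexx.
- apply: reachable_trans mn _; exact: linked_flatten.
- move=> A mA; rewrite -[LHS]/(n (flatten_at i 1 @^-1` A)) nE//.
  rewrite -[X in measurable X]setTI; exact: measurable_flatten_at.
Qed.

Lemma measurable_node (g : discr G) : measurable (@snd Rd (discr G) @^-1` [set g]).
Proof. by rewrite -[X in measurable X]setTI; exact: measurable_snd. Qed.

Lemma measure_nodes m (P : G -> Prop) :
  (m (@snd Rd (discr G) @^-1` [set g | P g]) =
   \sum_(g : G) if `[< P g >] then m (@snd Rd (discr G) @^-1` [set g]) else 0)%E.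
Proof.
transitivity (\sum_(g <- [seq g <- enum G | `[< P g >]])
    m (@snd Rd (discr G) @^-1` [set g]))%E; last first.
  by rewrite big_filter big_enum_cond [LHS]big_mkcond.
rewrite fsbig_seq ?filter_uniq//; last by rewrite -enumT enum_uniq.
rewrite -measure_fin_bigcup//.
- congr (m _); apply/seteqP; split => z /=.
    move=> Pz; exists z.2 => //=; rewrite mem_filter mem_enum andbT; exact/asboolP.
  by move=> [g /=]; rewrite mem_filter => /andP[/asboolP Pg _] ->.
- by move=> g h _ _ [z [/= -> ->]].
- by move=> g _; exact: measurable_node.
Qed.

Definition node_weight m (g : G) : R := fine (m (@snd Rd (discr G) @^-1` [set g])).

Lemma node_weightE m g : (node_weight m g)%:E = m (@snd Rd (discr G) @^-1` [set g]).
Proof.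
rewrite fineK// fin_num_measure//; exact: measurable_node.
Qed.

Fact node_weight_ge0 m g : 0 <= node_weight m g.
Proof. by rewrite fine_ge0. Qed.

Fact node_weight_sum m : \sum_g node_weight m g = 1.
Proof.
apply: EFin_inj; rewrite -sumEFin; under eq_bigr do rewrite node_weightE.
have := measure_nodes m (fun=> True); rewrite /= (_ : _ @^-1` _ = setT)//.
by rewrite probability_setT => ->; apply: eq_bigr => g _; rewrite asboolT.
Qed.

Definition node_law m : simplex R G :=
  Simplex (node_weight_ge0 m) (node_weight_sum m).

Lemma reachable_node_law m : P2 m ->
  reachable m (mix (dirac (0 : Rd)) (node_law m)).
Proof.
move=> m2; have [n [n2 mn nE]] := reachable_flatten (enum 'I_d) m2.
have fE z : flatten_all (enum 'I_d) z = (0, z.2).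
  have [E1 E2] := flatten_allE (enum 'I_d) z.
  rewrite [LHS]surjective_pairing E2; congr pair.
  by apply/rowP => j; rewrite E1 mem_enum mxE.
apply: reachable_trans mn _; apply: reachable_refl => // A mA.
rewrite nE//; transitivity (m (@snd Rd (discr G) @^-1` [set g | A (0, g)])).
  by congr (m _); apply/funext => z; rewrite /preimage /= fE.
rewrite measure_nodes /mix; apply: eq_bigr => g _; rewrite /= node_weightE.
rewrite diracE; case: asboolP => Ag.
  by rewrite mem_set// mule1.
by rewrite memNset// mule0.
Qed.

End reach.

(** * Motion of the node weights *)

(** This replaces the base of [hat mu], which under A0 is Lebesgue measure on the whole space, by
    the law [U] when the integrand vanishes off [Q]. *)
Lemma integral_supported (R : realType) (d' : measure_display)
    (T : measurableType d') (m1 m2 : {measure set T -> \bar R}) (Q : set T)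
    (F : T -> \bar R) : measurable Q ->
  (forall A, measurable A -> m1 (Q `&` A) = m2 A) ->
  (forall x, ~ Q x -> F x = 0%E) ->
  (\int[m1]_x F x = \int[m2]_x F x)%E.
Proof.
move=> mQ H F0.
have E (m : {measure set T -> \bar R}) : (\int[m]_x F x = \int[m]_(x in Q) F x)%E.
  rewrite [RHS]integral_mkcond; apply: eq_integral => x _; rewrite patchE.
  by case: ifPn => // xQ; apply: F0 => Qx; rewrite mem_set in xQ.
rewrite !E; apply: eq_measure_integral => A mA AQ.
by rewrite -H//; congr (m1 _); apply/esym/setIidPr.
Qed.

Lemma integral_2s (R : realType) (S t : R) : 0 <= t ->
  (@lebesgue_measure R).-integrable `[0, 1] (fun s => (2 * s * S)%:E) /\
  (\int[@lebesgue_measure R]_(s in `[0%R, t]) (2 * s * S)%:E = (t ^+ 2 * S)%:E)%E.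
Proof.
move=> t0.
have D (s : R) : is_derive s 1 (fun s : R => s ^+ 2 * S) (2 * s * S).
  apply: is_derive_eq; rewrite /GRing.scale /=; ring.
have cf : continuous (fun s : R => 2 * s * S).
  move=> s; apply: cvgM; last exact: cvg_cst.
  by apply: cvgM; [exact: cvg_cst|exact: cvg_id].
have cF : continuous (fun s : R => s ^+ 2 * S).
  by move=> s; apply/differentiable_continuous/derivable1_diffP; have [] := D s.
split.
  apply: continuous_compact_integrable; first exact: segment_compact.
  exact: continuous_subspaceT.
have [->|tN0] := eqVneq t 0.
  by rewrite set_itv1 integral_set1 expr0n mul0r.
have tp : 0 < t by rewrite lt_def tN0.
rewrite (@continuous_FTC2 _ _ (fun s : R => s ^+ 2 * S) 0 t tp).
- by rewrite expr0n mul0r sube0.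
- exact: continuous_subspaceT.
- split=> [s _||]; first by have [] := D s.
  + exact/cvg_at_right_filter/cF.
  + exact/cvg_at_left_filter/cF.
- by move=> s _; rewrite derive1E; have [_ ->] := D s.
Qed.

Section interpolation.
Context {R : realType} {G : pfinType}.
Variables p q : simplex R G.

(* [t ^+ 2] rather than [t]: the masses may vanish at [t = 0], and the conductances
   of the reaction curve then grow only like [t ^+ 2]. *)
Definition ramp (t : R) : R := Num.min 1 (t ^+ 2).

Lemma ramp_ge0 t : 0 <= ramp t.
Proof. by rewrite le_min ler01 sqr_ge0. Qed.

Lemma ramp_le1 t : ramp t <= 1.
Proof. by rewrite ge_min lexx. Qed.

Lemma rampE t : 0 <= t <= 1 -> ramp t = t ^+ 2.
Proof. by move=> /andP[t0 t1]; rewrite /ramp min_r// expr_le1. Qed.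

Lemma measurable_ramp : measurable_fun setT ramp.
Proof. by apply: measurable_minr => //; exact: measurable_funX. Qed.

Definition interp_weight t g := p g + ramp t * (q g - p g).

(** Since [ramp] is capped at 1, the weight is a convex combination at every real time, so [interp]
    is a total function of time. *)
Fact interp_ge0 t g : 0 <= interp_weight t g.
Proof.
rewrite (_ : interp_weight t g = (1 - ramp t) * p g + ramp t * q g); last first.
  by rewrite /interp_weight; ring.
by rewrite addr_ge0 ?mulr_ge0 ?weight_ge0 ?ramp_ge0// subr_ge0 ramp_le1.
Qed.

Fact interp_sum t : \sum_g interp_weight t g = 1.
Proof.
by rewrite big_split/= -mulr_sumr sumrB !weight_sum subrr mulr0 addr0.
Qed.

Definition interp t : simplex R G := Simplex (interp_ge0 t) (interp_sum t).

Lemma interp_lb t g : ramp t * q g <= interp t g.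
Proof.
rewrite (_ : weight (interp t) g = (1 - ramp t) * p g + ramp t * q g); last first.
  by rewrite /= /interp_weight; ring.
by rewrite lerDr mulr_ge0 ?weight_ge0// subr_ge0 ramp_le1.
Qed.

(** The time derivative of [interp_weight] on the unit interval, where [ramp t] is [t ^+ 2]. *)
Definition mass_rate t g : R := 2 * t * (q g - p g).

Lemma sum_mass_rate t : \sum_g mass_rate t g = 0.
Proof. by rewrite -mulr_sumr sumrB !weight_sum subrr mulr0. Qed.

End interpolation.

Section reaction_curve.
Context {R : realType} {d : nat} {G : pfinType}.
Local Notation Rd := 'rV[R]_d.
Local Notation X := ('rV[R]_d * discr G)%type.
Local Notation leb := (@lebesgue_measure R).
Variables (theta : mobility R d G) (K : G -> G -> R).
Hypothesis theta_ge0 : mobility_ge0 theta.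
Hypothesis mtheta : mobility_measurable theta.
Hypothesis K_ge0 : forall g g', 0 <= K g g'.
Hypothesis connK : connected_graph K.
Hypothesis A0A15 : A0 theta \/ A15 theta.
Hypothesis hlf : hat_locally_finite theta.
(** These data cover both cases: under A0, [Q] is the unit cube and [U] its uniform law; under
    A1-A5, [Q] is the origin and [U] the Dirac law there. On [Q] the base of [hat mu] is [U], and
    the density is computed from the interpolated weights. *)
Variables (U : probability Rd R) (p q : simplex R G) (Q : set Rd) (c : R).
Hypothesis mQ : measurable Q.
Hypothesis c0 : 0 < c.
Hypothesis U2 : (\int[U]_x (sqnorm x)%:E < +oo)%E.
Local Notation mu := (fun t => mix U (interp p q t)).
Hypothesis hatQ : forall t A, 0 <= t <= 1 -> measurable A ->
  hat_measure theta (mu t) (Q `&` A) = U A.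
Local Notation dens t x g g' := (theta x g g' (interp p q t g) (interp p q t g')).
Hypothesis densE : forall t x g g', 0 <= t <= 1 -> Q x ->
  hat_density theta (mu t) x g g' = dens t x g g'.
Hypothesis dens_lb : forall t x g g', 0 <= t <= 1 -> Q x ->
  c * t ^+ 2 <= dens t x g g'.

Definition conductance t x (g g' : G) : R := K g g' * dens t x g g'.

(** At each point of [Q], the solution of the graph Laplace equation whose source is the rate of
    change of the weights. The indicator removes the reaction where the base of [hat mu] may differ
    from [U]. *)
Definition reaction_potential t x g : R :=
  \1_Q x * potential (conductance t x) (mass_rate p q t) g.

(** At time 1/2 the factor [2 * t] is 1, so [F1] is the difference of the weights. The source at
    time [t] is [2 * t] times it, whose [K]-energy carries the factor 4 t^2; conductances of at
    least c t^2 times [K] divide this by c t^2, which leaves the factor 4 / c. *)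
Let F1 := mass_rate p q 2^-1.

Definition reaction_constant : R :=
  4 * dirichlet K (potential K F1) (potential K F1) / c.

Lemma conductance_ge0 t x g g' : 0 <= conductance t x g g'.
Proof. by rewrite mulr_ge0// theta_ge0// weight_ge0. Qed.

Lemma measurable_interp g : measurable_fun setT (fun t => interp p q t g).
Proof.
by apply: measurable_funD => //; apply: measurable_funM => //; exact: measurable_ramp.
Qed.

Lemma measurable_reaction_potential g : measurable_fun setT
  (fun s : R * Rd => reaction_potential s.1 s.2 g).
Proof.
have mI : measurable_fun setT (\1_Q : Rd -> R) by apply: measurable_indic.
have mi h : measurable_fun setT (fun s : R * Rd => interp p q s.1 h).
  exact: (measurableT_comp (measurable_interp h) measurable_fst).
apply: measurable_funM; first exact: (measurableT_comp mI measurable_snd).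
apply: (measurable_potential (W := fun s : R * Rd => conductance s.1 s.2)
  (f := fun s : R * Rd => mass_rate p q s.1)) => [h h'|h].
  apply: measurable_funM => //; apply: measurable_theta_comp => // s _;
    exact: weight_ge0.
by apply: measurable_funM => //; apply: measurable_funM.
Qed.

(** For positive [t] the conductances are positive on the edges of [K] and the source has zero sum,
    so the Laplace equation is solvable. At [t = 0] the conductances may degenerate, but the source
    vanishes and the potential is 0. *)
Lemma dirichlet_reaction t x z : 0 <= t <= 1 -> Q x ->
  dirichlet (conductance t x) z (reaction_potential t x) =
  \sum_g z g * mass_rate p q t g.
Proof.
move=> t01 Qx.
have rE : reaction_potential t x = potential (conductance t x) (mass_rate p q t).
  by apply/funext => g; rewrite /reaction_potential indicE mem_set// mul1r.
have [t0|tN0] := eqVneq t 0.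
  have f0 : mass_rate p q t = fun=> 0.
    by apply/funext => g; rewrite /mass_rate t0 mulr0 mul0r.
  rewrite rE f0 (_ : potential _ _ = fun=> 0); last first.
    by apply/funext => g; exact: potential0.
  by rewrite dirichletC dirichlet_cst big1// => g _; rewrite mulr0.
rewrite rE; apply: (potentialP (K := K)).
- exact: conductance_ge0.
- move=> g g' Kp; rewrite /conductance mulr_gt0//.
  apply: lt_le_trans (dens_lb _ _ t01 Qx); rewrite mulr_gt0// exprn_gt0//.
  by rewrite lt_def tN0; case/andP : t01.
- exact: connK.
- exact: sum_mass_rate.
Qed.

(** The comparison potential is [2 * t * chi], which solves the equation with weights [K] and the
    same source; the powers of [t] cancel. *)
Lemma dirichlet_reaction_le t x : 0 <= t <= 1 -> Q x ->
  dirichlet (conductance t x) (reaction_potential t x) (reaction_potential t x)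
  <= reaction_constant.
Proof.
move=> t01 Qx; have D := dirichlet_reaction _ t01 Qx.
have [t0|tN0] := eqVneq t 0.
  rewrite D big1 => [|g _]; last by rewrite /mass_rate t0 mulr0 mul0r mulr0.
  by rewrite mulr_ge0 ?invr_ge0 ?(ltW c0)// mulr_ge0// dirichlet_ge0.
have tp : 0 < t by rewrite lt_def tN0; case/andP : t01.
pose chi := potential K F1.
have chiP z : dirichlet K z chi = \sum_g z g * F1 g.
  by apply: (potentialP (K := K)) => //; exact: sum_mass_rate.
have chiP2 z : dirichlet K z (fun g => 2 * t * chi g) =
    \sum_g z g * mass_rate p q t g.
  rewrite dirichletC.
  have := dirichlet_suml K (fun _ : 'I_1 => 2 * t) (fun=> chi) z.
  rewrite big_ord1 (_ : (fun g => \sum_(i < 1) _) = (fun g => 2 * t * chi g)); last first.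
    by apply/funext => g; rewrite big_ord1.
  move=> ->; rewrite dirichletC chiP mulr_sumr; apply: eq_bigr => g _.
  by rewrite /F1 /mass_rate; field.
have ct0 : 0 < c * t ^+ 2 by rewrite mulr_gt0// exprn_gt0.
have cK g g' : c * t ^+ 2 * K g g' <= conductance t x g g'.
  by rewrite mulrC ler_wpM2l// dens_lb.
apply: le_trans (potential_energy ct0 K_ge0 cK chiP2 D) _.
rewrite chiP2 /reaction_constant chiP le_eqVlt; apply/orP; left; apply/eqP.
rewrite (_ : \sum_g _ * _ = 4 * t ^+ 2 * \sum_g chi g * F1 g).
  by rewrite /F1; field; rewrite tN0 gt_eqF.
by rewrite mulr_sumr; apply: eq_bigr => g _; rewrite /F1 /mass_rate; field.
Qed.

Lemma hat_int_conductance t (y z : Rd -> G -> R) x : 0 <= t <= 1 -> Q x ->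
  hat_int theta (mu t) (fun x g g' => grad_g y x g g' * grad_g z x g g' * K g g') x =
  dirichlet (conductance t x) (y x) (z x).
Proof.
move=> t01 Qx; apply: eq_bigr => g _; apply: eq_bigr => g' _.
by rewrite densE// /conductance /grad_g mulrA.
Qed.

Lemma reaction_potential_off t x g : ~ Q x -> reaction_potential t x g = 0.
Proof. by move=> Qx; rewrite /reaction_potential indicE memNset// mul0r. Qed.

(** Mass moves only between nodes, at fixed positions. The weak Laplace equation, tested at each
    point of [Q] with [zeta x], yields exactly the derivative of the weights; integrability of the
    reaction follows from the energy bound and the hat mass of the support. *)
Lemma linked_reaction : reachable theta K (mix U p) (mix U q).
Proof.
pose psi := reaction_potential.
pose z0 (t : R) (x : Rd) (g : G) : R := 0.
have g0 t x g : grad (z0 t ^~ g) x = 0 by exact: grad_cst.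
have C0 : 0 <= reaction_constant.
  by rewrite mulr_ge0 ?invr_ge0 ?(ltW c0)// mulr_ge0// dirichlet_ge0.
have mu2 t : P2 (mu t) by rewrite /P2 integral_sqnorm_mix.
have mpsi g g' t : measurable_fun setT (fun x => grad_g (psi t) x g g').
  have mt (h : G) : measurable_fun setT (fun x => psi t x h).
    apply: (measurableT_comp (measurable_reaction_potential h)
      (g := fun x : Rd => (t, x) : R * Rd)).
    by apply: measurable_fun_pair => //; exact: measurable_cst.
  by apply: measurable_funB; exact: mt.
have mflds t : measurable_fields (fun x g => grad (z0 t ^~ g) x) (grad_g (psi t)).
  split=> [g i|g g']; last exact: mpsi.
  rewrite (_ : (fun _ => _) = cst 0); first exact: measurable_cst.
  by apply/funext => x; rewrite g0 mxE.
have poff t x g g' : ~ Q x -> grad_g (psi t) x g g' = 0.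
  by move=> nQx; rewrite /grad_g /psi !reaction_potential_off// subrr.
have enE t : 0 <= t <= 1 -> (hat_integral theta (mu t) setT
    (fun x g g' => grad_g (psi t) x g g' ^+ 2 * K g g')%R <= reaction_constant%:E)%E.
  move=> t01; rewrite hat_integralE (integral_supported mQ (fun A => @hatQ t A t01)).
    apply: (@le_trans _ _ (\int[U]_x reaction_constant%:E)%E).
      apply: ge0_le_integral_lower => x _.
        by rewrite lee_fin hat_int_ge0// => g g'; rewrite mulr_ge0// sqr_ge0.
      rewrite lee_fin; have [Qx|nQx] := pselect (Q x).
        by rewrite hat_int_conductance//; exact: dirichlet_reaction_le.
      rewrite /hat_int big1// => g _; rewrite big1// => g' _.
      by rewrite poff// expr0n !mul0r.
    by rewrite integral_cst_prob.
  move=> x nQx; congr EFin; rewrite /hat_int big1// => g _; rewrite big1// => g' _.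
  by rewrite poff// expr0n !mul0r.
exists (reaction_constant + 1); first by rewrite ltr_wpDl.
exists mu, z0, psi; split.
- apply: regular_curveP.
  + by move=> t _; exact: mu2.
  + by move=> t _ g x; exact: differentiable_cst.
  + move=> g i; rewrite (_ : (fun _ => _) = cst 0); first exact: measurable_cst.
    by apply/funext => s; rewrite g0 mxE.
  + move=> g g'; apply: measurable_funTS.
    by apply: measurable_funB; exact: measurable_reaction_potential.
  + move=> t t01 zeta tz; split.
      rewrite (_ : EFin \o _ = cst 0%E); first exact: integrable0.
      apply/funext => z; congr EFin; rewrite /drift_of /dot big1// => i _.
      by rewrite g0 [X in _ * X]mxE mulr0.
    have [M [C [M0 cC zM _]]] := test_bound tz.
    (* By Young's inequality the reaction is dominated by a multiple of the hat mass of the support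
       of [zeta], finite by this bound, plus the energy. *)
    have [B BP] := uniform_hat_bound theta_ge0 mtheta K_ge0 A0A15 hlf cC (mu2 0).
    have mC := measurable_compact cC.
    pose P (x : Rd) := 4 * M ^+ 2 * (hat_int theta (mu t) (fun _ g g' => K g g') x * \1_C x).
    pose E := hat_int theta (mu t) (fun x g g' => grad_g (psi t) x g g' ^+ 2 * K g g').
    have P0 x : 0 <= P x.
      by rewrite mulr_ge0// ?mulr_ge0 ?sqr_ge0// hat_int_ge0.
    have E0 x : 0 <= E x.
      by rewrite hat_int_ge0// => g g'; rewrite mulr_ge0// sqr_ge0.
    have mP : measurable_fun setT P.
      apply: measurable_funM => //; apply: measurable_funM; first exact: measurable_hat_int.
      exact: measurable_indic.
    have mE : measurable_fun setT E.
      apply: measurable_hat_int => // g g'.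
      by apply: measurable_funM => //; exact: measurable_funX.
    rewrite hat_integralE.
    apply: (@le_lt_trans _ _ (\int[hat_measure theta (mu t)]_x ((P x)%:E + (E x)%:E))%E).
      apply: ge0_le_integral_lower => x _; first by rewrite lee_fin hat_int_ge0.
      rewrite -EFinD lee_fin /P /E /hat_int mulrA mulrC !mulr_sumr -big_split/=.
      apply: ler_sum => g _; rewrite !mulr_sumr -big_split/=; apply: ler_sum => g' _.
      have D0 := hat_density_ge0 theta_ge0 (mu t) x g g'.
      have H : `|grad_g zeta x g g' * grad_g (psi t) x g g'| <=
          4 * M ^+ 2 * \1_C x + grad_g (psi t) x g g' ^+ 2.
        apply: le_trans (young _ _ ltr01) _; rewrite invr1 !mul1r.
        apply: (@le_trans _ _ (grad_g zeta x g g' ^+ 2 + grad_g (psi t) x g g' ^+ 2)).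
          by rewrite ler_piMl ?addr_ge0 ?sqr_ge0// invf_le1// ler1n.
        rewrite lerD2r indicE; have [Cx|Cx] := boolP (x \in C).
          rewrite mulr1 (_ : 4 * M ^+ 2 = (M + M) ^+ 2); last by ring.
          rewrite normr_sqr_le//; apply: le_trans (ler_normB _ _) _.
          by apply: lerD; [have [] := zM x g'|have [] := zM x g].
        have nCx : ~ C x by move=> Cx'; rewrite mem_set in Cx.
        by rewrite /grad_g (zM x g').2// (zM x g).2// subrr expr0n mulr0.
      rewrite /reaction_of normrM (ger0_norm (K_ge0 _ _)).
      set D := hat_density _ _ _ _ _ in D0 *; set b := grad_g (psi t) x g g' in H *.
      apply: (@le_trans _ _ ((4 * M ^+ 2 * \1_C x + b ^+ 2) * (K g g' * D))).
        by rewrite -[leLHS]mulrA; apply: ler_wpM2r => //; rewrite mulr_ge0.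
      by rewrite le_eqVlt; apply/orP; left; apply/eqP; ring.
    rewrite ge0_integralD//; last 4 first.
    * by move=> x _; rewrite lee_fin.
    * exact/measurable_EFinP.
    * by move=> x _; rewrite lee_fin.
    * exact/measurable_EFinP.
    apply: lte_add_pinfty; last first.
      by have := enE t t01; rewrite hat_integralE => /le_lt_trans; apply; rewrite ltry.
    rewrite /P; under eq_integral do rewrite EFinM.
    rewrite ge0_integralZl//; last 3 first.
    * apply/measurable_EFinP; apply: measurable_funM; first exact: measurable_hat_int.
      exact: measurable_indic.
    * by move=> x _; rewrite lee_fin mulr_ge0// hat_int_ge0.
    * by rewrite lee_fin mulr_ge0// sqr_ge0.
    apply: lte_mul_pinfty => //; first by rewrite lee_fin mulr_ge0// sqr_ge0.
    have := BP (mu t); rewrite hat_integralE => BPt.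
    apply: le_lt_trans (ltry B); apply: le_trans BPt.
    rewrite [leRHS]integral_mkcond le_eqVlt; apply/orP; left; apply/eqP.
    apply: eq_integral => x _; rewrite patchE indicE.
    by case: (x \in C); rewrite ?mulr1 ?mulr0.
  + move=> zeta tz.
    have [M [C [M0 cC zM _]]] := test_bound tz.
    pose Z g := fine (\int[U]_x (zeta x g)%:E)%E.
    have zi g : U.-integrable setT (fun x => (zeta x g)%:E).
      apply: (@le_integrable _ _ _ _ _ measurableT _ (cst M%:E)) => //.
      - apply/measurable_EFinP; apply: continuous_measurable_fun_rV.
        exact: (tz g).1 0%N.
      - move=> x _; rewrite /= lee_fin (le_trans _ (ler_norm _))//.
        by have [] := zM x g.
      - exact: finite_measure_integrable_cst.
    have ZE g : (\int[U]_x (zeta x g)%:E = (Z g)%:E)%E.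
      by rewrite fineK//; exact: integrable_fin_num.
    pose S := \sum_g Z g * (q g - p g).
    have muE t : (\int[mu t]_z (zeta z.1 z.2)%:E =
        (\sum_g Z g * p g + ramp t * S)%:E)%E.
      rewrite (@integral_mix_bounded _ _ _ U (interp p q t) (fun z => zeta z.1 z.2) M).
      + under eq_bigr do rewrite /= ZE -EFinM.
        rewrite sumEFin; congr EFin; rewrite /S mulr_sumr -big_split/=.
        by apply: eq_bigr => g _; rewrite /interp_weight; ring.
      + exact: measurable_test.
      + by move=> z; have [] := zM z.1 z.2.
    have rE t : 0 <= t <= 1 -> curve_rate theta K mu z0 psi zeta t =
        (2 * t * S)%:E.
      move=> t01; rewrite /curve_rate /rate_of [X in (X + _)%E]integral0_eq; last first.
        move=> z _; congr EFin; rewrite /drift_of /dot big1// => i _.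
        by rewrite g0 [X in _ * X]mxE mulr0.
      rewrite add0e hat_integralE (integral_supported mQ (fun A => @hatQ t A t01)); last first.
        move=> x nQx; congr EFin; rewrite /hat_int big1// => g _; rewrite big1// => g' _.
        by rewrite /reaction_of poff// mulr0 !mul0r.
      have mz g : measurable_fun setT (fun x => zeta x g).
        apply: continuous_measurable_fun_rV; exact: (tz g).1 0%N.
      transitivity (\int[U]_x (\sum_g (mass_rate p q t g)%:E * (zeta x g)%:E))%E.
        apply: ae_eq_integral => //.
        - apply/measurable_EFinP; apply: measurable_hat_int => // g g'.
          exact: measurable_reaction tz (mflds t).
        - apply: emeasurable_sum => g; apply: emeasurable_funM => //.
          exact/measurable_EFinP.
        (* The law [U] does not charge the complement of [Q]: [hatQ] applied to that complement
           gives the measure of the empty set. *)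
        - exists (~` Q); split.
          + exact: measurableC.
          + have UQ := hatQ t01 (measurableC mQ).
            rewrite setICr measure0 in UQ; exact: (esym UQ).
          + move=> x /= /not_implyP[_ ne] Qx; apply: ne.
            transitivity (\sum_g mass_rate p q t g * zeta x g)%:E; last first.
              by rewrite -sumEFin.
            congr EFin.
            rewrite [LHS](hat_int_conductance zeta (psi t) t01 Qx) dirichlet_reaction//.
            by apply: eq_bigr => g _; rewrite mulrC.
      rewrite integral_sum//; last by move=> g; exact: integrableZl.
      under eq_bigr do rewrite integralZl// ZE -EFinM.
      rewrite sumEFin; congr EFin; rewrite /S mulr_sumr; apply: eq_bigr => g _.
      by rewrite /mass_rate; ring.
    have [si _] := integral_2s S ler01.
    split.
      by apply: eq_integrable_in si => // t; rewrite /= in_itv/= => t01; rewrite rE.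
    move=> t /[dup] t01 /andP[t0 t1]; rewrite !muE rampE// rampE ?lexx ?ler01//.
    have [_ sI] := integral_2s S t0.
    rewrite expr0n mul0r addr0 EFinD -sI; congr (_ + _)%E.
    apply: eq_integral => s; rewrite inE /= in_itv/= => /andP[s0 st].
    by rewrite rE// s0 (le_trans st).
- move=> A mA; apply: eq_bigr => g _.
  by rewrite /= /interp_weight rampE ?lexx ?ler01// expr0n mul0r addr0.
- move=> A mA; apply: eq_bigr => g _.
  by rewrite /= /interp_weight rampE ?lexx ?ler01// expr1n mul1r addrC subrK.
- rewrite actionE.
  apply: (@le_trans _ _ (\int[leb]_(t in `[0%R, 1%R]) reaction_constant%:E)%E).
    apply: ge0_le_integral_lower => t; rewrite /= in_itv/= => t01.
      exact: curve_energy_ge0.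
    rewrite /curve_energy /energy_of [X in (X + _)%E]integral0_eq; last first.
      move=> z _; congr EFin; rewrite /sqnorm big1// => i _.
      by rewrite g0 mxE expr0n.
    by rewrite add0e; exact: enE.
  by rewrite integral_cst01 lee_fin; nra.
Qed.

End reaction_curve.

(** * The uniform law of the unit cube *)

Section cube.
Context {R : realType}.

Definition cube d : set 'rV[R]_d := [set x | forall j, 0 <= x 0 j <= 1].

Lemma measurable_cube d : measurable (@cube d).
Proof. by apply: measurable_compact; exact: compact_box. Qed.

Lemma lebesgue_cube d : lebesgue_rV d (@cube d) = 1%E.
Proof.
elim: d => [|d IH] /=.
  by rewrite diracE mem_set// => -[].
rewrite -[LHS]/((@lebesgue_measure R \x lebesgue_rV d)%E (@rV_cons R d @^-1` @cube d.+1)).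
rewrite (_ : _ @^-1` _ = (`[0, 1]%classic : set R) `*` @cube d).
  rewrite product_measure1E//; last exact: measurable_cube.
  rewrite IH mule1; have L := @lebesgue_measure_itv R `[0, 1].
  by rewrite [LHS]L/= lte_fin ltr01 oppr0 adde0.
apply/seteqP; split => -[a y] /=.
  move=> h; split=> [|j].
    have := h 0; rewrite (_ : rV_cons _ 0 0 = a) ?in_itv//.
    by have := congr1 fst (rV_consK (a, y)).
  have := h (lift 0 j); rewrite (_ : rV_cons _ 0 _ = y 0 j)//.
  by have := congr1 (fun q : R * 'rV[R]_d => q.2 0 j) (rV_consK (a, y)); rewrite /= mxE.
rewrite in_itv/= => -[a01 h] j; case: (unliftP 0 j) => [k ->|->].
  rewrite (_ : rV_cons _ 0 _ = y 0 k)//.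
  by have := congr1 (fun q : R * 'rV[R]_d => q.2 0 k) (rV_consK (a, y)); rewrite /= mxE.
rewrite (_ : rV_cons _ 0 0 = a)//.
by have := congr1 fst (rV_consK (a, y)).
Qed.

Section uniform.
Variable d : nat.

Definition uniform_cube : set 'rV[R]_d -> \bar R :=
  mrestr (lebesgue_rV d) (@measurable_cube d).

HB.instance Definition _ := Measure.on uniform_cube.

Let uniform_cube_setT : uniform_cube setT = 1%E.
Proof. by rewrite /uniform_cube /mrestr setTI lebesgue_cube. Qed.

HB.instance Definition _ :=
  Measure_isProbability.Build _ _ _ uniform_cube uniform_cube_setT.

End uniform.

End cube.

(** * A common law reachable from all others *)

Section finiteness.
Context {R : realType} {d : nat} {G : pfinType}.
Local Notation Rd := 'rV[R]_d.
Local Notation X := ('rV[R]_d * discr G)%type.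
Variables (theta : mobility R d G) (K : G -> G -> R).
Hypothesis theta_ge0 : mobility_ge0 theta.
Hypothesis mtheta : mobility_measurable theta.
Hypothesis K_ge0 : forall g g', 0 <= K g g'.
Hypothesis connK : connected_graph K.
Hypothesis hlf : hat_locally_finite theta.
Local Notation unif := (@uniform_simplex R G).

(** Both laws have the same node weights, so both contract to the same product at the origin; the
    second contraction is run backwards. *)
Lemma reachable_mix (U : probability Rd R) m : P2 m ->
  (\int[U]_x (sqnorm x)%:E < +oo)%E ->
  reachable theta K m (mix U (node_law m)).
Proof.
move=> m2 U2; have mixU2 : P2 (mix U (node_law m)) by rewrite /P2 integral_sqnorm_mix.
apply: (reachable_trans theta_ge0 mtheta K_ge0
  (reachable_node_law theta_ge0 mtheta K_ge0 m2)).
apply: (reachable_sym theta_ge0 mtheta K_ge0).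
apply: (reachable_trans theta_ge0 mtheta K_ge0
  (reachable_node_law theta_ge0 mtheta K_ge0 mixU2)).
apply: reachable_refl.
  rewrite /P2 integral_sqnorm_mix; apply: (@integral_sqnorm_lty _ _ _ [set 0]).
    exact: compact_set1.
  by rewrite /= diracE memNset// => /(_ erefl).
move=> A mA; apply: eq_bigr => g _; congr (_%:E * _)%E.
rewrite /= /node_weight -[fine _]/(fine (mix U (node_law m) _)) /mix.
rewrite (bigD1 g)//= big1 => [|h hg].
  rewrite adde0 (_ : _ @^-1` _ = setT) ?probability_setT ?mule1//.
  by apply/seteqP; split.
rewrite (_ : _ @^-1` _ = set0) ?measure0 ?mule0//.
by apply/seteqP; split => // x /= hg'; rewrite hg' eqxx in hg.
Qed.

(** The uniform target keeps every weight at least a = t^2/|G|. Monotonicity and homogeneity then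
    bound the mobility below by a theta(1, 1), and A5 keeps theta(1, 1) away from 0 at the
    origin. *)
Lemma A15_dens_lb (p : simplex R G) : A15 theta -> exists2 c : R, 0 < c &
  forall t x g g', 0 <= t <= 1 -> [set (0 : Rd)] x ->
  c * t ^+ 2 <= theta x g g' (interp p unif t g) (interp p unif t g').
Proof.
move=> a15; have [_ _ _ _ /(_ [set 0] (@compact_set1 _ _))[_ [c c0 cP]]] := a15.
have k0 : 0 < #|G|%:R^-1 :> R by rewrite invr_gt0 ltr0n; exact: card_pfin_gt0.
exists (#|G|%:R^-1 * c); first by rewrite mulr_gt0.
move=> t x g g' t01 x0; set a := t ^+ 2 / #|G|%:R.
have a0 : 0 <= a by rewrite mulr_ge0 ?sqr_ge0// ltW.
have aP h : a <= interp p unif t h.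
  by apply: le_trans (interp_lb p unif t h); rewrite rampE.
apply: (@le_trans _ _ (theta x g g' a a)); last by apply: A15_mono.
rewrite A15_diag// /a mulrC mulrA ler_wpM2l// ?cP//.
Qed.

(** Under A0 the mobility is bounded below on the cube by a constant, hence by that constant times
    [t ^+ 2] for times in the unit interval. Under A1-A5 the atom at the origin makes the
    conditional weights equal to the interpolated ones. *)
Lemma reachable_uniform : A0 theta \/ A15 theta -> exists l, forall m, P2 m ->
  reachable theta K m l.
Proof.
move=> a; suff [U [U2 H]] : exists U : probability Rd R,
    (\int[U]_x (sqnorm x)%:E < +oo)%E /\
    forall p, reachable theta K (mix U p) (mix U unif).
  exists (mix U unif) => m m2.
  apply: (reachable_trans theta_ge0 mtheta K_ge0 (reachable_mix m2 U2)).
  exact: H.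
case: (a) => [a0|a15].
  have cC : compact (@cube R d) by exact: compact_box.
  have mC := measurable_compact cC.
  have U2 : (\int[@uniform_cube R d]_x (sqnorm x)%:E < +oo)%E.
    apply: (integral_sqnorm_lty cC).
    by rewrite /= /uniform_cube /mrestr setICl measure0.
  have [_ ec _ /(_ _ cC)[c c0 cP]] := a0.
  pose V : probability Rd R := @uniform_cube R d.
  exists V; split=> // p.
  apply: (@linked_reaction _ _ _ _ _ theta_ge0 mtheta K_ge0 connK a hlf V p unif _ _ mC c0 U2).
  - move=> t A _ mA; rewrite /hat_measure asboolT//.
    by rewrite /= /uniform_cube /mrestr setIC.
  - move=> t x g g' t01 _; apply: ec; try exact: weight_ge0.
      by have [_ /(_ x)/andP[]] := conditionalP (mix V (interp p unif t)) g.
    by have [_ /(_ x)/andP[]] := conditionalP (mix V (interp p unif t)) g'.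
  - move=> t x g g' /andP[t0 t1] Cx.
    apply: (@le_trans _ _ c); last by apply: cP => //; exact: weight_ge0.
    by rewrite ler_piMr ?(ltW c0)// expr_le1.
pose U : probability Rd R := dirac (0 : Rd).
have U2 : (\int[U]_x (sqnorm x)%:E < +oo)%E.
  apply: (@integral_sqnorm_lty _ _ _ [set 0]); first exact: compact_set1.
  by rewrite /U /= diracE memNset// => /(_ erefl).
exists U; split=> // p; have [c c0 cP] := A15_dens_lb p a15.
have m0 := measurable_set1_rV (0 : Rd).
apply: (@linked_reaction _ _ _ _ _ theta_ge0 mtheta K_ge0 connK a hlf U p unif _ _ m0 c0 U2).
- move=> t A _ mA; rewrite A15_hat_measure//.
  rewrite -[LHS]/(marginal (mix U (interp p unif t)) _) marginal_mix /U /= !diracE.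
  by congr (_%:R%:E); rewrite in_setI mem_set.
- move=> t x g g' _ ->; rewrite /hat_density !conditional_mix//.
  + by rewrite /U /= diracE mem_set// oner_neq0.
  + by rewrite /U /= diracE mem_set// oner_neq0.
- exact: cP.
Qed.

End finiteness.

Theorem theorem2p7 (R : realType) (d : nat) (G : pfinType)
    (K : G -> G -> R) (theta : mobility R d G) :
  (forall g g', 0 <= K g g') ->
  (forall g g', K g g' = K g' g) ->
  connected_graph K ->
  mobility_ge0 theta ->
  mobility_measurable theta ->
  hat_locally_finite theta ->
  A0 theta \/ A15 theta ->
  metric_on_P2 (W2 theta K).
Proof.
move=> K_ge0 _ connK theta_ge0 mtheta hlf a.
have [l lP] := reachable_uniform theta_ge0 mtheta K_ge0 connK hlf a.
apply: W2_pseudometric => // m n m2 n2.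
apply: (reachable_trans theta_ge0 mtheta K_ge0 (lP m m2)).
by apply: (reachable_sym theta_ge0 mtheta K_ge0); exact: lP.
Qed.
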